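(* Let $X$ be a smooth manifold, let $\mathcal{A}$, $\mathcal{B}$, $\mathcal{C}$ be super algebra bundles over $X$, let $\mathcal{M}$ be an implementing $\mathcal{A}$-$\mathcal{B}$-bimodule bundle and let $\mathcal{N}$ be an implementing $\mathcal{B}$-$\mathcal{C}$-bimodule bundle over $X$. Then the relative tensor product $\mathcal{M}\otimes_{\mathcal{B}}\mathcal{N}$ is an implementing $\mathcal{A}$-$\mathcal{C}$-bimodule bundle over $X$.
   Context: Let $k=\mathbb{R}$ or $k=\mathbb{C}$. A super algebra is a finite-dimensional, $\mathbb{Z}_2$-graded, unital, associative $k$-algebra; super algebra homomorphisms are even unital algebra homomorphisms, and $\mathrm{Aut}(A)$ denotes the Lie group of even algebra automorphisms of $A$. Bimodules over super algebras are finite-dimensional and $\mathbb{Z}_2$-graded; actions are written $a\triangleright m$, $m\triangleleft b$. Implementing bimodules: for an $A$-$B$-bimodule $M$, $I(M)$ is the Lie group of triples $(\phi,u,\psi)$ with $\phi\in\mathrm{Aut}(A)$, $\psi\in\mathrm{Aut}(B)$ and $u:M\to M$ an even invertible linear map with $u(a\triangleright m\triangleleft b)=\phi(a)\triangleright u(m)\triangleleft\psi(b)$; it is a closed subgroup of $\mathrm{Aut}(A)\times\mathrm{GL}(M)\times\mathrm{Aut}(B)$. $M$ is left (right) implementing if the projection $p_\ell:I(M)\to\mathrm{Aut}(A)$ (resp. $p_r:I(M)\to\mathrm{Aut}(B)$) is open, and implementing if both are open. Bundles: a super algebra bundle over $X$ is a smooth vector bundle $\mathcal{A}\to X$ with a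 super algebra structure on each fibre, such that every point has an open neighborhood $U$, a super algebra $A$ and a fibre-preserving diffeomorphism $\mathcal{A}|_U\to U\times A$ that is fibrewise a super algebra isomorphism. Given super algebra bundles $\mathcal{A},\mathcal{B}$, an $\mathcal{A}$-$\mathcal{B}$-bimodule bundle is a smooth super vector bundle $\mathcal{M}$ over $X$ with an $\mathcal{A}_x$-$\mathcal{B}_x$-bimodule structure on each fibre $\mathcal{M}_x$, such that every point has an open neighborhood $U$ with a local trivialization $(A,M,B;\phi,u,\psi)$: super algebras $A,B$, an $A$-$B$-bimodule $M$, local trivializations $\phi:\mathcal{A}|_U\to U\times A$, $\psi:\mathcal{B}|_U\to U\times B$ of super algebra bundles, and a super vector bundle trivialization $u:\mathcal{M}|_U\to U\times M$ with $u(a\triangleright m\triangleleft b)=\phi(a)\triangleright u(m)\triangleleft\psi(b)$ fibrewise. A bimodule bundle is (left/right) implementing if every fibre $\mathcal{M}_x$ is a (left/right) implementing $\mathcal{A}_x$-$\mathcal{B}_x$-bimodule. The relative tensor product $\mathcal{M}\otimes_{\mathcal{B}}\mathcal{N}=\bigcup_{x\in X}\mathcal{M}_x\otimes_{\mathcal{B}_x}\mathcal{N}_x$ has its fibrewise $\mathcal{A}_x$-$\mathcal{C}_x$-bimodule structures and is equipped with the unique smooth vector bundle structure for which the canonical map $\mathcal{M}\otimes\mathcal{N}\to\mathcal{M}\otimes_{\mathcal{B}}\mathcal{N}$ (with $\otimes$ the fibrewise tensor product over $k$) is smooth; such a structure exists whenever $\mathcal{M}$ is right implementing or $\mathcal{N}$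 is left implementing. *)

(* Defs.v *)
From HB Require Import structures.
From mathcomp Require Import all_boot all_order all_algebra.
From mathcomp Require Import complex.
From mathcomp Require Import boolp classical_sets reals topology normedtype
  derive.

Set Implicit Arguments.
Unset Strict Implicit.
Unset Printing Implicit Defensive.

Import Order.TTheory GRing.Theory Num.Theory.
Import numFieldNormedType.Exports.

Local Open Scope classical_set_scope.
Local Open Scope ring_scope.

Section SmoothMaps.
Variables (R : realType) (V W : normedModType R).

(* [V] is always a row space ['rV[R]_n] and [U] open below, so this is the
   usual C^m condition; values of [f] outside [U] are irrelevant. *)
Fixpoint Ck (m : nat) (U : set V) (f : V -> W) : Prop :=
  (forall x, U x -> {for x, continuous f}) /\
  if m is m'.+1 then
    forall v : V, (forall x, U x -> derivable f x v) /\ Ck m' U ('D_v f)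
  else True.

Definition smooth (U : set V) (f : V -> W) : Prop := forall m, Ck m U f.

End SmoothMaps.

Section Manifolds.
Variable R : realType.

(* A chart is a partial bijection; [cinv] is only meaningful on the image of
   [cdom] under [cmap], and [cmap] only on [cdom]. *)
Record chart (T : Type) := Chart {
  cdim : nat;
  cdom : set T;
  cmap : T -> 'rV[R]_cdim;
  cinv : 'rV[R]_cdim -> T }.

Arguments cinv {T} c.

Definition is_chart (T : Type) (c : chart T) : Prop :=
  (forall t, cdom c t -> cinv c (cmap c t) = t) /\ open (cmap c @` cdom c).

Definition compatible (T : Type) (c c' : chart T) : Prop :=
  let W := cmap c @` (cdom c `&` cdom c') in
  open W /\ smooth W (cmap c' \o cinv c).

Definition chart_open (T : Type) (C : set (chart T)) (W : set T) : Prop :=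
  forall c, C c -> open (cmap c @` (cdom c `&` W)).

Record atlas (T : Type) := Atlas {
  charts : set (chart T);
  charts_cover : forall t, exists2 c, charts c & cdom c t;
  chartsP : forall c, charts c -> is_chart c;
  charts_compatible : forall c c', charts c -> charts c' -> compatible c c' }.

(* [T] as a topological space: [W] is open when its image in every chart is. *)
Definition atlas_space (T : Type) (A : atlas T) : Type := T.

HB.instance Definition _ (T : Type) (A : atlas T) :=
  gen_eqMixin (atlas_space A).
HB.instance Definition _ (T : Type) (A : atlas T) :=
  gen_choiceMixin (atlas_space A).

Section AtlasTopology.
Variables (T : Type) (A : atlas T).

Lemma chart_openT : chart_open (charts A) setT.
Proof. by move=> c Ac; rewrite setIT; case: (chartsP Ac). Qed.

Lemma chart_openI (V W : set T) : chart_open (charts A) V ->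
  chart_open (charts A) W -> chart_open (charts A) (V `&` W).
Proof.
move=> oV oW c Ac; have [cK _] := chartsP Ac.
suff -> : cmap c @` (cdom c `&` (V `&` W)) =
          cmap c @` (cdom c `&` V) `&` cmap c @` (cdom c `&` W).
  by apply: openI; [exact: oV|exact: oW].
apply/seteqP; split => [_ [t [dt [Vt Wt]] <-]|_ [[t [dt Vt] <-]]].
  by split; exists t.
move=> [u [du Wu] e]; exists t => //; split => //; split => //.
by rewrite -(cK t dt) -e cK.
Qed.

Lemma chart_open_bigcup (I : Type) (f : I -> set T) :
  (forall i, chart_open (charts A) (f i)) ->
  chart_open (charts A) (\bigcup_i f i).
Proof.
move=> of_ c Ac; rewrite setI_bigcupr image_bigcup.
by apply: bigcup_open => i _; exact: of_.
Qed.

HB.instance Definition _ := @isOpenTopological.Build (atlas_space A)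
  (chart_open (charts A)) chart_openT chart_openI chart_open_bigcup.

Lemma atlas_openE (W : set (atlas_space A)) :
  open W = chart_open (charts A) W.
Proof. by []. Qed.

End AtlasTopology.

(* A smooth structure on a set: an atlas whose topology is Hausdorff and second
   countable.  The dimension is only locally constant. *)
Record smooth_structure (T : Type) := SmoothStructure {
  structure_atlas : atlas T;
  structure_hausdorff : hausdorff_space (atlas_space structure_atlas);
  structure_second_countable :
    @second_countable (atlas_space structure_atlas) }.

Definition structure_charts (T : Type) (S : smooth_structure T) :
  set (chart T) := charts (structure_atlas S).

Record manifold := Manifold {
  points :> Type;
  manifold_structure : smooth_structure points }.

Definition manifold_charts (X : manifold) : set (chart X) :=
  structure_charts (manifold_structure X).

(* Openness of [W] forces [S] to be open and [f] to be continuous on [S]. *)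
Definition smooth_on (T T' : Type) (C : set (chart T)) (C' : set (chart T'))
    (S : set T) (f : T -> T') : Prop :=
  forall c c', C c -> C' c' ->
  let W := cmap c @` (cdom c `&` S `&` f @^-1` cdom c') in
  open W /\ smooth W (cmap c' \o f \o cinv c).

Definition diffeo_on (T T' : Type) (C : set (chart T)) (C' : set (chart T'))
    (S : set T) (S' : set T') (f : T -> T') : Prop :=
  exists g : T' -> T,
  [/\ forall t, S t -> S' (f t) /\ g (f t) = t,
      forall t, S' t -> S (g t) /\ f (g t) = t,
      smooth_on C C' S f &
      smooth_on C' C S' g].

Definition prod_chart (T T' : Type) (c : chart T) (c' : chart T') :
  chart (T * T') :=
  Chart (cdom c `*` cdom c')
    (fun p => row_mx (cmap c p.1) (cmap c' p.2))
    (fun w => (cinv c (lsubmx w), cinv c' (rsubmx w))).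

Definition prod_charts (T T' : Type) (C : set (chart T))
    (C' : set (chart T')) : set (chart (T * T')) :=
  [set p | exists c c', [/\ C c, C' c' & p = prod_chart c c']].

End Manifolds.

Arguments cinv {R T} c.
Arguments charts {R T} a _.
Arguments structure_charts {R T} S _.
Arguments manifold_charts {R} X _.

Variant scalar_kind := RealScalars | ComplexScalars.

Definition scalars (R : realType) (s : scalar_kind) : fieldType :=
  match s with RealScalars => R | ComplexScalars => R[i]%C end.

Definition real_dim (s : scalar_kind) (d : nat) : nat :=
  match s with RealScalars => d | ComplexScalars => (d + d)%N end.

Definition to_real (R : realType) (s : scalar_kind) (d : nat) :
    'rV[scalars R s]_d -> 'rV[R]_(real_dim s d) :=
  match s with
  | RealScalars => id
  | ComplexScalars => fun z : 'rV[R[i]%C]_d =>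
      row_mx (map_mx (@complex.Re R) z) (map_mx (@complex.Im R) z)
  end.

Definition of_real (R : realType) (s : scalar_kind) (d : nat) :
    'rV[R]_(real_dim s d) -> 'rV[scalars R s]_d :=
  match s with
  | RealScalars => id
  | ComplexScalars => fun w : 'rV[R]_(d + d) =>
      \row_j (lsubmx w 0 j +i* rsubmx w 0 j)%C
  end.

Lemma to_realK (R : realType) (s : scalar_kind) (d : nat) :
  cancel (@to_real R s d) (@of_real R s d).
Proof.
case: s => //= z; apply/rowP => j.
rewrite [LHS]mxE [lsubmx _]row_mxKl [rsubmx _]row_mxKr !mxE.
by case: (z 0 j).
Qed.

Lemma of_realK (R : realType) (s : scalar_kind) (d : nat) :
  cancel (@of_real R s d) (@to_real R s d).
Proof.
case: s => //= w; rewrite -[RHS]hsubmxK.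
by congr row_mx; apply/rowP => j; rewrite !mxE.
Qed.

Section VectorManifold.
Variables (R : realType) (s : scalar_kind).
Implicit Type V : vectType (scalars R s).

Definition vect_chart V : chart R V :=
  @Chart R V (real_dim s (\dim {:V})) setT
    (fun v => to_real (\row_i coord (vbasis {:V}) i v))
    (fun w => \sum_i of_real (s := s) w 0 i *: (vbasis {:V})`_i).

Lemma vect_chartK V : cancel (cmap (vect_chart V)) (cinv (vect_chart V)).
Proof.
move=> v; rewrite /= [RHS](coord_vbasis (memvf v)); apply: eq_bigr => i _.
by rewrite to_realK mxE.
Qed.

Lemma vect_chartVK V : cancel (cinv (vect_chart V)) (cmap (vect_chart V)).
Proof.
move=> w /=; rewrite -[RHS](@of_realK R s); congr to_real.
by apply/rowP => i; rewrite mxE coord_sum_free ?(basis_free (vbasisP _)).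
Qed.

(* The norm topology of V, seen in the global chart given by a basis. *)
Definition vect_open V : set V -> Prop := chart_open [set vect_chart V].

Definition open_in V (S O : set V) : Prop :=
  exists2 W, vect_open W & O = S `&` W.

Definition open_map V V' (S : set V) (S' : set V') (f : V -> V') : Prop :=
  forall O, open_in S O -> open_in S' (f @` O).

End VectorManifold.

(* The parities 0 and 1 are [false] and [true]. *)
Record super_space (k : fieldType) := SuperSpace {
  super_vect :> vectType k;
  grade : bool -> {vspace super_vect};
  grade_cap : (grade false :&: grade true = 0)%VS;
  grade_sum : (grade false + grade true = fullv)%VS }.

Definition even_map (k : fieldType) (V W : super_space k) (f : 'Hom(V, W)) :
  Prop := forall i v, v \in grade V i -> f v \in grade W i.

Record super_algebra (k : fieldType) := SuperAlgebra {
  alg_space :> super_space k;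
  smul : 'Hom(alg_space, 'End(alg_space));
  sone : alg_space;
  smulA : forall a b c, smul (smul a b) c = smul a (smul b c);
  smul1l : forall a, smul sone a = a;
  smul1r : forall a, smul a sone = a;
  smul_grade : forall i j a b, a \in grade alg_space i ->
    b \in grade alg_space j -> smul a b \in grade alg_space (i (+) j);
  sone_grade : sone \in grade alg_space false }.

Definition alg_hom (k : fieldType) (A B : super_algebra k) (f : 'Hom(A, B)) :
  Prop :=
  [/\ even_map f, f (sone A) = sone B &
      forall a b, f (smul A a b) = smul B (f a) (f b)].

(* [lact M a m] is a |> m and [ract M b m] is m <| b. *)
Record bimodule (k : fieldType) (A B : super_algebra k) := Bimodule {
  bimod_space :> super_space k;
  lact : 'Hom(A, 'End(bimod_space));
  ract : 'Hom(B, 'End(bimod_space));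
  lact1 : forall m, lact (sone A) m = m;
  lactM : forall a a' m, lact (smul A a a') m = lact a (lact a' m);
  ract1 : forall m, ract (sone B) m = m;
  ractM : forall b b' m, ract (smul B b b') m = ract b' (ract b m);
  lractC : forall a b m, ract b (lact a m) = lact a (ract b m);
  lact_grade : forall i j a m, a \in grade A i ->
    m \in grade bimod_space j -> lact a m \in grade bimod_space (i (+) j);
  ract_grade : forall i j m b, m \in grade bimod_space i ->
    b \in grade B j -> ract b m \in grade bimod_space (i (+) j) }.

Definition bimod_intertwines (k : fieldType) (A B A' B' : super_algebra k)
    (M : bimodule A B) (M' : bimodule A' B')
    (phi : 'Hom(A, A')) (u : 'Hom(M, M')) (psi : 'Hom(B, B')) : Prop :=
  forall a m b, u (ract M b (lact M a m)) =
                ract M' (psi b) (lact M' (phi a) (u m)).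

Section Implementing.
Variables (R : realType) (s : scalar_kind).
Let k := scalars R s.

Definition super_aut (A : super_algebra k) : set 'End(A) :=
  [set f : 'End(A) | bijective f /\ alg_hom f].

Section Implementers.
Variables (A B : super_algebra k) (M : bimodule A B).

(* The triples (phi, u, psi), in the subspace topology. *)
Definition implementers : set ('End(A) * 'End(M) * 'End(B)) :=
  [set t : 'End(A) * 'End(M) * 'End(B) |
     [/\ super_aut t.1.1, super_aut t.2, bijective t.1.2, even_map t.1.2 &
         bimod_intertwines t.1.1 t.1.2 t.2]].

Definition left_implementing : Prop :=
  open_map implementers (@super_aut A) (fun t => t.1.1).

Definition right_implementing : Prop :=
  open_map implementers (@super_aut B) (fun t => t.2).

Definition implementing : Prop := left_implementing /\ right_implementing.

End Implementers.
End Implementing.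

Section LinearTools.
Variable k : fieldType.

Definition mklfun (V W : vectType k) (f : V -> W) (_ : linear f) : 'Hom(V, W) :=
  linfun f.

Lemma mklfunE (V W : vectType k) (f : V -> W) (f_lin : linear f) v :
  mklfun f_lin v = f v.
Proof.
pose L := GRing.isLinear.Build k V W *:%R f f_lin.
pose F : {linear V -> W} := HB.pack f L.
exact: (lfunE F).
Qed.

(* The tensor product of finite-dimensional V and W, as Hom(V^*, W): the pure
   tensor v (x) w is phi |-> phi(v) w. *)
Definition tensor (V W : vectType k) : vectType k := 'Hom('Hom(V, k^o), W).

Lemma tens_subproof (V W : vectType k) (v : V) (w : W) :
  linear (fun phi : 'Hom(V, k^o) => (phi v : k) *: w).
Proof. by move=> a f g; rewrite !lfunE /= lfunE /= scalerDl scalerA. Qed.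

Definition tens (V W : vectType k) (v : V) (w : W) : tensor V W :=
  mklfun (tens_subproof v w).

Lemma tensE (V W : vectType k) (v : V) (w : W) (phi : 'Hom(V, k^o)) :
  tens v w phi = (phi v : k) *: w.
Proof. exact: mklfunE. Qed.

Definition vcoord (V : vectType k) (i : 'I_(\dim {:V})) : 'Hom(V, k^o) :=
  linfun (coord (vbasis {:V}) i : V -> k^o).

Lemma tensor_sum (V W : vectType k) (t : tensor V W) :
  t = \sum_(i < \dim {:V}) tens (vbasis {:V})`_i (t (vcoord i)).
Proof.
apply/lfunP => phi; rewrite sum_lfunE.
have {1}-> : phi = \sum_(i < \dim {:V}) (phi (vbasis {:V})`_i : k) *: vcoord i.
  apply/lfunP => v; rewrite {1}(coord_vbasis (memvf v)) linear_sum sum_lfunE.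
  by apply: eq_bigr => i _; rewrite linearZ scale_lfunE lfunE; exact: mulrC.
by rewrite linear_sum; apply: eq_bigr => i _; rewrite tensE linearZ.
Qed.

Lemma tmap_subproof1 (V V' : vectType k) (f : 'Hom(V, V')) :
  linear (fun phi : 'Hom(V', k^o) => (phi \o f)%VF).
Proof.
by move=> a g h; apply/lfunP => v; rewrite !(comp_lfunE, add_lfunE, scale_lfunE).
Qed.

Lemma tmap_subproof2 (V V' W W' : vectType k) (f : 'Hom(V, V'))
    (g : 'Hom(W, W')) :
  linear (fun t : tensor V W => (g \o t \o mklfun (tmap_subproof1 f))%VF
          : tensor V' W').
Proof.
move=> a t t'; apply/lfunP => phi.
by rewrite !(comp_lfunE, add_lfunE, scale_lfunE) linearP.
Qed.

Definition tmap (V V' W W' : vectType k) (f : 'Hom(V, V')) (g : 'Hom(W, W')) :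
  'Hom(tensor V W, tensor V' W') := mklfun (tmap_subproof2 f g).

Lemma tmapE (V V' W W' : vectType k) (f : 'Hom(V, V')) (g : 'Hom(W, W'))
    (t : tensor V W) (phi : 'Hom(V', k^o)) :
  (tmap f g t : tensor V' W') phi = g (t (phi \o f)%VF).
Proof. by rewrite mklfunE !comp_lfunE mklfunE. Qed.

Lemma tmap_tens (V V' W W' : vectType k) (f : 'Hom(V, V')) (g : 'Hom(W, W'))
    v w : tmap f g (tens v w) = tens (f v) (g w).
Proof. by apply/lfunP => phi; rewrite tmapE !tensE comp_lfunE linearZ. Qed.

Lemma tmap_comp (V V' V'' W W' W'' : vectType k) (f : 'Hom(V, V'))
    (f' : 'Hom(V', V'')) (g : 'Hom(W, W')) (g' : 'Hom(W', W'')) t :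
  tmap f' g' (tmap f g t) = tmap (f' \o f)%VF (g' \o g)%VF t.
Proof. by apply/lfunP => phi; rewrite !tmapE !comp_lfunE comp_lfunA. Qed.

Lemma tmap1 (V W : vectType k) (t : tensor V W) : tmap \1%VF \1%VF t = t.
Proof. by apply/lfunP => phi; rewrite tmapE id_lfunE comp_lfun1r. Qed.

Lemma tmapDl (V V' W W' : vectType k) (f f' : 'Hom(V, V')) (g : 'Hom(W, W'))
    a t : tmap (a *: f + f') g t = a *: tmap f g t + tmap f' g t.
Proof.
apply/lfunP => phi; rewrite !(add_lfunE, scale_lfunE) !tmapE -!linearP.
by congr (g (t _)); apply/lfunP => v; rewrite !(comp_lfunE, add_lfunE, scale_lfunE) linearP.
Qed.

Lemma tmapDr (V V' W W' : vectType k) (f : 'Hom(V, V')) (g g' : 'Hom(W, W'))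
    a t : tmap f (a *: g + g') t = a *: tmap f g t + tmap f g' t.
Proof.
by apply/lfunP => phi; rewrite !(add_lfunE, scale_lfunE, tmapE).
Qed.

(* The quotient V / U, realised on a complement of U. *)
Section Quotient.
Variables (V : vectType k) (U : {vspace V}).

Definition quot : vectType k := subvs_of (U^C)%VS.

Definition quot_proj : 'Hom(V, quot) :=
  (linfun (vsproj (U^C)%VS) \o daddv_pi (U^C)%VS U)%VF.

Definition quot_lift : 'Hom(quot, V) := linfun vsval.

Let capCU : (U^C :&: U = 0)%VS. Proof. by rewrite capvC capv_compl. Qed.

Lemma quot_liftK q : quot_proj (quot_lift q) = q.
Proof.
rewrite comp_lfunE !lfunE /= daddv_pi_id ?subvsP //.
by apply: val_inj; rewrite /= vsprojK ?subvsP.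
Qed.

Lemma quot_projK v : v - quot_lift (quot_proj v) \in U.
Proof.
rewrite comp_lfunE !lfunE /= vsprojK ?memv_pi //.
rewrite -{1}(daddv_pi_add capCU (_ : v \in (U^C + U)%VS)).
  by rewrite addrC addKr memv_pi.
by rewrite addvC addv_complf memvf.
Qed.

Lemma quot_proj_eq0 v : (quot_proj v == 0) = (v \in U).
Proof.
apply/eqP/idP => [v0|Uv].
  by have := quot_projK v; rewrite v0 linear0 subr0.
have lv0 : quot_lift (quot_proj v) = 0.
  apply/eqP; rewrite -memv0 -capCU memv_cap {1}lfunE /= subvsP /=.
  rewrite -[X in X \in _](subKr v); apply: rpredB => //.
  exact: quot_projK.
by rewrite -(quot_liftK (quot_proj v)) lv0 linear0.
Qed.

Definition quot_map (f : 'End(V)) : 'End(quot) :=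
  (quot_proj \o f \o quot_lift)%VF.

Lemma quot_mapE (f : 'End(V)) v : (forall u, u \in U -> f u \in U) ->
  quot_map f (quot_proj v) = quot_proj (f v).
Proof.
move=> fU; transitivity (quot_proj (f (quot_lift (quot_proj v)))).
  by rewrite /quot_map (comp_lfunE (_ \o _)%VF) (comp_lfunE quot_proj).
apply/eqP; rewrite -subr_eq0 -!linearB quot_proj_eq0.
by apply: fU; rewrite -opprB rpredN quot_projK.
Qed.

Lemma quot_mapP : linear quot_map.
Proof.
move=> a f g; apply/lfunP => q; rewrite /quot_map; move: quot_proj quot_lift => p l.
by rewrite !(comp_lfunE, add_lfunE, scale_lfunE) linearP.
Qed.

End Quotient.
End LinearTools.

Section Parity.
Variable k : fieldType.
Implicit Types V W : super_space k.

Definition gproj V (i : bool) : 'End(V) := daddv_pi (grade V i) (grade V (~~ i)).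

Let grade_capN V i : (grade V i :&: grade V (~~ i) = 0)%VS.
Proof. by case: i; rewrite /= ?grade_cap // capvC grade_cap. Qed.

Lemma gproj_mem V i v : gproj V i v \in grade V i.
Proof. exact: memv_pi. Qed.

Lemma gproj_id V i v : v \in grade V i -> gproj V i v = v.
Proof. by apply: daddv_pi_id; exact: grade_capN. Qed.

Lemma gproj_sum V v : gproj V false v + gproj V true v = v.
Proof. by apply: daddv_pi_add; rewrite ?grade_cap ?grade_sum ?memvf. Qed.

Lemma gproj_compl V i v : gproj V i v + gproj V (~~ i) v = v.
Proof. by case: i; rewrite /= ?gproj_sum // addrC gproj_sum. Qed.

Lemma gproj_eq0 V i v : v \in grade V (~~ i) -> gproj V i v = 0.
Proof.
by move=> Vv; apply/(addIr (gproj V (~~ i) v)); rewrite gproj_compl add0r gproj_id.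
Qed.

Lemma gproj_proj V i j v :
  gproj V i (gproj V j v) = if i == j then gproj V j v else 0.
Proof.
case: eqP => [->|/eqP ij]; first by rewrite gproj_id ?gproj_mem.
by rewrite gproj_eq0 //; case: i j ij => [] [] // _; exact: gproj_mem.
Qed.

Lemma gproj_shift V W (f : 'Hom(V, W)) i j :
  (forall e v, v \in grade V e -> f v \in grade W (e (+) j)) ->
  (gproj W i \o f = f \o gproj V (i (+) j))%VF.
Proof.
move=> fj; apply/lfunP => v; rewrite !comp_lfunE.
rewrite -{1}(gproj_compl (i (+) j) v) !linearD /=.
rewrite gproj_id; last first.
  by have := fj _ _ (gproj_mem (i (+) j) v); rewrite addbK.
rewrite [X in _ + X]gproj_eq0 ?addr0 //.
by have := fj _ _ (gproj_mem (~~ (i (+) j)) v); rewrite -addNb addbK.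
Qed.

Section OfProj.
Variables (V : vectType k) (p : bool -> 'End(V)).
Hypothesis p_sum : forall v, p false v + p true v = v.
Hypothesis p_proj : forall i j v, p i (p j v) = if i == j then p j v else 0.

Lemma of_proj_cap : (limg (p false) :&: limg (p true) = 0)%VS.
Proof.
apply/eqP; rewrite -subv0; apply/subvP => v /memv_capP[/memv_imgP[u _ e]].
move=> /memv_imgP[u' _ e']; rewrite memv0 -(p_sum v) {1}e' e !p_proj /=.
by rewrite addr0.
Qed.

Lemma of_proj_sum : (limg (p false) + limg (p true) = fullv)%VS.
Proof.
apply/vspaceP => v; rewrite memvf -(p_sum v).
by apply: memv_add; apply: memv_img; rewrite memvf.
Qed.

Definition super_of_proj : super_space k :=
  @SuperSpace k V (fun i => limg (p i)) of_proj_cap of_proj_sum.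

Lemma super_of_projP i v :
  reflect (p i v = v) (v \in grade super_of_proj i).
Proof.
apply: (iffP idP) => [/memv_imgP[u _ ->]|<-]; first by rewrite p_proj eqxx.
by apply: memv_img; rewrite memvf.
Qed.
End OfProj.

(* (V (x) W)_e is V_0 (x) W_e + V_1 (x) W_(e+1). *)
Section TensorParity.
Variables V W : super_space k.

Definition tproj (e : bool) : 'End(tensor V W) :=
  tmap (gproj V false) (gproj W e) + tmap (gproj V true) (gproj W (~~ e)).

Lemma tprojE e t (phi : 'Hom(V, k^o)) :
  (tproj e t : tensor V W) phi =
  gproj W e (t (phi \o gproj V false)%VF) +
  gproj W (~~ e) (t (phi \o gproj V true)%VF).
Proof. by rewrite !add_lfunE !tmapE. Qed.

Lemma tproj_tens i j v w : v \in grade V i -> w \in grade W j ->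
  tproj (i (+) j) (tens v w) = tens v w.
Proof.
move=> Vv Ww; apply/lfunP => phi; rewrite tprojE !tensE !comp_lfunE.
case: i Vv => Vv; rewrite ?addTb ?addFb ?negbK (gproj_id Vv).
  by rewrite (gproj_eq0 (i := false)) // linear0 scale0r linear0 add0r linearZ /=
    gproj_id.
by rewrite (gproj_eq0 (i := true)) // linear0 scale0r linear0 addr0 linearZ /=
  gproj_id.
Qed.

Lemma tproj_sum t : tproj false t + tproj true t = t.
Proof.
apply/lfunP => phi; rewrite add_lfunE !tprojE /= addrACA gproj_sum.
rewrite [gproj W true _ + _]addrC gproj_sum -linearD /=; congr (t _).
by apply/lfunP => v; rewrite add_lfunE !comp_lfunE -linearD gproj_sum.
Qed.

Let gprojC i j (phi : 'Hom(V, k^o)) :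
  (phi \o gproj V i \o gproj V j)%VF =
  if i == j then (phi \o gproj V i)%VF else 0.
Proof.
apply/lfunP => v; rewrite !comp_lfunE gproj_proj.
by case: eqP => [->|_]; rewrite ?comp_lfunE // linear0 zero_lfunE.
Qed.

Lemma tproj_proj i j t : tproj i (tproj j t) = if i == j then tproj j t else 0.
Proof.
apply/lfunP => phi; rewrite !tprojE !gprojC /= !linear0 addr0 add0r.
rewrite !gproj_proj (inj_eq negb_inj); case: eqP => _; first by rewrite tprojE.
by rewrite addr0 zero_lfunE.
Qed.

Lemma tproj_mapl (f : 'End(V)) j e t :
  (forall i v, v \in grade V i -> f v \in grade V (i (+) j)) ->
  tproj e (tmap f \1%VF t) = tmap f \1%VF (tproj (e (+) j) t).
Proof.
move=> fj; apply/lfunP => phi; rewrite tprojE !tmapE !id_lfunE tprojE.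
rewrite -!comp_lfunA !(gproj_shift _ fj).
by case: j {fj}; rewrite ?addbF ?addbT //= negbK addrC.
Qed.

Lemma tproj_mapr (g : 'End(W)) j e t :
  (forall i w, w \in grade W i -> g w \in grade W (i (+) j)) ->
  tproj e (tmap \1%VF g t) = tmap \1%VF g (tproj (e (+) j) t).
Proof.
move=> gj; apply/lfunP => phi; rewrite tprojE !tmapE !comp_lfun1r tprojE.
rewrite linearD /= -!(comp_lfunE (gproj W _) g) !(gproj_shift _ gj) !comp_lfunE.
by rewrite addNb.
Qed.

End TensorParity.
End Parity.

Section RelativeTensor.
Variables (k : fieldType) (A B C : super_algebra k).
Variables (M : bimodule A B) (N : bimodule B C).

Lemma balancing_subproof :
  linear (fun b : B => tmap (ract M b) \1%VF - tmap \1%VF (lact N b)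
          : 'End(tensor M N)).
Proof.
move=> x b b'; apply/lfunP => t.
rewrite !(add_lfunE, scale_lfunE, opp_lfunE) !linearP tmapDl tmapDr.
by rewrite opprD addrACA -scalerBr.
Qed.

(* balancing b maps m (x) n to (m <| b) (x) n - m (x) (b |> n). *)
Definition balancing : 'Hom(B, 'End(tensor M N)) := mklfun balancing_subproof.

Lemma balancingE b t : balancing b t =
  tmap (ract M b) \1%VF t - tmap \1%VF (lact N b) t.
Proof. by rewrite mklfunE add_lfunE opp_lfunE. Qed.

Lemma balancing_tens b m n :
  balancing b (tens m n) = tens (ract M b m) n - tens m (lact N b n).
Proof. by rewrite balancingE !tmap_tens !id_lfunE. Qed.

(* As pure tensors span, this is the span of all
   (m <| b) (x) n - m (x) (b |> n). *)
Definition balanced : {vspace tensor M N} :=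
  (\sum_(i < \dim {:B}) limg (balancing (vbasis {:B})`_i))%VS.

Lemma mem_balancing b t : balancing b t \in balanced.
Proof.
rewrite (coord_vbasis (memvf b)) linear_sum sum_lfunE; apply: rpred_sum => i _.
rewrite linearZ scale_lfunE; apply: rpredZ.
by apply: (subvP (sumv_sup i _ _)) => //; apply: memv_img; rewrite memvf.
Qed.

Lemma balanced_stable (f : 'End(tensor M N)) :
  (forall b t, f (balancing b t) \in balanced) ->
  forall t, t \in balanced -> f t \in balanced.
Proof.
move=> fb t /memv_sumP[ts tsP ->]; rewrite linear_sum.
apply: rpred_sum => i _; have /memv_imgP[u _ ->] := tsP i isT; exact: fb.
Qed.

Lemma balanced_lact a t : t \in balanced ->
  tmap (lact M a) \1%VF t \in balanced.
Proof.
apply: balanced_stable => b {}t.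
suff -> : tmap (lact M a) \1%VF (balancing b t) =
          balancing b (tmap (lact M a) \1%VF t) by exact: mem_balancing.
rewrite !balancingE linearB /= !tmap_comp !comp_lfun1l !comp_lfun1r.
congr (tmap _ _ _ - _); apply/lfunP => m.
by rewrite !comp_lfunE lractC.
Qed.

Lemma balanced_ract c t : t \in balanced ->
  tmap \1%VF (ract N c) t \in balanced.
Proof.
apply: balanced_stable => b {}t.
suff -> : tmap \1%VF (ract N c) (balancing b t) =
          balancing b (tmap \1%VF (ract N c) t) by exact: mem_balancing.
rewrite !balancingE linearB /= !tmap_comp !comp_lfun1l !comp_lfun1r.
congr (_ - tmap _ _ _); apply/lfunP => m.
by rewrite !comp_lfunE lractC.
Qed.

Lemma balanced_tproj e t : t \in balanced -> tproj M N e t \in balanced.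
Proof.
apply: balanced_stable => b {}t.
have -> : balancing b t =
          balancing (gproj B false b) t + balancing (gproj B true b) t.
  by rewrite -add_lfunE -linearD gproj_sum.
rewrite linearD; apply: rpredD;
  rewrite balancingE linearB /=.
- rewrite (tproj_mapl (j := false)); last first.
    by move=> i v Vv; apply: ract_grade => //; exact: gproj_mem.
  rewrite (tproj_mapr (j := false)); last first.
    by move=> i v Vv; rewrite addbC; apply: lact_grade => //; exact: gproj_mem.
  by rewrite -balancingE mem_balancing.
- rewrite (tproj_mapl (j := true)); last first.
    by move=> i v Vv; apply: ract_grade => //; exact: gproj_mem.
  rewrite (tproj_mapr (j := true)); last first.
    by move=> i v Vv; rewrite addbC; apply: lact_grade => //; exact: gproj_mem.
  by rewrite -balancingE mem_balancing.
Qed.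

Definition rel_quot : vectType k := quot balanced.

Definition rel_proj : 'Hom(tensor M N, rel_quot) := quot_proj balanced.

Lemma rel_proj_balanced b m n :
  rel_proj (tens (ract M b m) n) = rel_proj (tens m (lact N b n)).
Proof.
apply/eqP; rewrite -subr_eq0 -linearB quot_proj_eq0 -balancing_tens.
exact: mem_balancing.
Qed.

Definition rel_gproj (e : bool) : 'End(rel_quot) :=
  quot_map balanced (tproj M N e).

Let rel_ind (P : rel_quot -> Prop) :
  (forall t, P (rel_proj t)) -> forall q, P q.
Proof. by move=> Pp q; rewrite -(quot_liftK q). Qed.

Lemma rel_gprojE e t : rel_gproj e (rel_proj t) = rel_proj (tproj M N e t).
Proof. by apply: quot_mapE => u; exact: balanced_tproj. Qed.

Lemma rel_gproj_sum q : rel_gproj false q + rel_gproj true q = q.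
Proof. by elim/rel_ind: q => t; rewrite !rel_gprojE -linearD tproj_sum. Qed.

Lemma rel_gproj_proj i j q :
  rel_gproj i (rel_gproj j q) = if i == j then rel_gproj j q else 0.
Proof.
elim/rel_ind: q => t; rewrite !rel_gprojE tproj_proj.
by case: eqP => // _; rewrite linear0.
Qed.

(* limg (rel_gproj e) is the image of the degree e part of the tensor product. *)
Definition rel_space : super_space k :=
  super_of_proj rel_gproj_sum rel_gproj_proj.

Lemma rel_lact_subproof :
  linear (fun a : A => quot_map balanced (tmap (lact M a) \1%VF)
          : 'End(rel_space)).
Proof.
move=> x a a'; rewrite -quot_mapP; congr quot_map; apply/lfunP => t.
by rewrite linearP tmapDl add_lfunE scale_lfunE.
Qed.

Lemma rel_ract_subproof :
  linear (fun c : C => quot_map balanced (tmap \1%VF (ract N c))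
          : 'End(rel_space)).
Proof.
move=> x c c'; rewrite -quot_mapP; congr quot_map; apply/lfunP => t.
by rewrite linearP tmapDr add_lfunE scale_lfunE.
Qed.

Definition rel_lact : 'Hom(A, 'End(rel_space)) := mklfun rel_lact_subproof.
Definition rel_ract : 'Hom(C, 'End(rel_space)) := mklfun rel_ract_subproof.

Lemma rel_lactE a t :
  rel_lact a (rel_proj t) = rel_proj (tmap (lact M a) \1%VF t).
Proof.
rewrite mklfunE; apply: quot_mapE => u; exact: balanced_lact.
Qed.

Lemma rel_ractE c t :
  rel_ract c (rel_proj t) = rel_proj (tmap \1%VF (ract N c) t).
Proof.
rewrite mklfunE; apply: quot_mapE => u; exact: balanced_ract.
Qed.

Lemma rel_lact1 q : rel_lact (sone A) q = q.
Proof.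
elim/rel_ind: q => t; rewrite rel_lactE -[in RHS](tmap1 t).
by congr (rel_proj (tmap _ _ _)); apply/lfunP => m; rewrite lact1 id_lfunE.
Qed.

Lemma rel_lactM a a' q :
  rel_lact (smul A a a') q = rel_lact a (rel_lact a' q).
Proof.
elim/rel_ind: q => t; rewrite !rel_lactE tmap_comp comp_lfun1l.
by congr (rel_proj (tmap _ _ _)); apply/lfunP => m; rewrite lactM comp_lfunE.
Qed.

Lemma rel_ract1 q : rel_ract (sone C) q = q.
Proof.
elim/rel_ind: q => t; rewrite rel_ractE -[in RHS](tmap1 t).
by congr (rel_proj (tmap _ _ _)); apply/lfunP => m; rewrite ract1 id_lfunE.
Qed.

Lemma rel_ractM c c' q :
  rel_ract (smul C c c') q = rel_ract c' (rel_ract c q).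
Proof.
elim/rel_ind: q => t; rewrite !rel_ractE tmap_comp comp_lfun1l.
by congr (rel_proj (tmap _ _ _)); apply/lfunP => m; rewrite ractM comp_lfunE.
Qed.

Lemma rel_lractC a c q :
  rel_ract c (rel_lact a q) = rel_lact a (rel_ract c q).
Proof.
elim/rel_ind: q => t; rewrite rel_lactE !rel_ractE rel_lactE !tmap_comp.
by rewrite !comp_lfun1l !comp_lfun1r.
Qed.

Lemma rel_lact_grade i j a q : a \in grade A i -> q \in grade rel_space j ->
  rel_lact a q \in grade rel_space (i (+) j).
Proof.
move=> Aa /super_of_projP <-; elim/rel_ind: q => t; apply/super_of_projP.
rewrite rel_gprojE rel_lactE rel_gprojE (tproj_mapl (j := i)); last first.
  by move=> e v Vv; rewrite addbC; apply: lact_grade.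
by rewrite addbC addKb tproj_proj eqxx.
Qed.

Lemma rel_ract_grade i j q c : q \in grade rel_space i -> c \in grade C j ->
  rel_ract c q \in grade rel_space (i (+) j).
Proof.
move=> /super_of_projP <- Cc; elim/rel_ind: q => t; apply/super_of_projP.
rewrite rel_gprojE rel_ractE rel_gprojE (tproj_mapr (j := j)); last first.
  by move=> e v Vv; apply: ract_grade.
by rewrite addbK tproj_proj eqxx.
Qed.

Definition rel_tensor : bimodule A C :=
  @Bimodule k A C rel_space rel_lact rel_ract rel_lact1 rel_lactM rel_ract1
    rel_ractM rel_lractC rel_lact_grade rel_ract_grade.

End RelativeTensor.

(* A bundle is a family of fibres together with a smooth structure on the
   disjoint union of the fibres. *)
Definition total_space (k : fieldType) (X : Type) (F : X -> vectType k) : Type :=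
  {x : X & F x}.

Section Bundles.
Variables (R : realType) (s : scalar_kind) (X : manifold R).
Let k := scalars R s.

(* A diffeomorphism from the bundle over U onto U x V, over U and linear on the
   fibres. *)
Definition is_trivialization (F : X -> vectType k)
    (E : smooth_structure R (total_space F)) (U : set X) (V : vectType k)
    (t : forall x, 'Hom(F x, V)) : Prop :=
  chart_open (manifold_charts X) U /\
  diffeo_on (structure_charts E)
    (prod_charts (manifold_charts X) [set vect_chart V])
    [set e | U (tag e)] [set p | U p.1]
    (fun e : total_space F => (tag e, t (tag e) (tagged e))).

Definition is_vector_bundle (F : X -> vectType k)
    (E : smooth_structure R (total_space F)) : Prop :=
  forall x, exists (U : set X) (V : vectType k) (t : forall y, 'Hom(F y, V)),
    U x /\ is_trivialization E U t.

Definition is_super_trivialization (F : X -> super_space k)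
    (E : smooth_structure R (total_space F)) (U : set X) (V : super_space k)
    (t : forall x, 'Hom(F x, V)) : Prop :=
  is_trivialization E U t /\ forall y, U y -> even_map (t y).

Definition is_algebra_trivialization (F : X -> super_algebra k)
    (E : smooth_structure R (total_space F)) (U : set X) (A : super_algebra k)
    (t : forall x, 'Hom(F x, A)) : Prop :=
  is_trivialization E U t /\ forall y, U y -> alg_hom (t y).

Definition is_algebra_bundle (F : X -> super_algebra k)
    (E : smooth_structure R (total_space F)) : Prop :=
  forall x, exists (U : set X) (A : super_algebra k)
    (t : forall y, 'Hom(F y, A)), U x /\ is_algebra_trivialization E U t.

Record algebra_bundle := AlgebraBundle {
  algebra_fibre :> X -> super_algebra k;
  algebra_structure : smooth_structure R (total_space algebra_fibre);
  algebra_bundleP : is_algebra_bundle algebra_structure }.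

Definition is_bimodule_bundle (A B : algebra_bundle)
    (F : forall x, bimodule (A x) (B x))
    (E : smooth_structure R (total_space F)) : Prop :=
  forall x, exists (U : set X) (A0 B0 : super_algebra k) (M0 : bimodule A0 B0)
    (phi : forall y, 'Hom(A y, A0)) (u : forall y, 'Hom(F y, M0))
    (psi : forall y, 'Hom(B y, B0)),
    U x /\
    [/\ is_algebra_trivialization (algebra_structure A) U phi,
        is_super_trivialization E U u,
        is_algebra_trivialization (algebra_structure B) U psi &
        forall y, U y -> bimod_intertwines (phi y) (u y) (psi y)].

Record bimodule_bundle (A B : algebra_bundle) := BimoduleBundle {
  bimodule_fibre :> forall x, bimodule (A x) (B x);
  bimodule_structure : smooth_structure R (total_space bimodule_fibre);
  bimodule_bundleP : is_bimodule_bundle bimodule_structure }.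

Definition implementing_family (A B : algebra_bundle)
    (F : forall x, bimodule (A x) (B x)) : Prop :=
  forall x, implementing (F x).

Definition trivialization_chart (F : X -> vectType k) (b : chart R X)
    (U : set X) (V : vectType k) (t : forall x, 'Hom(F x, V)) :
  chart R (total_space F) :=
  Chart (fun e : total_space F => U (tag e) /\ cdom b (tag e))
    (fun e : total_space F =>
       row_mx (cmap b (tag e)) (cmap (vect_chart V) (t (tag e) (tagged e))))
    (fun w => let x := cinv b (lsubmx w) in
       existT F x ((t x)^-1%VF (cinv (vect_chart V) (rsubmx w)))).

Section Tensor.
Variables (A B C : algebra_bundle).
Variables (M : bimodule_bundle A B) (N : bimodule_bundle B C).

(* The smooth structure of the fibrewise tensor product over k: the atlas
   induced by the trivializations u (x) v. *)
Definition tensor_charts :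
    set (chart R (total_space (fun x => tensor (M x) (N x)))) :=
  [set c | exists (b : chart R X) (U : set X) (V W : vectType k)
     (u : forall x, 'Hom(M x, V)) (v : forall x, 'Hom(N x, W)),
     [/\ manifold_charts X b,
         is_trivialization (bimodule_structure M) U u,
         is_trivialization (bimodule_structure N) U v &
         c = trivialization_chart b U (fun x => tmap (u x) (v x))]].

Definition rel_tensor_fibre (x : X) : bimodule (A x) (C x) :=
  rel_tensor (M x) (N x).

Definition canonical_map (e : total_space (fun x => tensor (M x) (N x))) :
  total_space rel_tensor_fibre :=
  existT _ (tag e) (rel_proj (M (tag e)) (N (tag e)) (tagged e)).

(* As the canonical map is fibrewise onto, at most one smooth structure (up to
   equivalence of atlases) satisfies this. *)
Definition is_rel_tensor_structure
    (E : smooth_structure R (total_space rel_tensor_fibre)) : Prop :=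
  is_vector_bundle E /\
  smooth_on tensor_charts (structure_charts E) setT canonical_map.

End Tensor.
End Bundles.

(* Main.v *)
Require Import Defs.
From HB Require Import structures.
From mathcomp Require Import all_boot all_order all_algebra.
From mathcomp Require Import complex.
From mathcomp Require Import boolp classical_sets functions cardinality reals
  topology normedtype derive.
From mathcomp Require Import landau sequences exp.
From mathcomp Require Import ring lra.

Set Implicit Arguments.
Unset Strict Implicit.
Unset Printing Implicit Defensive.

Import Order.TTheory GRing.Theory Num.Theory.
Import numFieldNormedType.Exports.

Local Open Scope classical_set_scope.
Local Open Scope ring_scope.

(** Locally, M looks like the fixed bimodule [M x] and N like [N x]. The tensor
    product of a trivialization u of M with a trivialization v of N descends to
    the relative tensor products as soon as u and v come with the same
    trivialization of B; in general these differ by a smooth family tau of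
    automorphisms of [B x], which can be taken to be the identity at x. Because
    [M x] is right implementing, tau lifts near x to a smooth family of implementers
    (f, g, tau) of [M x] ([right_lift]), and composing the trivialization of M with
    this family makes the two trivializations of B agree ([bimod_triv_twist]). The
    maps of relative tensor products induced by u and v ([rel_map]) then have smooth
    transitions, so they are the trivializations of a bundle ([bundle_structure]),
    whose canonical map is smooth. They are trivializations of any other structure
    for which the canonical map is smooth as well, because their inverses are
    given by the canonical map ([rel_triv_local]).

    The lift exists for the following reason. Near the identity, implementers are
    exponentials of triples of derivations. If the projection to the automorphisms
    of the right algebra is open, it is onto on Lie algebras ([lie_onto]), and a
    linear section S on Lie algebras gives the smooth local section sending g to
    Exp (S (Log g)). That Exp and Log preserve all the conditions on implementers
    has one cause: each condition says that a linear map intertwines two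
    endomorphisms ([equivariant_tlin], [even_mapP]), and W X = Y W implies
    W exp X = exp Y W, and conversely for small X and Y. The same property of being
    defined in all sizes and respecting intertwiners yields the smoothness of the
    exponential, the logarithm and the inverse ([noncommutative_smooth]): a
    difference quotient is, up to a scalar, a block of the value at a block matrix.

    Finally, openness of a projection needs to be checked at the identity only
    ([left_implementingP], [right_implementingP]). There an automorphism of A lifts
    to an implementer (f, u, g) of [M x] and then g lifts to an implementer
    (g, v, h) of [N x]; the map induced by u and v completes f and h to an
    implementer of the relative tensor product ([implementing_rel_tensor]). *)

(** * Maps of class C^m between normed spaces *)
Section CkBasics.
Variable R : realType.
Implicit Types V W Z : normedModType R.

Lemma Ck_continuous V W m (U : set V) (f : V -> W) x :
  Ck m U f -> U x -> {for x, continuous f}.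
Proof. by case: m => [|m] [fc _]; exact: fc. Qed.

Lemma CkSW V W m (U : set V) (f : V -> W) : Ck m.+1 U f -> Ck m U f.
Proof.
elim: m f => [|m IH] f [fc fd]; first by split.
by split=> // v; case: (fd v) => dv /IH cv; split.
Qed.

Lemma Ck_sub V W m (U U' : set V) (f : V -> W) :
  U' `<=` U -> Ck m U f -> Ck m U' f.
Proof.
move=> sU; elim: m f => [|m IH] f [fc fd];
  (split; first by move=> x /sU; exact: fc) => //.
by move=> v; case: (fd v) => dv cv; split; [move=> x /sU; exact: dv|exact: IH].
Qed.

Lemma Ck_local V W m (U : set V) (f : V -> W) :
  (forall x, U x -> exists2 O : set V, O x & Ck m O f) -> Ck m U f.
Proof.
elim: m f => [|m IH] f Uf;
  (split; first by move=> x /Uf[P Px [fc _]]; exact: fc) => //.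
move=> v; split => [x /Uf[P Px [_ fd]]|]; first exact: (fd v).1.
by apply: IH => x /Uf[P Px [_ fd]]; exists P => //; exact: (fd v).2.
Qed.

Lemma open_eq_near V W (U : set V) (f g : V -> W) x : open U -> {in U, f =1 g} ->
  U x -> {near x, f =1 g}.
Proof.
move=> oU fg Ux; apply: filterS (open_nbhs_nbhs (conj oU Ux)) => y Uy.
by apply: fg; rewrite inE.
Qed.

Lemma open_eq_continuous V W (U : set V) (f g : V -> W) x : open U ->
  {in U, f =1 g} -> U x -> {for x, continuous f} -> {for x, continuous g}.
Proof.
move=> oU fg Ux fc; have e : f x = g x by apply: fg; rewrite inE.
have gx := open_eq_near oU fg Ux.
apply: (@cvg_trans _ (f @ x)); first exact: near_eq_cvg.
by rewrite -e.
Qed.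

Lemma Ck_eq V W m (U : set V) (f g : V -> W) : open U -> {in U, f =1 g} ->
  Ck m U f -> Ck m U g.
Proof.
move=> oU; elim: m f g => [|m IH] f g fg [fc fd];
  (split; first by move=> x Ux; exact: open_eq_continuous oU fg Ux (fc x Ux)) => //.
move=> v; case: (fd v) => dv cv; split => [x Ux|].
  by apply: near_eq_derivable (dv x Ux); exact: (open_eq_near oU).
apply: IH cv => x; rewrite inE => Ux.
by apply: near_eq_derive; exact: (open_eq_near oU).
Qed.

Lemma Ck_cst V W m (U : set V) (a : W) : Ck m U (cst a : V -> W).
Proof.
elim: m a => [|m IH] a;
  (split; first by move=> x _; exact: cst_continuous) => //.
move=> v; split => [x _|]; first exact: derivable_cst.
suff -> : 'D_v (cst a) = cst 0 :> (V -> W) by exact: IH.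
by apply/funext => x; rewrite derive_cst.
Qed.

(** Precomposition with an affine map A with linear part B, whose domain may be a
    space of matrices: differentiating f along A in direction v is differentiating
    f in direction B v. *)
Lemma Ck_pre V V' W m (U : set V) (f : V -> W) (A B : V' -> V) :
  continuous A -> (forall h x v, A (h *: v + x) = h *: B v + A x) ->
  Ck m U f -> Ck m (A @^-1` U) (f \o A).
Proof.
move=> Ac AB; elim: m f => [|m IH] f [fc fd];
  (split; first by move=> x Ux; apply: continuous_comp; [exact: Ac|exact: fc]) => //.
move=> v; have [dv cv] := fd (B v).
have e (x : V') : (fun h : R => h^-1 *: ((f \o A \o shift x) (h *: v) - f (A x)))
   = (fun h : R => h^-1 *: ((f \o shift (A x)) (h *: B v) - f (A x))).
  by apply/funext => h; rewrite /= AB.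
split => [x Ux|]; first by rewrite /derivable e; exact: dv.
suff -> : 'D_v (f \o A) = 'D_(B v) f \o A by exact: IH.
by apply/funext => x; rewrite /derive e.
Qed.

Lemma derivable_post V W Z (L : {linear W -> Z}) (f : V -> W) x v :
  continuous L -> derivable f x v ->
  is_derive x v (L \o f) (L ('D_v f x)).
Proof.
move=> Lc df.
have e : (fun h : R => h^-1 *: ((L \o f \o shift x) (h *: v) - L (f x)))
   = L \o (fun h : R => h^-1 *: ((f \o shift x) (h *: v) - f x)).
  by apply/funext => h; rewrite /= linearZ_LR [L (_ - _)]linearB.
have c : (fun h : R => h^-1 *: ((L \o f \o shift x) (h *: v) - L (f x))) @ 0^'
   --> L ('D_v f x).
  by rewrite e; apply: cvg_comp; [exact: df|exact: Lc].
by split; [apply/cvg_ex; exists (L ('D_v f x))|exact: cvg_lim].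
Qed.

Lemma Ck_post V W Z m (U : set V) (f : V -> W) (L : {linear W -> Z}) :
  open U -> continuous L -> Ck m U f -> Ck m U (L \o f).
Proof.
move=> oU Lc; elim: m f => [|m IH] f [fc fd];
  (split; first by move=> x Ux; apply: continuous_comp; [exact: fc|exact: Lc]) => //.
move=> v; have [dv cv] := fd v; split => [x Ux|].
  by have [] := derivable_post Lc (dv x Ux).
apply: Ck_eq (IH _ cv) => // x; rewrite inE => Ux.
by have [_ ->] := derivable_post Lc (dv x Ux).
Qed.

Lemma CkD V W m (U : set V) (f g : V -> W) : open U ->
  Ck m U f -> Ck m U g -> Ck m U (f + g).
Proof.
move=> oU; elim: m f g => [|m IH] f g [fc fd] [gc gd];
  (split; first by move=> x Ux; apply: continuousD; [exact: fc|exact: gc]) => //.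
move=> v; have [dv cv] := fd v; have [dv' cv'] := gd v; split => [x Ux|].
  by apply: derivableD; [exact: dv|exact: dv'].
apply: Ck_eq (IH _ _ cv cv') => // x; rewrite inE => Ux.
by rewrite deriveD //; [exact: dv|exact: dv'].
Qed.

Lemma Ck_sum V W m (U : set V) (I : Type) (r : seq I) (f : I -> V -> W) :
  open U -> (forall i, Ck m U (f i)) -> Ck m U (\sum_(i <- r) f i).
Proof.
move=> oU cf; elim: r => [|i r IH]; first by rewrite big_nil; exact: Ck_cst.
by rewrite big_cons; exact: CkD.
Qed.

Lemma CkM V m (U : set V) (f g : V -> R) : open U ->
  Ck m U f -> Ck m U g -> Ck m U (f * g).
Proof.
move=> oU; elim: m f g => [|m IH] f g cf cg.
  by case: cf cg => fc _ [gc _]; split => // x Ux; apply: continuousM;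
    [exact: fc|exact: gc].
have [cf' cg'] := (CkSW cf, CkSW cg); case: cf cg => fc fd [gc gd]; split => //.
  by move=> x Ux; apply: continuousM; [exact: fc|exact: gc].
move=> v; have [dv cv] := fd v; have [dv' cv'] := gd v; split => [x Ux|].
  by apply: derivableM; [exact: dv|exact: dv'].
apply: (@Ck_eq _ _ _ _ (f * 'D_v g + g * 'D_v f)) => //.
  by move=> x; rewrite inE => Ux; rewrite deriveM //; [exact: dv|exact: dv'].
by apply: CkD => //; apply: IH.
Qed.

Lemma cvg_mx_entry T (F : set_system T) (FF : Filter F) m n
    (f : T -> 'M[R]_(m, n)) (X : 'M[R]_(m, n)) :
  (forall i j, (fun t => f t i j) @ F --> X i j) -> f @ F --> X.
Proof.
move=> fX; apply/cvg_ballP => e e0; near=> y; split => // i j.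
move: i j; near: y; apply: filter_forall => i; apply: filter_forall => j.
exact: (cvg_ball (fX i j) e0).
Unshelve. all: by end_near. Qed.

Lemma Ck_mxP V m p q (U : set V) (f : V -> 'M[R]_(p, q)) : open U ->
  Ck m U f <-> forall i j, Ck m U (fun x => f x i j).
Proof.
move=> oU; split => [cf i j|].
  have lc : linear (fun M : 'M[R]_(p, q) => M i j : R) by move=> a M N; rewrite !mxE.
  pose l := GRing.isLinear.Build R 'M[R]_(p, q) R *:%R (fun M => M i j) lc.
  pose L : {linear 'M[R]_(p, q) -> R} := HB.pack (fun M : 'M[R]_(p, q) => M i j) l.
  apply: (@Ck_post _ _ _ m U f L oU _ cf); exact: coord_continuous.
elim: m f => [|m IH] f cf.
  split => // x Ux; apply: cvg_mx_entry => i j.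
  exact: Ck_continuous (cf i j) Ux.
split.
  move=> x Ux; apply: cvg_mx_entry => i j; exact: Ck_continuous (cf i j) Ux.
move=> v; have df x : U x -> derivable f x v.
  by move=> Ux; apply/derivable_mxP => i j; have [_ /(_ v)[+ _]] := cf i j; exact.
split => //; apply: (@Ck_eq _ _ _ _
    (fun x => \matrix_(i, j) 'D_v (fun y => f y i j) x)) => //.
  by move=> x; rewrite inE => /df/derive_mx ->.
apply: IH => i j; have [_ /(_ v)[_ c]] := cf i j.
by apply: Ck_eq c => // x _; rewrite mxE.
Qed.

Lemma continuous_sum (T : topologicalType) W (I : Type) (r : seq I)
    (F : I -> T -> W) :
  (forall i, continuous (F i)) -> continuous (fun x => \sum_(i <- r) F i x).
Proof.
move=> Fc; elim: r => [|i r IH] x.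
  under eq_fun do rewrite big_nil; exact: cst_continuous.
under eq_fun do rewrite big_cons; apply: continuousD; [exact: Fc|exact: IH].
Qed.

Lemma linear_mx_continuous m n W (f : {linear 'M[R]_(m, n) -> W}) :
  continuous f.
Proof.
have -> : (f : _ -> _) = (fun X => \sum_i \sum_j X i j *: f (delta_mx i j)).
  apply/funext => X; rewrite {1}[X]matrix_sum_delta linear_sum; apply: eq_bigr => i _.
  by rewrite linear_sum; apply: eq_bigr => j _; rewrite linearZ.
apply: continuous_sum => i; apply: continuous_sum => j X.
by apply: continuousZl; exact: coord_continuous.
Qed.

End CkBasics.
(** * The chain rule *)
Section ChainRule.
Variable R : realType.
Implicit Types V W : normedModType R.

Lemma line_derive V W (f : V -> W) (x v : V) (t : R) :
  derivable f (t *: v + x) v ->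
  is_derive t 1 (fun s : R => f (s *: v + x)) ('D_v f (t *: v + x)).
Proof.
move=> df.
have e : (fun h : R => h^-1 *: (((fun s : R => f (s *: v + x)) \o shift t) (h *: 1)
             - f (t *: v + x))) =
    (fun h : R => h^-1 *: ((f \o shift (t *: v + x)) (h *: v) - f (t *: v + x))).
  by apply/funext => h; rewrite /= [h *: 1]mulr1 scalerDl addrA.
by split; rewrite /derivable /derive e.
Qed.

(** The mean value theorem along the segment from z to c *: v + z, for either
    sign of c. *)
Lemma MVT_line V (g : V -> R) (z v : V) (c : R) :
  (forall t : R, `|t| <= `|c| -> derivable g (t *: v + z) v) ->
  exists2 t : R, `|t| <= `|c| & g (c *: v + z) - g z = c * 'D_v g (t *: v + z).
Proof.
have pos (y : V) (a : R) : 0 <= a ->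
    (forall t : R, 0 <= t <= a -> derivable g (t *: v + y) v) ->
    exists2 t : R, 0 <= t <= a & g (a *: v + y) - g y = a * 'D_v g (t *: v + y).
  move=> a0 dg; pose phi (s : R) := g (s *: v + y).
  have dphi t : 0 <= t <= a -> is_derive t 1 phi ('D_v g (t *: v + y)).
    by move=> /dg; exact: line_derive.
  have [|||t ta e] := @MVT_segment R phi (fun t => 'D_v g (t *: v + y)) 0 a.
  - exact: a0.
  - move=> t; rewrite in_itv /= => /andP[t0 ta]; apply: dphi.
    by rewrite (ltW t0) (ltW ta).
  - by apply: derivable_within_continuous => t; rewrite in_itv /= => /dphi[].
  exists t; first by move: ta; rewrite in_itv.
  by move: e; rewrite /phi scale0r add0r subr0 mulrC.
move=> dg; have [c0|c0] := leP 0 c.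
  have [|t tc e] := pos z c c0.
    by move=> t /andP[t0 tc]; apply: dg; rewrite !ger0_norm.
  by exists t => //; case/andP: tc => t0 tc; rewrite !ger0_norm.
have [||t tc] := pos (c *: v + z) (- c).
- by rewrite oppr_ge0 ltW.
- move=> t /andP[t0 tc]; rewrite addrA -scalerDl; apply: dg.
  rewrite [`|c|]ltr0_norm // ler0_norm; last by rewrite -lerBrDr sub0r.
  by rewrite opprD gerDr oppr_le0.
rewrite scaleNr addKr addrA -scalerDl => e; exists (t + c).
  case/andP: tc => t0 tc.
  rewrite [`|c|]ltr0_norm // ler0_norm; last by rewrite -lerBrDr sub0r.
  by rewrite opprD gerDr oppr_le0.
by rewrite -[LHS]opprB e mulNr opprK.
Qed.

(** Directional derivatives alone do not suffice for a chain rule; continuous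
    partial derivatives give the total differential. *)
Lemma C1_differentiable n (U : set 'rV[R]_n) (g : 'rV[R]_n -> R) a :
  open U -> Ck 1 U g -> U a -> differentiable g a /\
  forall v, 'd g a v = \sum_j v 0 j * 'D_(delta_mx 0 j) g a.
Proof.
move=> oU [gc gd] Ua.
pose D (j : 'I_n) (x : 'rV[R]_n) : R := 'D_(delta_mx 0 j) g x.
have Dc j : {for a, continuous (D j)} by have [_ [+ _]] := gd (delta_mx 0 j); exact.
pose L (v : 'rV[R]_n) : R := \sum_j v 0 j * D j a.
have Llin : linear (L : 'rV[R]_n -> R).
  move=> k v w; rewrite /L [X in _ = X + _]mulr_sumr -big_split /=; apply: eq_bigr => j _.
  by rewrite !mxE mulrDl mulrA.
pose Li := GRing.isLinear.Build R 'rV[R]_n R *:%R L Llin.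
pose LL : {linear 'rV[R]_n -> R} := HB.pack L Li.
have Lc : continuous LL by exact: linear_mx_continuous.
have est : forall eta : R, 0 < eta -> \forall h \near (0 : 'rV[R]_n),
    `|g (h + a) - g a - L h| <= eta * \sum_j `|h 0 j|.
  move=> eta eta0.
  have /nbhs_ballP[d d0 dP] : \forall y \near a, U y /\ forall j, `|D j a - D j y| <= eta.
    near=> y; split; first by near: y; exact: open_nbhs_nbhs.
    move=> j; move: j; near: y; apply: filter_forall => j.
    by have /cvgr_dist_le/(_ eta eta0) := Dc j.
  apply/nbhs_ballP; exists d => // h; rewrite -ball_normE /= sub0r normrN => hd.
  pose z s := \sum_(j <- s) h 0 j *: delta_mx 0 j + a : 'rV[R]_n.
  have zball (t : R) j s : `|t| <= `|h 0 j| -> uniq (j :: s) ->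
      ball a d (t *: delta_mx 0 j + z s).
    move=> th us; rewrite -ball_normE /=; apply: le_lt_trans hd.
    rewrite distrC /z addrA addrK.
    rewrite /Num.Def.normr /= mx_normrE; apply: bigmax_le => [|[i l] _] /=.
      exact: (normr_ge0 h).
    rewrite !mxE summxE ord1.
    have hl : `|h 0 l| <= mx_norm h.
      by rewrite mx_normrE; exact: (le_bigmax _ (fun i => `|h i.1 i.2|) (0, l)).
    apply: le_trans hl; move: us => /= /andP[js us].
    have sumE : \sum_(i0 <- s) (h 0 i0 *: delta_mx 0 i0 : 'rV[R]_n) 0 l =
                if l \in s then h 0 l else 0.
      case: ifP => ls.
        rewrite (bigD1_seq l) //= big1 ?addr0 => [|j' jl].
          by rewrite !mxE !eqxx mulr1.
        by rewrite !mxE eqxx eq_sym (negbTE jl) mulr0.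
      rewrite big_seq big1 // => j' js'; rewrite !mxE eqxx /=.
      by case: eqP ls js' => [->|]; rewrite ?mulr0 // => ->.
    rewrite sumE /=; case: eqP => [->|_].
      by rewrite (negbTE js) addr0 mulr1.
    rewrite !mulr0 add0r; case: ifP => // _; by rewrite normr0.
  (* h is added one coordinate at a time; by the mean value theorem each
     increment is a partial derivative at a nearby point. *)
  have step s : uniq s -> `|g (z s) - g a - \sum_(j <- s) h 0 j * D j a| <=
      eta * \sum_(j <- s) `|h 0 j|.
    elim: s => [|j s IH] us; first by rewrite /z !big_nil add0r !subrr normr0 mulr0.
    have us' : uniq s by case/andP: us.
    pose v := delta_mx 0 j : 'rV[R]_n.
    have zU (t : R) : `|t| <= `|h 0 j| -> U (t *: v + z s) /\
        forall j, `|D j a - D j (t *: v + z s)| <= eta.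
      by move=> t01; apply: dP; exact: zball.
    have dj y : U y -> derivable g y (delta_mx 0 j) by exact: (gd _).1.
    have [t /zU[tU _]|c c01 e] := @MVT_line _ g (z s) v (h 0 j); first exact: dj.
    have zE : z (j :: s) = h 0 j *: v + z s by rewrite /z big_cons addrA.
    have [cU cD] := zU c c01.
    rewrite zE !big_cons -[g (_ *: v + z s)](subrK (g (z s))) e mulrDr.
    rewrite (_ : _ - _ = h 0 j * (D j (c *: v + z s) - D j a) +
      (g (z s) - g a - \sum_(j <- s) h 0 j * D j a)); last by rewrite /D; ring.
    apply: le_trans (ler_normD _ _) _; apply: lerD; last exact: IH.
    rewrite normrM mulrC ler_wpM2r // distrC; exact: cD.
  have := step (index_enum 'I_n) (index_enum_uniq _).
  suff -> : z (index_enum 'I_n) = h + a by [].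
  by rewrite /z; congr (_ + a); rewrite [RHS]row_sum_delta.
have oest (e : R) : 0 < e -> \forall h \near (0 : 'rV[R]_n),
    `|g (h + a) - (g a + L h)| <= e * `|h|.
  move=> e0; have n1 : 0 < n%:R + 1 :> R by rewrite ltr_wpDl.
  apply: filterS (est (e / (n%:R + 1)) _); last by rewrite divr_gt0.
  move=> h hle; rewrite opprD addrA; apply: le_trans hle _.
  rewrite -mulrA ler_wpM2l ?(ltW e0) // ler_pdivrMl //.
  apply: (@le_trans _ _ (\sum_(j < n) `|h|)).
    apply: ler_sum => j _; rewrite [leRHS]/Num.Def.normr /= mx_normrE.
    exact: (le_bigmax _ (fun i => `|h i.1 i.2|) (0, j)).
  by rewrite sumr_const card_ord -[leLHS]mulr_natl ler_wpM2r // lerDl.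
have dE : 'd g a = LL :> ('rV[R]_n -> R).
  apply: diff_unique => //; apply: landau.eqaddoE; apply/landau.eqaddoP => e e0.
  exact: oest.
split; last by move=> v; rewrite dE.
apply/diff_locallyP; split; rewrite dE //.
apply: landau.eqaddoE; apply/landau.eqaddoP => e e0; exact: oest.
Unshelve. all: by end_near. Qed.

Lemma derive_chain V n (f : V -> 'rV[R]_n) (g : 'rV[R]_n -> R) x v :
  derivable f x v -> differentiable g (f x) ->
  derivable (g \o f) x v /\ 'D_v (g \o f) x = 'd g (f x) ('D_v f x).
Proof.
move=> df dg; pose phi (s : R) := f (s *: v + x).
have df0 : derivable f (0 *: v + x) v by rewrite scale0r add0r.
have [dphi ephi] := line_derive df0.
rewrite scale0r add0r in ephi.
have phi0 : phi 0 = f x by rewrite /phi scale0r add0r.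
have dphi' : differentiable phi 0 by apply/derivable1_diffP.
have dgphi : differentiable g (phi 0) by rewrite phi0.
have dc : differentiable (g \o phi) 0 by exact: differentiable_comp.
have dgf : derivable (g \o f) x v by apply/derivable1P/derivable1_diffP.
split => //.
have dgf0 : derivable (g \o f) (0 *: v + x) v by rewrite scale0r add0r.
have [_] := line_derive dgf0; rewrite scale0r add0r => <-.
rewrite -[fun s : R => _]/(g \o phi) deriveE // diff_comp //= phi0; congr ('d g _ _).
by rewrite -ephi deriveE.
Qed.

(** The chain rule writes a derivative of the composite as a sum of products of
    derivatives of f with composites of class C^m, so induction on m applies. *)
Lemma Ck_comp_real V n m (U : set V) (U' : set 'rV[R]_n) (f : V -> 'rV[R]_n)
    (g : 'rV[R]_n -> R) :
  open U -> open U' -> (forall x, U x -> U' (f x)) ->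
  Ck m U f -> Ck m U' g -> Ck m U (g \o f).
Proof.
move=> oU oU' UU'; elim: m f g UU' => [|m IH] f g UU' cf cg.
  split => // x Ux; apply: continuous_comp; first exact: (cf.1).
  by apply: (cg.1); exact: UU'.
have cf' := CkSW cf; have cg1 : Ck 1 U' g.
  by case: cg => gc gd; split => // v; split; [exact: (gd v).1|
     split => // y Uy; exact: Ck_continuous (gd v).2 Uy].
have chain x v : U x -> derivable (g \o f) x v /\ 'D_v (g \o f) x =
    \sum_j ('D_v f x) 0 j * 'D_(delta_mx 0 j) g (f x).
  move=> Ux; have [dg dgE] := C1_differentiable oU' cg1 (UU' x Ux).
  have [d e] := derive_chain (((cf.2 v).1) x Ux) dg.
  by split => //; rewrite e dgE.
split=> [x Ux|v].
  by apply: continuous_comp; [exact: (cf.1)|apply: (cg.1); exact: UU'].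
split=> [x Ux|]; first exact: (chain x v Ux).1.
apply: (@Ck_eq _ _ _ _ _ (\sum_j
   ((fun x => ('D_v f x) 0 j) * ('D_(delta_mx 0 j) g \o f)))) => //.
  move=> x; rewrite inE => Ux; rewrite (chain x v Ux).2 fct_sumE.
  by apply: eq_bigr.
apply: Ck_sum => // j; apply: CkM => //.
  by have /Ck_mxP := (cf.2 v).2; exact.
by apply: IH => //; exact: (cg.2 _).2.
Qed.

Lemma Ck_comp V n m p (U : set V) (U' : set 'rV[R]_n) (f : V -> 'rV[R]_n)
    (g : 'rV[R]_n -> 'rV[R]_p) :
  open U -> open U' -> (forall x, U x -> U' (f x)) ->
  Ck m U f -> Ck m U' g -> Ck m U (g \o f).
Proof.
move=> oU oU' UU' cf cg; apply/Ck_mxP => // i j.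
by apply: (@Ck_comp_real _ _ _ U U' f (fun y => g y i j)) => //; have /Ck_mxP := cg; exact.
Qed.

End ChainRule.

(** * The exponential of matrices *)
Section MatrixExponential.
Variable R : realType.

(** The operator norm for row vectors with the sup norm; unlike the entrywise
    norm it is submultiplicative with a constant that does not depend on the
    size, and bounded by the same constant on block diagonal matrices. *)
Definition rownorm m n (X : 'M[R]_(m, n)) : R :=
  \big[Num.max/0]_i \sum_j `|X i j|.

Lemma rownorm_leP m n (X : 'M[R]_(m, n)) c : 0 <= c ->
  reflect (forall i, \sum_j `|X i j| <= c) (rownorm X <= c).
Proof.
move=> c0; apply: (iffP idP) => [Xc i|Xc].
  by apply: le_trans Xc; exact: (le_bigmax _ (fun i => \sum_j `|X i j|) i).
by apply: bigmax_le => // i _; exact: Xc.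
Qed.

Lemma rownorm_ge0 m n (X : 'M[R]_(m, n)) : 0 <= rownorm X.
Proof.
rewrite /rownorm; elim/big_ind: _ => // [x y x0 y0|i _]; last exact: sumr_ge0.
by rewrite le_max x0.
Qed.

Hint Resolve rownorm_ge0 : core.

Lemma rownorm_row m n (X : 'M[R]_(m, n)) i : \sum_j `|X i j| <= rownorm X.
Proof. by move/rownorm_leP: (lexx (rownorm X)); exact. Qed.

Lemma rownormD m n (X Y : 'M[R]_(m, n)) :
  rownorm (X + Y) <= rownorm X + rownorm Y.
Proof.
apply/rownorm_leP => [|i]; first exact: addr_ge0.
apply: le_trans (lerD (rownorm_row X i) (rownorm_row Y i)).
by rewrite -big_split /=; apply: ler_sum => j _; rewrite mxE ler_normD.
Qed.

Lemma rownormZ m n a (X : 'M[R]_(m, n)) : rownorm (a *: X) = `|a| * rownorm X.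
Proof.
apply/eqP; rewrite eq_le; apply/andP; split.
  apply/rownorm_leP => [|i]; first exact: mulr_ge0.
  apply: le_trans (ler_wpM2l (normr_ge0 a) (rownorm_row X i)).
  by rewrite mulr_sumr; apply: ler_sum => j _; rewrite mxE normrM.
have [->|a0] := eqVneq a 0; first by rewrite normr0 mul0r.
rewrite mulrC -ler_pdivlMr ?normr_gt0 //.
apply/rownorm_leP => [|i]; first by rewrite divr_ge0.
rewrite ler_pdivlMr ?normr_gt0 // mulrC; apply: le_trans (rownorm_row (a *: X) i).
by rewrite mulr_sumr; apply: ler_sum => j _; rewrite mxE normrM.
Qed.

Lemma rownormN m n (X : 'M[R]_(m, n)) : rownorm (- X) = rownorm X.
Proof. by rewrite -scaleN1r rownormZ normrN1 mul1r. Qed.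

Lemma rownorm0 m n : rownorm (0 : 'M[R]_(m, n)) = 0.
Proof. by rewrite -(scale0r (0 : 'M[R]_(m, n))) rownormZ normr0 mul0r. Qed.

Lemma rownormB m n (X Y : 'M[R]_(m, n)) : rownorm (X - Y) = rownorm (Y - X).
Proof. by rewrite -rownormN opprB. Qed.

Lemma rownormM m n p (X : 'M[R]_(m, n)) (Y : 'M[R]_(n, p)) :
  rownorm (X *m Y) <= rownorm X * rownorm Y.
Proof.
apply/rownorm_leP => [|i]; first exact: mulr_ge0.
apply: (@le_trans _ _ (\sum_j \sum_l `|X i l| * `|Y l j|)).
  apply: ler_sum => j _; rewrite mxE; apply: le_trans (ler_norm_sum _ _ _) _.
  by apply: ler_sum => l _; rewrite normrM.
rewrite exchange_big /=.
apply: le_trans (ler_wpM2r (rownorm_ge0 Y) (rownorm_row X i)).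
rewrite mulr_suml; apply: ler_sum => l _; rewrite -mulr_sumr.
by apply: ler_wpM2l => //; exact: rownorm_row.
Qed.

Lemma rownorm_sum m n (I : Type) (r : seq I) (F : I -> 'M[R]_(m, n)) :
  rownorm (\sum_(i <- r) F i) <= \sum_(i <- r) rownorm (F i).
Proof.
elim: r => [|i r IH]; first by rewrite !big_nil rownorm0.
by rewrite !big_cons; apply: le_trans (rownormD _ _) _; rewrite lerD2l.
Qed.

Lemma rownorm1 n : rownorm (1%:M : 'M[R]_n) <= 1.
Proof.
apply/rownorm_leP => // i; rewrite (bigD1 i) //= big1 => [|j ji].
  by rewrite mxE eqxx normr1 addr0.
by rewrite mxE eq_sym (negbTE ji) normr0.
Qed.

Lemma norm_le_rownorm m n (X : 'M[R]_(m, n)) : `|X| <= rownorm X.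
Proof.
rewrite /Num.Def.normr /= mx_normrE; apply: bigmax_le => // -[i j] _ /=.
apply: le_trans (rownorm_row X i); rewrite (bigD1 j) //= lerDl.
by apply: sumr_ge0.
Qed.

Lemma rownorm_le_norm m n (X : 'M[R]_(m, n)) : rownorm X <= n%:R * `|X|.
Proof.
apply/rownorm_leP => [|i]; first exact: mulr_ge0.
have -> : n%:R * `|X| = \sum_(j < n) `|X| by rewrite sumr_const card_ord mulr_natl.
apply: ler_sum => j _; rewrite [leRHS]/Num.Def.normr /= mx_normrE.
exact: (le_bigmax _ (fun i => `|X i.1 i.2|) (i, j)).
Qed.

Lemma rownorm_eq0 m n (X : 'M[R]_(m, n)) : rownorm X <= 0 -> X = 0.
Proof.
move=> X0; apply/eqP; rewrite -normr_le0.
exact: le_trans (norm_le_rownorm X) X0.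
Qed.

Lemma cvg_rownormP T (F : set_system T) (FF : Filter F) m n
    (f : T -> 'M[R]_(m, n)) (X : 'M[R]_(m, n)) :
  f @ F --> X <->
  (forall e : R, 0 < e -> \forall t \near F, rownorm (X - f t) <= e).
Proof.
split => [fX e e0|fX].
  have n1 : 0 < n%:R + 1 :> R by rewrite ltr_wpDl.
  have /cvgr_dist_le/(_ (e / (n%:R + 1))) := fX; rewrite divr_gt0 // => /(_ isT).
  apply: filterS => t; rewrite ler_pdivlMr // mulrC => Xt.
  apply: le_trans (rownorm_le_norm _) _; apply: le_trans Xt.
  by rewrite ler_wpM2r // lerDl.
apply/cvgrPdist_le => e e0; apply: filterS (fX e e0) => t.
exact: le_trans (norm_le_rownorm _).
Qed.

Lemma rownorm_lim m n (F : nat -> 'M[R]_(m, n)) (X : 'M[R]_(m, n)) c :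
  F @ \oo --> X -> (\forall k \near \oo, rownorm (F k) <= c) -> rownorm X <= c.
Proof.
move=> /cvg_rownormP FX Fc; apply/ler_addgt0Pr => e e0.
have [k [Fk Xk]] : exists k, rownorm (F k) <= c /\ rownorm (X - F k) <= e.
  apply: (@filter_ex _ \oo); near=> k; split; first by near: k.
  by near: k; exact: FX.
rewrite -(subrK (F k) X) addrC; apply: le_trans (rownormD _ _) _.
exact: lerD.
Unshelve. all: by end_near. Qed.

Lemma cvg_mulmx T (F : set_system T) (FF : Filter F) m n p
    (A : 'M[R]_(m, n)) (f : T -> 'M[R]_(n, p)) (X : 'M[R]_(n, p)) :
  f @ F --> X -> (fun k => A *m f k) @ F --> A *m X.
Proof.
move=> fX; pose L : {linear 'M[R]_(n, p) -> 'M[R]_(m, p)} := mulmx A.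
have Lc := @linear_mx_continuous _ _ _ _ L; apply: (cvg_comp f L fX); exact: Lc.
Qed.

Lemma cvg_mulmxl T (F : set_system T) (FF : Filter F) m n p
    (A : 'M[R]_(n, p)) (f : T -> 'M[R]_(m, n)) (X : 'M[R]_(m, n)) :
  f @ F --> X -> (fun k => f k *m A) @ F --> X *m A.
Proof.
move=> fX; pose L : {linear 'M[R]_(m, n) -> 'M[R]_(m, p)} := mulmxr A.
have Lc := @linear_mx_continuous _ _ _ _ L; apply: (cvg_comp f L fX); exact: Lc.
Qed.

Lemma summable_cvg_mx m n (u : nat -> 'M[R]_(m, n)) (v : nat -> R) :
  (forall k, rownorm (u k) <= v k) -> cvgn (series v) -> cvgn (series u).
Proof.
move=> uv cv; have uij i j : cvgn (series (fun k => u k i j)).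
  apply: normed_cvg; apply: series_le_cvg cv => k; first exact: normr_ge0.
    exact: (le_trans (rownorm_ge0 (u k)) (uv k)).
  apply: le_trans (uv k); apply: le_trans (rownorm_row _ i).
  by rewrite (bigD1 j) //= lerDl; apply: sumr_ge0.
apply/cvg_ex; exists (\matrix_(i, j) limn (series (fun k => u k i j))).
apply: cvg_mx_entry => i j; rewrite mxE.
have -> : (fun N => series u N i j) = series (fun k => u k i j); last exact: uij.
by apply/funext => N; rewrite /series /= summxE.
Qed.

Lemma is_cvg_exp_series n (X : 'M[R]_n) :
  cvgn (series (fun k => k`!%:R^-1 *: X ^+ k)).
Proof.
have pw k : rownorm (X ^+ k) <= rownorm X ^+ k.
  elim: k => [|k IH]; first by rewrite !expr0; exact: rownorm1.
  by rewrite !exprS; apply: le_trans (rownormM _ _) _; rewrite ler_wpM2l.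
apply: summable_cvg_mx (is_cvg_series_exp_coeff (rownorm X)) => k; rewrite rownormZ /exp_coeff /=.
by rewrite ger0_norm ?invr_ge0 // mulrC ler_wpM2r ?invr_ge0.
Qed.

Definition mexp n (X : 'M[R]_n) : 'M[R]_n :=
  limn (series (fun k => k`!%:R^-1 *: X ^+ k)).

Lemma cvg_mexp n (X : 'M[R]_n) :
  (fun N => \sum_(k < N) k`!%:R^-1 *: X ^+ k) @ \oo --> mexp X.
Proof.
have -> : (fun N => \sum_(k < N) k`!%:R^-1 *: X ^+ k) =
          series (fun k => k`!%:R^-1 *: X ^+ k).
  by apply/funext => N; rewrite /series /= big_mkord.
exact: is_cvg_exp_series.
Qed.

Lemma invfact_mul k : (k.+1)`!%:R^-1 * k.+1%:R = k`!%:R^-1 :> R.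
Proof. by rewrite factS natrM invfM mulrAC mulVf ?mul1r ?pnatr_eq0. Qed.

Lemma sum_exp_le (r : R) N : 0 <= r -> \sum_(k < N) k`!%:R^-1 * r ^+ k <= expR r.
Proof.
move=> r0; have -> : \sum_(k < N) k`!%:R^-1 * r ^+ k = series (exp_coeff r) N.
  by rewrite /series /= big_mkord; apply: eq_bigr => k _; rewrite mulrC.
apply: nondecreasing_cvgn_le; last exact: is_cvg_series_exp_coeff.
by apply: nondecreasing_series => k _ _; exact: exp_coeff_ge0.
Qed.

(** W is any rectangular matrix, so that one estimate serves two purposes: with
    Y W = W X it shows that functions of X respect intertwiners, and with W = 1 it
    is a Lipschitz estimate. The factor is the derivative of r ^ k. *)
Lemma expX_intertwine m n (X : 'M[R]_n) (Y : 'M[R]_m) W r k :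
  rownorm X <= r -> rownorm Y <= r ->
  rownorm (Y ^+ k *m W - W *m X ^+ k) <=
  k%:R * r ^+ k.-1 * rownorm (Y *m W - W *m X).
Proof.
move=> Xr Yr; have r0 : 0 <= r by apply: le_trans Xr.
have pw l : rownorm (X ^+ l) <= r ^+ l.
  elim: l => [|l IH]; first by rewrite !expr0; exact: rownorm1.
  rewrite !exprS; apply: le_trans (rownormM _ _) _; exact: ler_pM.
elim: k => [|k IH]; first by rewrite !expr0 mul1mx mulmx1 subrr rownorm0 !mul0r.
have -> : Y ^+ k.+1 *m W - W *m X ^+ k.+1 =
    Y *m (Y ^+ k *m W - W *m X ^+ k) + (Y *m W - W *m X) *m X ^+ k.
  by rewrite !exprS -!mulmxE mulmxBr mulmxBl !mulmxA addrA subrK.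
apply: le_trans (rownormD _ _) _.
have -> : k.+1%:R * r ^+ k.+1.-1 * rownorm (Y *m W - W *m X) =
   r * (k%:R * r ^+ k.-1 * rownorm (Y *m W - W *m X)) +
   rownorm (Y *m W - W *m X) * r ^+ k.
  rewrite -natr1 mulrDl mul1r mulrDl [r ^+ _ * _]mulrC !mulrA /=.
  case: k {IH} => [|k]; first by rewrite !mul0r mulr0 !mul0r.
  by rewrite [r * _]mulrC exprS !mulrA.
apply: lerD; first by apply: le_trans (rownormM _ _) _; exact: ler_pM.
by apply: le_trans (rownormM _ _) _; exact: ler_pM.
Qed.

Lemma mexp_intertwine_le m n (X : 'M[R]_n) (Y : 'M[R]_m) W r :
  rownorm X <= r -> rownorm Y <= r ->
  rownorm (mexp Y *m W - W *m mexp X) <= expR r * rownorm (Y *m W - W *m X).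
Proof.
move=> Xr Yr; have r0 : 0 <= r by apply: le_trans Xr.
apply: (@rownorm_lim _ _ (fun N => (\sum_(k < N) k`!%:R^-1 *: Y ^+ k) *m W -
   W *m (\sum_(k < N) k`!%:R^-1 *: X ^+ k))).
  by apply: cvgB; [apply: cvg_mulmxl|apply: cvg_mulmx]; exact: cvg_mexp.
apply: nearW => N; rewrite mulmx_suml mulmx_sumr -sumrB.
apply: le_trans (rownorm_sum _ _) _.
apply: (@le_trans _ _ (\sum_(k < N) k`!%:R^-1 *
   (k%:R * r ^+ k.-1 * rownorm (Y *m W - W *m X)))).
  apply: ler_sum => k _; rewrite -scalemxAl -scalemxAr -scalerBr rownormZ.
  rewrite ger0_norm ?invr_ge0 // ler_wpM2l ?invr_ge0 //.
  exact: expX_intertwine.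
under eq_bigr do rewrite mulrA; rewrite -mulr_suml ler_wpM2r //.
case: N => [|N]; first by rewrite big_ord0 expR_ge0.
rewrite big_ord_recl !mul0r mulr0 add0r.
apply: le_trans (sum_exp_le N r0); apply: ler_sum => k _ /=.
by rewrite /bump /= add1n mulrA invfact_mul.
Unshelve. all: by end_near. Qed.

(** Leaving out the linear term leaves out the 1 in the derivative exp r of the
    scalar series. The constant is small near 0, which makes the exponential
    invertible there. *)
Lemma mexp_intertwine_sub m n (X : 'M[R]_n) (Y : 'M[R]_m) W r :
  rownorm X <= r -> rownorm Y <= r ->
  rownorm ((mexp Y *m W - W *m mexp X) - (Y *m W - W *m X)) <=
  (expR r - 1) * rownorm (Y *m W - W *m X).
Proof.
move=> Xr Yr; have r0 : 0 <= r by apply: le_trans Xr.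
apply: (@rownorm_lim _ _ (fun N => (\sum_(k < N) k`!%:R^-1 *: Y ^+ k) *m W -
   W *m (\sum_(k < N) k`!%:R^-1 *: X ^+ k) - (Y *m W - W *m X))).
  apply: cvgB; last exact: cvg_cst.
  by apply: cvgB; [apply: cvg_mulmxl|apply: cvg_mulmx]; exact: cvg_mexp.
exists 2%N => // -[|[|K]] // _ /=; rewrite mulmx_suml mulmx_sumr -sumrB.
rewrite !big_ord_recl /= !expr0 !expr1 invr1 !scale1r.
rewrite -[(1 : 'M[R]_m)]/(1%:M) -[(1 : 'M[R]_n)]/(1%:M) mul1mx mulmx1 subrr add0r.
rewrite [X in X - _]addrC addrK.
apply: le_trans (rownorm_sum _ _) _.
apply: (@le_trans _ _ (\sum_(k < K) (k.+1)`!%:R^-1 * r ^+ k.+1 * rownorm (Y *m W - W *m X))).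
  apply: ler_sum => k _; rewrite -scalemxAl -scalemxAr -scalerBr rownormZ.
  rewrite ger0_norm ?invr_ge0 //.
  rewrite /bump /= !add1n.
  apply: le_trans (ler_wpM2l _ (expX_intertwine W k.+2 Xr Yr)) _.
    by rewrite invr_ge0.
  by rewrite !mulrA invfact_mul.
rewrite -mulr_suml ler_wpM2r // lerBrDl.
apply: le_trans (sum_exp_le K.+1 r0).
by rewrite big_ord_recl /= expr0 mulr1 invr1.
Qed.

End MatrixExponential.

(** * The logarithm of matrices *)
Section MatrixLogarithm.
Variable R : realType.
Let rownorm_pos m n (X : 'M[R]_(m, n)) : 0 <= rownorm X.
Proof. exact: rownorm_ge0. Qed.
Hint Resolve rownorm_pos : core.

Lemma mexp_intertwine m n (X : 'M[R]_n) (Y : 'M[R]_m) W :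
  Y *m W = W *m X -> mexp Y *m W = W *m mexp X.
Proof.
move=> YW; apply/subr0_eq/rownorm_eq0.
apply: le_trans (mexp_intertwine_le W (r := Num.max (rownorm X) (rownorm Y)) _ _) _.
- by rewrite le_max lexx.
- by rewrite le_max lexx orbT.
by rewrite YW subrr rownorm0 mulr0.
Qed.

Lemma mexp0 n : mexp (0 : 'M[R]_n) = 1%:M.
Proof.
apply: (@norm_cvg_unique _ _ _ _ _ _ (@cvg_mexp R n 0)).
apply: cvg_near_cst; exists 1%N => // -[|N] // _ /=.
rewrite big_ord_recl /= expr0 invr1 scale1r big1 ?addr0 // => i _.
by rewrite /bump /= expr0n scaler0.
Qed.

Lemma cauchy_triangle (T : pzRingType) (a b : nat -> T) N :
  (\sum_(i < N) a i) * (\sum_(i < N) b i) -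
  \sum_(k < N) \sum_(i < k.+1) a (k - i)%N * b i =
  \sum_(i < N) (\sum_(N - i <= j < N) a j) * b i.
Proof.
have -> : \sum_(k < N) \sum_(i < k.+1) a (k - i)%N * b i =
          \sum_(i < N) (\sum_(0 <= j < N - i) a j) * b i.
  transitivity (\sum_(k < N) \sum_(i < N | (i <= k)%N) a (k - i)%N * b i).
    apply: eq_bigr => k _.
    rewrite (big_ord_widen_cond N xpredT (fun i => a (k - i)%N * b i)) //=.
  rewrite (exchange_big_dep xpredT) //=; apply: eq_bigr => i _.
  rewrite mulr_suml -(big_mkord (fun k => (i <= k)%N) (fun k => a (k - i)%N * b i)).
  rewrite (eq_bigl (fun k => xpredT k && (i <= k)%N)) // -(big_nat_widenl _ 0) //.
  rewrite -{1}[nat_of_ord i]add0n big_addn.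
  by apply: eq_bigr => j _; rewrite addnK.
rewrite mulr_sumr -sumrB; apply: eq_bigr => i _; rewrite -mulrBl.
congr (_ * _); rewrite -(big_mkord xpredT a).
by rewrite (@big_cat_nat _ _ _ (N - i)) ?leq_subr //= addrAC subrr add0r.
Qed.

(** The difference between the product of two partial sums and a partial sum of
    their Cauchy product is a sum over a triangle of indices. For the matrices it
    is bounded by the same sum for their norms, which tends to 0 because the real
    exponential is multiplicative. *)
Lemma mexpD n (X Y : 'M[R]_n) : X *m Y = Y *m X ->
  mexp (X + Y) = mexp X *m mexp Y.
Proof.
move=> XY; apply/esym/subr0_eq/rownorm_eq0.
pose a (Z : 'M[R]_n) k := k`!%:R^-1 *: Z ^+ k : 'M[R]_n.
pose c (r : R) k := k`!%:R^-1 * r ^+ k.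
have fact_bin k i : (i < k.+1)%N ->
    (k`!%:R^-1 *+ 'C(k, i) : R) = (k - i)`!%:R^-1 * i`!%:R^-1.
  move=> ik; rewrite -(bin_fact (ltnSE ik)) !natrM !invfM -[LHS]mulr_natl !mulrA mulfV.
    by rewrite mul1r mulrC.
  by rewrite pnatr_eq0 -lt0n bin_gt0 -ltnS.
have aD k : a (X + Y) k = \sum_(i < k.+1) a X (k - i)%N *m a Y i.
  rewrite /a exprDn_comm // scaler_sumr; apply: eq_bigr => i _.
  rewrite -scalemxAl -scalemxAr scalerA -scalerMnr scalerMnl.
  by rewrite fact_bin.
have cD r s k : c (r + s) k = \sum_(i < k.+1) c r (k - i)%N * c s i.
  rewrite /c exprDn mulr_sumr; apply: eq_bigr => i _.
  by rewrite mulrnAr -mulrnAl fact_bin // mulrACA.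
pose S (Z : 'M[R]_n) N := \sum_(k < N) a Z k.
pose s (r : R) N := \sum_(k < N) c r k.
have pw (Z : 'M[R]_n) k : rownorm (a Z k) <= c (rownorm Z) k.
  rewrite rownormZ ger0_norm ?invr_ge0 // ler_wpM2l ?invr_ge0 //.
  elim: k => [|k IH]; first by rewrite !expr0; exact: rownorm1.
  by rewrite !exprS; apply: le_trans (rownormM _ _) _; rewrite ler_wpM2l.
have bound N : rownorm (S X N *m S Y N - S (X + Y) N) <=
   s (rownorm X) N * s (rownorm Y) N - s (rownorm X + rownorm Y) N.
  have e1 : S X N *m S Y N - S (X + Y) N =
      \sum_(i < N) (\sum_(N - i <= j < N) a X j) *m a Y i.
    rewrite -[RHS](cauchy_triangle (a X) (a Y) N); congr (_ - _).
    by apply: eq_bigr => k _; exact: aD.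
  have e2 : s (rownorm X) N * s (rownorm Y) N - s (rownorm X + rownorm Y) N =
      \sum_(i < N) (\sum_(N - i <= j < N) c (rownorm X) j) * c (rownorm Y) i.
    rewrite -[RHS](cauchy_triangle (c (rownorm X)) (c (rownorm Y)) N).
    by congr (_ - _); apply: eq_bigr => k _; exact: cD.
  rewrite e1 e2; apply: le_trans (rownorm_sum _ _) _; apply: ler_sum => i _.
  apply: le_trans (rownormM _ _) _; apply: ler_pM => //.
  by apply: le_trans (rownorm_sum _ _) _; apply: ler_sum => j _.
have scvg r : s r @ \oo --> expR r.
  have -> : s r = series (exp_coeff r); last exact: is_cvg_series_exp_coeff.
  apply/funext => N; rewrite /s /series /= big_mkord; apply: eq_bigr => k _.
  by rewrite /c mulrC.
have lim0 : (fun N => s (rownorm X) N * s (rownorm Y) N -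
    s (rownorm X + rownorm Y) N) @ \oo --> (0 : R).
  rewrite -(subrr (expR (rownorm X + rownorm Y))) {1}expRD.
  by apply: cvgB => //; apply: cvgM.
have limM : (fun N => S X N *m S Y N - S (X + Y) N) @ \oo -->
    mexp X *m mexp Y - mexp (X + Y).
  apply: cvgB; last exact: cvg_mexp.
  have -> : (fun N => S X N *m S Y N) =
     (fun N => (S X N - mexp X) *m S Y N + mexp X *m S Y N).
    by apply/funext => N; rewrite mulmxBl subrK.
  rewrite -[X in _ --> X]add0r; apply: cvgD; last first.
    by apply: cvg_mulmx; exact: cvg_mexp.
  apply/cvg_rownormP => e e0.
  have E0 : 0 < expR (rownorm Y) by exact: expR_gt0.
  have /cvg_rownormP/(_ (e / expR (rownorm Y))) := @cvg_mexp R n X.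
  rewrite divr_gt0 // => /(_ isT); apply: filterS => N; rewrite ler_pdivlMr // => h.
  rewrite sub0r rownormN; apply: le_trans (rownormM _ _) _; apply: le_trans h.
  rewrite rownormB; apply: ler_wpM2l => //.
  apply: le_trans (sum_exp_le N (rownorm_ge0 Y)).
  by apply: le_trans (rownorm_sum _ _) _; apply: ler_sum => k _; exact: pw.
apply/ler_addgt0Pr => e e0; rewrite add0r; apply: rownorm_lim limM _.
have /cvgr_dist_le/(_ e e0) := lim0; apply: filterS => N; rewrite sub0r normrN => h.
by apply: le_trans (bound N) _; apply: le_trans h; exact: ler_norm.
Qed.

(** On the ball of this radius, the exponential differs from 1 + X by a map of
    Lipschitz constant 1/2. *)
Definition logradius : R := ln (3 / 2).

Lemma logradius_gt0 : 0 < logradius.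
Proof. by apply: ln_gt0; lra. Qed.

Lemma expR_logradius : expR logradius - 1 = 1 / 2.
Proof. by rewrite lnK ?posrE; lra. Qed.

Lemma mexp_small m n (X : 'M[R]_n) (Y : 'M[R]_m) W :
  rownorm X <= logradius -> rownorm Y <= logradius ->
  rownorm ((mexp Y *m W - W *m mexp X) - (Y *m W - W *m X)) <=
  1 / 2 * rownorm (Y *m W - W *m X).
Proof. by move=> Xr Yr; rewrite -expR_logradius; exact: mexp_intertwine_sub. Qed.

Lemma mexp_intertwine_small m n (X : 'M[R]_n) (Y : 'M[R]_m) W :
  rownorm X <= logradius -> rownorm Y <= logradius ->
  mexp Y *m W = W *m mexp X -> Y *m W = W *m X.
Proof.
move=> Xr Yr e; apply/subr0_eq/rownorm_eq0.
have := mexp_small W Xr Yr; rewrite e subrr sub0r rownormN => h.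
by have := rownorm_ge0 (Y *m W - W *m X); lra.
Qed.

Lemma mexp_inj n (X Y : 'M[R]_n) :
  rownorm X <= logradius -> rownorm Y <= logradius -> mexp X = mexp Y -> X = Y.
Proof.
move=> Xr Yr e; rewrite -[X]mulmx1 -[Y in RHS]mul1mx.
by apply: mexp_intertwine_small; rewrite // e mulmx1 mul1mx.
Qed.

Lemma near_rownorm m n (X : 'M[R]_(m, n)) (e : R) : 0 < e ->
  \forall Y \near X, rownorm (X - Y) <= e.
Proof. by apply: (cvg_rownormP (nbhs_filter X) id X).1; exact: cvg_id. Qed.

Lemma mexp_continuous n : continuous (@mexp R n).
Proof.
move=> X; apply: (cvg_rownormP (nbhs_filter X) _ _).2 => e e0.
pose r := rownorm X + 1.
have r0 : 0 < expR r by exact: expR_gt0.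
have cX := near_rownorm X.
have c1 := cX 1 ltr01; have c2 := cX (e / expR r) (divr_gt0 e0 r0).
near=> Y.
have Yr : rownorm Y <= r.
  rewrite -(subrK X Y) addrC; apply: le_trans (rownormD _ _) _.
  by rewrite lerD2l rownormB; near: Y.
have Xr : rownorm X <= r by rewrite lerDl.
have := mexp_intertwine_le 1%:M Yr Xr; rewrite !mulmx1 !mul1mx => /le_trans; apply.
by rewrite mulrC -ler_pdivlMr //; near: Y.
Unshelve. all: by end_near. Qed.

(** The map sending X to X + g - exp X contracts by the factor 1/2 on the ball of
    radius [logradius]; its fixed point is a logarithm of g. *)
Lemma mexp_solve n (X0 g : 'M[R]_n) : rownorm X0 < logradius ->
  rownorm (g - mexp X0) <= (logradius - rownorm X0) / 4 ->
  exists X, [/\ rownorm X < logradius, mexp X = g &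
               rownorm (X - X0) <= 2 * rownorm (g - mexp X0)].
Proof.
set delta := rownorm (g - mexp X0) => X0r dle.
have d0 : 0 <= delta by exact: rownorm_ge0.
pose F (X : 'M[R]_n) := X + (g - mexp X).
pose x k := iter k F X0.
have Fc X Y : rownorm X <= logradius -> rownorm Y <= logradius ->
    rownorm (F Y - F X) <= 1 / 2 * rownorm (Y - X).
  move=> Xr Yr; have := mexp_small 1%:M Xr Yr; rewrite !mulmx1 !mul1mx.
  have -> // : F Y - F X = - ((mexp Y - mexp X) - (Y - X)).
    by rewrite /F opprD !opprB addrACA [X in _ + X]addrC subrKA.
  by rewrite rownormN.
(* The steps halve, so that all iterates stay within 2 delta of X0, inside the
   ball on which the map contracts. *)
have inv k : rownorm (x k - X0) <= 2 * delta * (1 - (1 / 2) ^+ k) /\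
    rownorm (x k.+1 - x k) <= delta * (1 / 2) ^+ k.
  have ball y : rownorm (y - X0) <= 2 * delta -> rownorm y <= logradius.
    move=> yX; rewrite -(subrK X0 y); apply: le_trans (rownormD _ _) _; lra.
  have half k' : 2 * delta * (1 - (1 / 2) ^+ k') <= 2 * delta.
    have : 0 <= delta * (1 / 2) ^+ k' by rewrite mulr_ge0 // exprn_ge0 // divr_ge0.
    by lra.
  elim: k => [|k [IH1 IH2]].
    rewrite /x /= subrr rownorm0 expr0 subrr mulr0 mulr1; split => //.
    by rewrite /F addrAC subrr add0r.
  have IH3 : rownorm (x k.+1 - X0) <= 2 * delta * (1 - (1 / 2) ^+ k.+1).
    rewrite -(subrK (x k) (x k.+1)) -addrA; apply: le_trans (rownormD _ _) _.
    by rewrite exprS; lra.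
  split => //; apply: le_trans (Fc _ _ _ _) _.
  - by apply: ball; exact: le_trans (half k).
  - by apply: ball; exact: le_trans (half k.+1).
  by rewrite exprS; lra.
have [X xX] : exists X : 'M[R]_n, x @ \oo --> X.
  pose z k := x k.+1 - x k.
  have cz : cvgn (series z).
    apply: (@summable_cvg_mx _ _ _ _ (geometric delta (1 / 2))).
      by move=> k; have [_] := inv k.
    by apply: is_cvg_geometric_series; rewrite ger0_norm; lra.
  exists (limn (series z) + X0).
  have -> : x = (fun k => series z k + X0).
    apply/funext => k; rewrite /series /z /=.
    by rewrite telescope_sumr // subrK.
  by apply: cvgD => //; exact: cvg_cst.
have XX0 : rownorm (X - X0) <= 2 * delta.
  apply: (@rownorm_lim _ _ _ (fun k => x k - X0)).
    by apply: cvgB => //; exact: cvg_cst.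
  apply: nearW => k; have [h _] := inv k; apply: le_trans h _.
  have : 0 <= delta * (1 / 2) ^+ k by rewrite mulr_ge0 // exprn_ge0 // divr_ge0.
  by lra.
have XF : F X = X.
  apply: (@norm_cvg_unique _ _ ((fun k => x k.+1) @ \oo)).
    rewrite /x /= /F; apply: cvgD; first exact: xX.
    apply: cvgB; first exact: cvg_cst.
    by apply: (cvg_comp x (@mexp R n) xX); exact: mexp_continuous.
  by have := xX; rewrite -(cvg_shiftS x).
exists X; split => //.
  rewrite -(subrK X0 X); apply: le_lt_trans (rownormD _ _) _; lra.
by move: XF; rewrite /F -[RHS]addr0 => /addrI/subr0_eq ->.
Qed.

Definition logdom n : set 'M[R]_n :=
  [set g | exists2 X, rownorm X < logradius & mexp X = g].

(** The exponential is injective on that ball, so the choice is unique. *)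
Definition mlog n (g : 'M[R]_n) : 'M[R]_n :=
  xget 0 [set X | rownorm X < logradius /\ mexp X = g].

Lemma mlogP n (g : 'M[R]_n) : logdom g ->
  rownorm (mlog g) < logradius /\ mexp (mlog g) = g.
Proof.
case=> X Xr Xg.
by apply: (@xgetPex _ 0 [set X | rownorm X < logradius /\ mexp X = g]); exists X.
Qed.

Lemma mexpK n (X : 'M[R]_n) : rownorm X < logradius -> mlog (mexp X) = X.
Proof.
move=> Xr; have [|lr le] := @mlogP _ (mexp X); first by exists X.
by apply: mexp_inj => //; exact: ltW.
Qed.

Lemma logdom1 n : logdom (1%:M : 'M[R]_n).
Proof. by exists 0; rewrite ?mexp0 // rownorm0 logradius_gt0. Qed.

Lemma open_logdom n : open (@logdom n).
Proof.
rewrite openE => _ [X0 X0r <-]; rewrite /interior.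
have := near_rownorm (mexp X0) => /(_ ((logradius - rownorm X0) / 4)).
rewrite divr_gt0 ?subr_gt0 // => /(_ isT).
apply: filterS => g; rewrite rownormB => /(mexp_solve X0r)[X [Xr Xg _]].
by exists X.
Qed.

Lemma mlog_continuous n (g : 'M[R]_n) : logdom g -> {for g, continuous (@mlog n)}.
Proof.
move=> [X0 X0r <-]; apply: (cvg_rownormP (nbhs_filter (mexp X0)) _ _).2 => e e0; rewrite mexpK //.
have cX := near_rownorm (mexp X0).
have c1 : \forall h \near mexp X0,
    rownorm (mexp X0 - h) <= (logradius - rownorm X0) / 4.
  by apply: cX; rewrite divr_gt0 ?subr_gt0.
have c2 : \forall h \near mexp X0, rownorm (mexp X0 - h) <= e / 2.
  by apply: cX; rewrite divr_gt0.
near=> h.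
have he : rownorm (mexp X0 - h) <= e / 2 by near: h.
have [|X [Xr Xh hX]] := @mexp_solve n X0 h X0r; first by rewrite rownormB; near: h.
rewrite rownormB in he; rewrite -Xh mexpK // rownormB; apply: le_trans hX _; lra.
Unshelve. all: by end_near. Qed.

Lemma mlog_intertwine m n (g : 'M[R]_n) (h : 'M[R]_m) W :
  logdom g -> logdom h -> h *m W = W *m g -> mlog h *m W = W *m mlog g.
Proof.
move=> /mlogP[gr ge] /mlogP[hr he] hW.
by apply: mexp_intertwine_small; rewrite ?(ltW gr) ?(ltW hr) // ge he.
Qed.

(** The block diagonal matrix is intertwined with X and with Y by the two
    coordinate projections. *)
Lemma mexp_block_diag m n (X : 'M[R]_m) (Y : 'M[R]_n) :
  mexp (block_mx X 0 0 Y) = block_mx (mexp X) 0 0 (mexp Y).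
Proof.
have e1 : X *m row_mx 1%:M 0 = row_mx 1%:M 0 *m block_mx X 0 0 Y.
  by rewrite mul_mx_row mul_row_block !mulmx1 !mul1mx !mulmx0 !mul0mx !addr0.
have e2 : Y *m row_mx 0 1%:M = row_mx 0 1%:M *m block_mx X 0 0 Y.
  by rewrite mul_mx_row mul_row_block !mulmx1 !mul1mx !mulmx0 !mul0mx !add0r.
have f1 := mexp_intertwine e1; have f2 := mexp_intertwine e2.
rewrite -[LHS]mul1mx [1%:M]scalar_mx_block.
rewrite /block_mx mul_col_mx -f1 -f2 !mul_mx_row.
by rewrite !mulmx1 !mulmx0.
Qed.

Lemma logdom_block_diag m n (g : 'M[R]_m) (h : 'M[R]_n) :
  logdom g -> logdom h -> logdom (block_mx g 0 0 h).
Proof.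
move=> [X Xr <-] [Y Yr <-]; exists (block_mx X 0 0 Y); last exact: mexp_block_diag.
apply: (@le_lt_trans _ _ (Num.max (rownorm X) (rownorm Y))); last by rewrite gt_max Xr.
apply/rownorm_leP => [|i]; first by rewrite le_max rownorm_ge0.
rewrite big_split_ord le_max; case: (split_ordP i) => j -> /=.
  under eq_bigr do rewrite block_mxEul.
  under [X in _ + X]eq_bigr do rewrite block_mxEur mxE normr0.
  by rewrite sumr_const mul0rn addr0 rownorm_row.
under eq_bigr do rewrite block_mxEdl mxE normr0.
under [X in _ + X]eq_bigr do rewrite block_mxEdr.
by rewrite sumr_const mul0rn add0r rownorm_row orbT.
Qed.

End MatrixLogarithm.

(** * Smoothness of the exponential, the logarithm and the inverse *)
Section NoncommutativeFunctions.
Variable R : realType.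

(** A continuous function given on square matrices of all sizes that respects
    intertwiners and block diagonals is smooth: an off-diagonal block of its
    value at the upper triangular block matrix with diagonal X + tY, X is, up to a
    scalar, the difference quotient at X in direction Y. So the derivative is a
    block of the same function in twice the size, and the order of
    differentiability can be raised step by step. *)
Lemma noncommutative_smooth (U : forall n, set 'M[R]_n)
    (f : forall n, 'M[R]_n -> 'M[R]_n) :
  (forall n, open (U n)) ->
  (forall n X, U n X -> {for X, continuous (f n)}) ->
  (forall m n X Y, U m X -> U n Y -> U (m + n)%N (block_mx X 0 0 Y)) ->
  (forall m n X Y (W : 'M[R]_(m, n)), U n X -> U m Y ->
     Y *m W = W *m X -> f m Y *m W = W *m f n X) ->
  forall n, smooth (U n) (f n).
Proof.
move=> oU fc Ub fi n m; elim: m n => [|m IH] n; first by split => // X; exact: fc.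
split => [X|Y]; first exact: fc.
pose A (e : R) (X : 'M[R]_n) : 'M[R]_(n + n) := block_mx X (e *: Y) 0 X.
have Ac e : continuous (A e).
  move=> X; have -> : A e = (fun X => block_mx X 0 0 X + block_mx 0 (e *: Y) 0 0).
    by apply/funext => Z; rewrite add_block_mx !addr0 add0r.
  have Llin : linear (fun X : 'M[R]_n => block_mx X 0 0 X : 'M[R]_(n + n)).
    by move=> a Z Z'; rewrite scale_block_mx add_block_mx !scaler0 !addr0.
  pose Li := GRing.isLinear.Build R 'M[R]_n 'M[R]_(n + n) *:%R _ Llin.
  pose L : {linear 'M[R]_n -> 'M[R]_(n + n)} := 
    HB.pack (fun X : 'M[R]_n => block_mx X 0 0 X : 'M[R]_(n + n)) Li.
  exact: (@continuousD _ _ _ L (cst (block_mx 0 (e *: Y) 0 0)) X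
    (@linear_mx_continuous _ _ _ _ L X) (@cst_continuous _ _ _ X)).
pose Lf (e : R) (F : 'M[R]_(n + n)) : 'M[R]_n :=
  (e^-1 *: row_mx 1%:M 0) *m F *m col_mx 0 1%:M.
have Llin e : linear (Lf e).
  move=> a F G; rewrite /Lf; move: (e^-1 *: _) => Z.
  by rewrite mulmxDr mulmxDl -scalemxAr -scalemxAl.
pose L e : {linear 'M[R]_(n + n) -> 'M[R]_n} :=
  HB.pack (Lf e) (GRing.isLinear.Build R 'M[R]_(n + n) 'M[R]_n *:%R _ (Llin e)).
have Lc e : continuous (L e) by exact: linear_mx_continuous.
(* The matrix in the middle is intertwined with X by P = (0, 1), and with X + tY
   by W = (1, e / t), so that its value is determined by f at X and at X + tY. *)
have quot e X t : 0 < e -> t != 0 -> U n X -> U n (t *: Y + X) ->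
    U (n + n)%N (block_mx (t *: Y + X) (e *: Y) 0 X) ->
    t^-1 *: (f n (t *: Y + X) - f n X) =
    L e (f (n + n)%N (block_mx (t *: Y + X) (e *: Y) 0 X)).
  move=> e0 t0 UX UX' UB; set F := f _ (block_mx _ _ _ _).
  pose P : 'M[R]_(n, n + n) := row_mx 0 1%:M.
  pose c := e / t.
  pose W : 'M[R]_(n, n + n) := row_mx 1%:M c%:M.
  have eP : f n X *m P = P *m F.
    apply: fi => //; rewrite mul_mx_row mul_row_block.
    by rewrite !mulmx0 !mul0mx !mulmx1 !mul1mx !add0r.
  have eW : f n (t *: Y + X) *m W = W *m F.
    apply: fi => //; rewrite mul_mx_row mul_row_block !mulmx0 !mulmx1 !mul1mx addr0.
    rewrite mul_mx_scalar mul_scalar_mx scalerDr scalerA.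
    by rewrite /c divfK.
  have r1 : row_mx 1%:M 0 = W - c *: P :> 'M[R]_(n, n + n).
    by rewrite scale_row_mx opp_row_mx add_row_mx scaler0 oppr0 addr0 scalemx1 subrr.
  rewrite /L /= /Lf r1 -!scalemxAl mulmxBl -eW -scalemxAl -eP mulmxBl -scalemxAl.
  rewrite -!mulmxA !mul_row_col !mulmx0 !mul1mx mul_scalar_mx scalemx1 !add0r.
  rewrite mul_mx_scalar mulmx1 -scalerBr scalerA /c mulrA mulVf ?mul1r //.
  by rewrite gt_eqF.
have key X0 : U n X0 -> exists2 e, 0 < e & U (n + n)%N (A e X0).
  move=> UX0; have h : \forall e \near (0 : R), U (n + n)%N (A e X0).
    have c0 : {for 0, continuous (fun e : R => A e X0)}.
      have -> : (fun e : R => A e X0) =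
          (fun e : R => block_mx X0 0 0 X0 + e *: block_mx 0 Y 0 0).
        apply/funext => e; rewrite scale_block_mx add_block_mx.
        by rewrite !scaler0 !addr0 add0r.
      by apply: cvgD; [exact: cst_continuous|exact: scalel_continuous].
    apply: c0; apply: open_nbhs_nbhs; split; first exact: oU.
    by rewrite /A scale0r; exact: Ub.
  have [e [e0 Ue]] : exists e : R, 0 < e /\ U (n + n)%N (A e X0).
    apply: (@filter_ex _ (0 : R)^'+); near=> e; split => //.
    near: e; have /nbhs_ballP[d d0 dU] := h.
    exists d => //= e; rewrite /ball_ => ed _; exact: dU.
  by exists e.
have der e X : 0 < e -> U n X -> U (n + n)%N (A e X) ->
   is_derive X Y (f n) (L e (f (n + n)%N (A e X))).
  move=> e0 UX UA.
  pose B (t : R) : 'M[R]_(n + n) := block_mx (t *: Y + X) (e *: Y) 0 X.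
  have Bc : {for 0, continuous B}.
    have -> : B = (fun t => A e X + t *: block_mx Y 0 0 0).
      apply/funext => t; rewrite /A scale_block_mx add_block_mx.
      by rewrite !scaler0 !addr0 addrC.
    by apply: cvgD; [exact: cst_continuous|exact: scalel_continuous].
  have B0 : B 0 = A e X by rewrite /B scale0r add0r.
  have nB : \forall t \near (0 : R), U (n + n)%N (B t).
    by apply: Bc; apply: open_nbhs_nbhs; rewrite B0.
  have nX : \forall t \near (0 : R), U n (t *: Y + X).
    have c0 : {for 0, continuous (fun t : R => t *: Y + X)}.
      by apply: cvgD; [exact: scalel_continuous|exact: cst_continuous].
    by apply: c0; apply: open_nbhs_nbhs; rewrite /= scale0r add0r; split => //; exact: oU.
  have cv : (fun h : R => h^-1 *: ((f n \o shift X) (h *: Y) - f n X)) @ 0^' -->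
      L e (f (n + n)%N (A e X)).
    apply: (@cvg_trans _ ((L e \o f (n + n)%N \o B) @ 0^')).
      apply: near_eq_cvg; near=> t; rewrite /= (@quot e X t) //.
      - by near: t; exact: nbhs_dnbhs_neq.
      - by near: t; exact: nbhs_dnbhs.
      - by near: t; exact: nbhs_dnbhs.
    apply: cvg_within_filter; rewrite -B0.
    have c : {for 0, continuous ((L e \o f (n + n)%N) \o B)}.
      apply: continuous_comp; first exact: Bc.
      apply: (@continuous_comp _ _ _ (f (n + n)%N) (L e)); last exact: Lc.
      by rewrite B0; exact: fc.
    exact: c.
  by split; [apply/cvg_ex; eexists; exact: cv|exact: cvg_lim].
split => [X UX|].
  by have [e e0 UA] := key X UX; have [] := der e X e0 UX UA.
apply: Ck_local => X0 UX0; have [e e0 UA0] := key X0 UX0.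
exists (U n `&` A e @^-1` U (n + n)%N) => //.
have oO : open (U n `&` A e @^-1` U (n + n)%N).
  apply: openI; first exact: oU.
  by apply: open_comp => // x _; exact: Ac.
apply: (@Ck_eq _ _ _ _ _ (L e \o (f (n + n)%N \o A e))) => //.
  by move=> X; rewrite inE => -[UX UA]; have [_ ->] := der e X e0 UX UA.
apply: Ck_post => //; apply: (@Ck_sub _ _ _ _ (A e @^-1` U (n + n)%N)).
  by move=> X [].
apply: (@Ck_pre _ _ _ _ _ _ _ (A e) (fun v => block_mx v 0 0 v)) => //.
move=> h x v; rewrite /A scale_block_mx add_block_mx.
by rewrite !scaler0 !add0r.
Unshelve. all: by end_near. Qed.

Lemma mexp_smooth n : smooth setT (@mexp R n).
Proof.
apply: (@noncommutative_smooth (fun n => setT) (@mexp R)) => //.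
- by move=> k; exact: openT.
- by move=> k X _; exact: mexp_continuous.
- by move=> *; exact: mexp_intertwine.
Qed.

Lemma mlog_smooth n : smooth (@logdom R n) (@mlog R n).
Proof.
apply: (@noncommutative_smooth (@logdom R) (@mlog R)).
- exact: open_logdom.
- exact: mlog_continuous.
- exact: logdom_block_diag.
- exact: mlog_intertwine.
Qed.

(** If v Y = 0 then v = v (X - Y) X^-1, whose norm is at most half of that of v. *)
Lemma unitmx_near n (X : 'M[R]_n) (Y : 'M[R]_n) : X \in unitmx ->
  rownorm (X - Y) * rownorm (invmx X) <= 1 / 2 ->
  Y \in unitmx /\ rownorm (invmx X - invmx Y) <=
    2 * rownorm (invmx X) * rownorm (X - Y) * rownorm (invmx X).
Proof.
move=> Xu XY; have Yu : Y \in unitmx.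
  rewrite -row_free_unit; apply: inj_row_free => v vY.
  apply: rownorm_eq0; have e : v = v *m (X - Y) *m invmx X.
    by rewrite mulmxBr vY subr0 mulmxK.
  have : rownorm v <= rownorm v * (rownorm (X - Y) * rownorm (invmx X)).
    rewrite {1}e -mulmxA; apply: le_trans (rownormM _ _) _.
    by apply: ler_wpM2l; [exact: rownorm_ge0|exact: rownormM].
  have := ler_wpM2l (rownorm_ge0 v) XY; lra.
split => //; have e : invmx X - invmx Y = invmx Y *m (Y - X) *m invmx X.
  by rewrite mulmxBr mulVmx // mulmxBl mul1mx -mulmxA mulmxV // mulmx1.
have b : rownorm (invmx X - invmx Y) <=
    rownorm (invmx Y) * (rownorm (X - Y) * rownorm (invmx X)).
  rewrite e -mulmxA [rownorm (X - Y)]rownormB; apply: le_trans (rownormM _ _) _.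
  by apply: ler_wpM2l; [exact: rownorm_ge0|exact: rownormM].
have y2 : rownorm (invmx Y) <= 2 * rownorm (invmx X).
  have : rownorm (invmx Y) <= rownorm (invmx X) + rownorm (invmx X - invmx Y).
    rewrite -{1}(subKr (invmx X) (invmx Y)); apply: le_trans (rownormD _ _) _.
    by rewrite [rownorm (- _)]rownormN.
  have := ler_wpM2l (rownorm_ge0 (invmx Y)) XY; lra.
apply: le_trans b _; rewrite -[leRHS]mulrA; apply: ler_wpM2r => //.
by rewrite mulr_ge0 // rownorm_ge0.
Qed.

Lemma near_unitmx m (X : 'M[R]_m) (e : R) : X \in unitmx -> 0 < e ->
  \forall Y \near X, Y \in unitmx /\ rownorm (invmx X - invmx Y) <= e.
Proof.
move=> Xu e0; pose a := rownorm (invmx X) + 1.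
have a0 : 0 < a by rewrite ltr_wpDl // rownorm_ge0.
have ale : rownorm (invmx X) <= a by rewrite lerDl.
have h0 : 0 < Num.min (1 / 2 / a) (e / (2 * a * a)).
  by rewrite lt_min !divr_gt0 // !mulr_gt0.
apply: filterS (near_rownorm X h0) => Y; rewrite le_min => /andP[h1 h2].
have [||Yu b] := @unitmx_near m X Y; first exact: Xu.
  move: h1; rewrite ler_pdivlMr // => h1.
  by apply: le_trans h1; apply: ler_wpM2l => //; exact: rownorm_ge0.
split => //; apply: le_trans b _; move: h2; rewrite ler_pdivlMr ?mulr_gt0 // => h2.
apply: le_trans h2; rewrite mulrC mulrA [in leRHS]mulrC.
apply: ler_wpM2r; first exact: rownorm_ge0.
rewrite mulrCA -mulrA; apply: ler_wpM2l => //.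
by apply: ler_pM => //; exact: rownorm_ge0.
Qed.

Lemma open_unitmx n : open [set X : 'M[R]_n | X \in unitmx].
Proof.
rewrite openE => X Xu; rewrite /interior.
by apply: filterS (near_unitmx Xu ltr01) => Y [].
Qed.

Lemma invmx_smooth n : smooth [set X : 'M[R]_n | X \in unitmx] (@invmx R n).
Proof.
apply: (@noncommutative_smooth (fun n => [set X : 'M[R]_n | X \in unitmx]) (@invmx R)).
- exact: open_unitmx.
- move=> m X Xu; apply: (cvg_rownormP (nbhs_filter X) _ _).2 => e e0.
  by apply: filterS (near_unitmx Xu e0) => Y [].
- move=> m p X Y; rewrite /= !unitmxE det_ublock => Xu Yu.
  by rewrite unitrM Xu Yu.
move=> m p X Y W Xu Yu YW.
by rewrite -[LHS](mulmxK Xu) -[_ *m W *m X]mulmxA -YW mulmxA mulVmx // mul1mx.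
Qed.

End NoncommutativeFunctions.

(** * Smooth maps between manifolds *)
Section SmoothMapsBetweenRowSpaces.
Variable R : realType.
Implicit Types V W : normedModType R.

Lemma open_preimage_in (T T' : topologicalType) (U : set T) (U' : set T')
    (f : T -> T') : open U -> open U' ->
  (forall x, U x -> {for x, continuous f}) -> open (U `&` f @^-1` U').
Proof.
move=> oU oU' fc; rewrite openE => x [Ux U'fx]; rewrite /interior.
apply: filterI; first exact: open_nbhs_nbhs.
by apply: (fc x Ux); exact: open_nbhs_nbhs.
Qed.

Lemma Ck_linear V W m (U : set V) (L : {linear V -> W}) :
  continuous L -> Ck m U L.
Proof.
move=> Lc; case: m => [|m]; first by split => // x _; exact: Lc.
split => [x _|v]; first exact: Lc.
have dL x : is_derive x v L (L v).
  split; first exact/diff_derivable/linear_differentiable.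
  by rewrite deriveE ?diff_lin //; exact: linear_differentiable.
split => [x _|]; first by have [] := dL x.
suff -> : 'D_v L = cst (L v) by exact: Ck_cst.
by apply/funext => x; have [] := dL x.
Qed.

Lemma smooth_continuous V W (U : set V) (f : V -> W) x :
  smooth U f -> U x -> {for x, continuous f}.
Proof. by move=> /(_ 0%N); exact: Ck_continuous. Qed.

Lemma smooth_sub V W (U U' : set V) (f : V -> W) :
  U' `<=` U -> smooth U f -> smooth U' f.
Proof. by move=> sU fs m; exact: Ck_sub (fs m). Qed.

Lemma smooth_eq V W (U : set V) (f g : V -> W) :
  open U -> (forall x, U x -> f x = g x) -> smooth U f -> smooth U g.
Proof.
by move=> oU fg fs m; apply: Ck_eq (fs m) => // x; rewrite inE; exact: fg.
Qed.

Lemma smooth_local V W (U : set V) (f : V -> W) :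
  (forall x, U x -> exists2 P : set V, P x & smooth P f) -> smooth U f.
Proof. by move=> Uf m; apply: Ck_local => x /Uf[P Px fs]; exists P. Qed.

Lemma smooth_comp V n p (U : set V) (U' : set 'rV[R]_n) (f : V -> 'rV[R]_n)
    (g : 'rV[R]_n -> 'rV[R]_p) :
  open U -> open U' -> (forall x, U x -> U' (f x)) ->
  smooth U f -> smooth U' g -> smooth U (g \o f).
Proof. by move=> oU oU' UU' fs gs m; exact: (Ck_comp oU oU'). Qed.

Lemma smooth_row_mx V n p (U : set V) (f : V -> 'rV[R]_n) (g : V -> 'rV[R]_p) :
  open U -> smooth U f -> smooth U g -> smooth U (fun x => row_mx (f x) (g x)).
Proof.
move=> oU fs gs m; apply/(Ck_mxP _ _ oU) => i j.
case: (split_ordP j) => l ->.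
  by apply: (Ck_eq oU _ ((Ck_mxP _ _ oU).1 (fs m) i l)) => x _; rewrite row_mxEl.
by apply: (Ck_eq oU _ ((Ck_mxP _ _ oU).1 (gs m) i l)) => x _; rewrite row_mxEr.
Qed.

Lemma smooth_linear_mx m n W (U : set 'M[R]_(m, n)) (L : {linear 'M[R]_(m, n) -> W}) :
  smooth U L.
Proof. by move=> l; apply: Ck_linear; exact: linear_mx_continuous. Qed.

End SmoothMapsBetweenRowSpaces.

Section PointwiseSmoothness.
Variable R : realType.

Section Atlas.
Variables (T : Type) (A : atlas R T).

Lemma chart_inj (c : chart R T) s t : charts A c -> cdom c s -> cdom c t ->
  cmap c s = cmap c t -> s = t.
Proof. by move=> /chartsP[cK _] ds dt e; rewrite -(cK _ ds) -(cK _ dt) e. Qed.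

Lemma chart_open_preimage (c : chart R T) P : charts A c -> open P ->
  chart_open (charts A) [set s | cdom c s /\ P (cmap c s)].
Proof.
move=> Ac oP c' Ac'; have [c'K _] := chartsP Ac'; have [cK _] := chartsP Ac.
have [oW sW] := charts_compatible Ac' Ac.
have -> : cmap c' @` (cdom c' `&` [set s | cdom c s /\ P (cmap c s)]) =
    cmap c' @` (cdom c' `&` cdom c) `&` (cmap c \o cinv c') @^-1` P.
  apply/seteqP; split => [_ [s [ds [ds' Ps]] <-]|_ [[s [ds ds'] <-]]].
    by split; [exists s|rewrite /= c'K].
  by rewrite /= c'K // => Ps; exists s.
by apply: open_preimage_in oW oP _ => x Wx; exact: (smooth_continuous sW Wx).
Qed.

Lemma chart_openP (S : set T) :
  (forall t, S t -> exists2 N, chart_open (charts A) N & N t /\ N `<=` S) ->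
  chart_open (charts A) S.
Proof.
move=> loc c Ac; rewrite openE => _ [t [dt St] <-]; rewrite /interior.
have [N oN [Nt NS]] := loc t St.
apply: filterS (open_nbhs_nbhs (conj (oN c Ac) _)); last by exists t.
by move=> _ [s [ds Ns] <-]; exists s => //; split => //; exact: NS.
Qed.

Lemma chart_open_dom (c : chart R T) : charts A c -> chart_open (charts A) (cdom c).
Proof.
move=> Ac; have := chart_open_preimage Ac openT; congr chart_open.
by apply/seteqP; split => [s []|s].
Qed.

End Atlas.

Definition smooth_in_charts (T T' : Type) (c : chart R T) (c' : chart R T')
    (f : T -> T') (t : T) : Prop :=
  [/\ cdom c t, cdom c' (f t) & exists P : set 'rV[R]_(cdim c),
   [/\ open P, P (cmap c t),
       P `<=` cmap c @` (cdom c `&` f @^-1` cdom c') &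
       smooth P (cmap c' \o f \o cinv c)]].

(** One pair of charts is enough for smoothness at a point, so that composition
    and localization are easy; [smooth_at_on] recovers smoothness on a set, which
    quantifies over all pairs of charts. *)
Definition smooth_at (T T' : Type) (A : atlas R T) (A' : atlas R T')
    (f : T -> T') (t : T) : Prop :=
  exists c c', [/\ charts A c, charts A' c' & smooth_in_charts c c' f t].

(** As transition maps are smooth, one pair of charts can be traded for another. *)
Lemma smooth_at_charts (T T' : Type) (A : atlas R T) (A' : atlas R T')
    (f : T -> T') (t : T) c c' :
  smooth_at A A' f t -> charts A c -> charts A' c' -> cdom c t -> cdom c' (f t) ->
  smooth_in_charts c c' f t.
Proof.
move=> [c0 [c0' [Ac0 Ac0' [d0 d0' [P [oP Pt Pim Ps]]]]]] Ac Ac' dt dt'.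
have [cK _] := chartsP Ac; have [c0K _] := chartsP Ac0.
have [c'K _] := chartsP Ac'; have [c0'K _] := chartsP Ac0'.
have [oW1 sW1] := charts_compatible Ac Ac0.
have [oW2 sW2] := charts_compatible Ac0' Ac'.
set W1 := _ @` _ in oW1 sW1; set W2 := _ @` _ in oW2 sW2.
pose F := cmap c0' \o f \o cinv c0.
pose P2 := P `&` F @^-1` W2.
have oP2 : open P2.
  by apply: open_preimage_in oP oW2 _ => x Px; exact: (smooth_continuous Ps Px).
pose P3 := W1 `&` (cmap c0 \o cinv c) @^-1` P2.
have oP3 : open P3.
  by apply: open_preimage_in oW1 oP2 _ => x Wx; exact: (smooth_continuous sW1 Wx).
have P3P w : P3 w -> exists s, [/\ w = cmap c s, cdom c s, cdom c0 s,
    cdom c0' (f s) & cdom c' (f s)].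
  move=> [[s [ds ds0] <-]]; rewrite /= cK // => -[Ps0].
  have [s' [ds' fs'] es'] := Pim _ Ps0.
  have es := chart_inj Ac0 ds' ds0 es'; rewrite {}es in fs'.
  rewrite /F /= c0K // => -[r [dr dr'] er].
  have er' := chart_inj Ac0' dr fs' er; rewrite {}er' in dr dr'.
  by exists s.
split => //; exists P3; split => //.
- split; first by exists t.
  rewrite /= cK //; split => //; rewrite /F /= c0K //.
  by exists (f t).
- by move=> w /P3P[s [-> ds ds0 fs0 fs]]; exists s.
apply: (@smooth_eq _ _ _ _ ((cmap c' \o cinv c0') \o (F \o (cmap c0 \o cinv c)))) => //.
  move=> w /P3P[s [-> ds ds0 fs0 fs]].
  by rewrite /F /= cK // c0K // c0'K.
apply: (@smooth_comp _ _ _ _ P3 W2) => //.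
  by move=> w [_ []].
apply: (@smooth_comp _ _ _ _ P3 P) => //.
  by move=> w [_ []].
by apply: smooth_sub sW1 => w [].
Qed.

Section SmoothAt.
Variables (T T' : Type) (A : atlas R T) (A' : atlas R T').
Implicit Types (f g : T -> T') (t : T).

Lemma smooth_on_open S f : smooth_on (charts A) (charts A') S f ->
  chart_open (charts A) S.
Proof.
move=> fs; apply: chart_openP => t St.
have [c Ac dt] := charts_cover A t; have [c' Ac' dt'] := charts_cover A' (f t).
have [oW _] := fs c c' Ac Ac'.
have [cK _] := chartsP Ac.
eexists; first exact: (chart_open_preimage Ac oW).
split; first by split => //; exists t.
move=> s [ds [r [[dr Sr] _] er]].
by have <- := chart_inj Ac dr ds er.
Qed.

Lemma smooth_on_at S f t : smooth_on (charts A) (charts A') S f -> S t ->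
  smooth_at A A' f t.
Proof.
move=> fs St.
have [c Ac dt] := charts_cover A t; have [c' Ac' dt'] := charts_cover A' (f t).
have [oW sW] := fs c c' Ac Ac'.
exists c, c'; split => //; split => //; eexists; split; [exact: oW| | |exact: sW].
  by exists t.
by move=> _ [s [[ds Ss] ds'] <-]; exists s.
Qed.

Lemma smooth_at_on S f : chart_open (charts A) S ->
  (forall t, S t -> smooth_at A A' f t) -> smooth_on (charts A) (charts A') S f.
Proof.
move=> oS fs c c' Ac Ac' W.
have loc w : W w -> exists P, [/\ open P, P w, P `<=` W & smooth P (cmap c' \o f \o cinv c)].
  move=> [t [[dt St] dt'] <-].
  have [_ _ [P [oP Pt Pim Ps]]] := smooth_at_charts (fs t St) Ac Ac' dt dt'.
  exists (P `&` (cmap c @` (cdom c `&` S))); split.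
  - by apply: openI => //; exact: oS.
  - by split => //; exists t.
  - move=> y [Py [s [ds Ss] es]]; have [r [dr fr] er] := Pim y Py.
    rewrite -es in er; have e := chart_inj Ac dr ds er; rewrite e in fr.
    by exists s.
  by apply: smooth_sub Ps => y [].
split.
  rewrite openE => w /loc[P [oP Pw PW _]].
  by apply: filterS PW _; exact: open_nbhs_nbhs.
by apply: smooth_local => w /loc[P [oP Pw PW Ps]]; exists P.
Qed.

Lemma smooth_at_continuous f t (W : set T') : smooth_at A A' f t ->
  chart_open (charts A') W -> W (f t) ->
  exists2 N, chart_open (charts A) N & N t /\ forall s, N s -> W (f s).
Proof.
move=> [c [c' [Ac Ac' [dt dt' [P [oP Pt Pim Ps]]]]]] oW Wt.
have [cK _] := chartsP Ac; have [c'K _] := chartsP Ac'.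
pose P2 := P `&` (cmap c' \o f \o cinv c) @^-1` (cmap c' @` (cdom c' `&` W)).
have oP2 : open P2.
  apply: open_preimage_in oP _ _; first exact: oW.
  by move=> x Px; exact: (smooth_continuous Ps Px).
exists [set s | cdom c s /\ P2 (cmap c s)]; first exact: chart_open_preimage.
split; first by split => //; split => //=; exists (f t); rewrite ?cK.
move=> s [ds [Pcs]]; rewrite /= cK // => -[r [dr Wr] er].
have [r' [dr' fr'] er'] := Pim _ Pcs.
have e := chart_inj Ac dr' ds er'; rewrite e in fr'.
by have <- := chart_inj Ac' dr fr' er.
Qed.

Lemma smooth_at_eq f g t N : chart_open (charts A) N -> N t ->
  (forall s, N s -> f s = g s) -> smooth_at A A' f t -> smooth_at A A' g t.
Proof.
move=> oN Nt fg [c [c' [Ac Ac' [dt dt' [P [oP Pt Pim Ps]]]]]].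
have [cK _] := chartsP Ac.
exists c, c'; split => //; split => //; first by rewrite -fg.
exists (P `&` (cmap c @` (cdom c `&` N))); split.
- by apply: openI => //; exact: oN.
- by split => //; exists t.
- move=> w [Pw [s [ds Ns] es]]; have [r [dr fr] er] := Pim w Pw.
  rewrite -es in er; have e := chart_inj Ac dr ds er; rewrite e in fr.
  by exists s => //; split => //; rewrite /preimage /= -fg.
apply: (@smooth_eq _ _ _ _ (cmap c' \o f \o cinv c)).
- by apply: openI => //; exact: oN.
- by move=> w [_ [s [ds Ns] <-]]; rewrite /= cK // fg.
by apply: smooth_sub Ps => w [].
Qed.

Lemma smooth_at_cst t (a : T') : smooth_at A A' (cst a) t.
Proof.
have [c Ac dt] := charts_cover A t; have [c' Ac' da] := charts_cover A' a.
have [cK oc] := chartsP Ac.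
exists c, c'; split => //; split => //; exists (cmap c @` cdom c); split => //.
  by move=> _ [s ds <-]; exists s.
by move=> m; exact: (@Ck_cst R 'rV[R]_(cdim c) 'rV[R]_(cdim c') m _ (cmap c' a)).
Qed.

Lemma chart_open_smooth_preimage S f (W : set T') : chart_open (charts A) S ->
  (forall t, S t -> smooth_at A A' f t) -> chart_open (charts A') W ->
  chart_open (charts A) (S `&` f @^-1` W).
Proof.
move=> oS fs oW; apply: chart_openP => t [St Wt].
have [N oN [Nt NW]] := smooth_at_continuous (fs t St) oW Wt.
exists (N `&` S); first exact: chart_openI.
by split => // s [Ns Ss]; split => //; exact: NW.
Qed.

End SmoothAt.

Lemma smooth_at_id (T : Type) (A : atlas R T) t : smooth_at A A id t.
Proof.
have [c Ac dt] := charts_cover A t; have [cK oc] := chartsP Ac.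
exists c, c; split => //; split => //; exists (cmap c @` cdom c); split => //.
  by move=> _ [s ds <-]; exists s.
apply: (@smooth_eq _ _ _ _ idfun) => //; last exact: smooth_linear_mx.
by move=> _ [s ds <-]; rewrite /= cK.
Qed.

Lemma smooth_at_comp (T T' T'' : Type) (A : atlas R T) (A' : atlas R T')
    (A'' : atlas R T'') (f : T -> T') (g : T' -> T'') t :
  smooth_at A A' f t -> smooth_at A' A'' g (f t) -> smooth_at A A'' (g \o f) t.
Proof.
move=> [c [c' [Ac Ac' [dt dt' [P [oP Pt Pim Ps]]]]]] gs.
have [c'' Ac'' dt''] := charts_cover A'' (g (f t)).
have [_ _ [Q [oQ Qt Qim Qs]]] := smooth_at_charts gs Ac' Ac'' dt' dt''.
have [cK _] := chartsP Ac; have [c'K _] := chartsP Ac'.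
exists c, c''; split => //; split => //.
pose F := cmap c' \o f \o cinv c.
have oPQ : open (P `&` F @^-1` Q).
  by apply: open_preimage_in oP oQ _ => x Px; exact: (smooth_continuous Ps Px).
exists (P `&` F @^-1` Q); split => //.
- by split => //; rewrite /F /= cK.
- move=> w [Pw]; have [s [ds fs] es] := Pim w Pw.
  rewrite /F /= -es cK // => /Qim[r [dr gr] er].
  have e := chart_inj Ac' dr fs er; rewrite e in gr.
  by exists s.
apply: (@smooth_eq _ _ _ _ ((cmap c'' \o g \o cinv c') \o F)) => //.
  move=> w [Pw _]; have [s [ds fs] es] := Pim w Pw.
  by rewrite /F /= -es cK // c'K.
apply: (@smooth_comp _ _ _ _ _ Q) => //; first by move=> w [].
by apply: smooth_sub Ps => w [].
Qed.

End PointwiseSmoothness.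

Section ProductAtlas.
Variable R : realType.
Variables (T1 T2 : Type) (A1 : atlas R T1) (A2 : atlas R T2).

Lemma prod_chart_open (c1 : chart R T1) (c2 : chart R T2) (S1 : set T1) (S2 : set T2) :
  open (cmap c1 @` S1) -> open (cmap c2 @` S2) ->
  open (cmap (prod_chart c1 c2) @` (S1 `*` S2)).
Proof.
move=> o1 o2.
have -> : cmap (prod_chart c1 c2) @` (S1 `*` S2) =
   (lsubmx @^-1` (cmap c1 @` S1)) `&` (rsubmx @^-1` (cmap c2 @` S2)).
  apply/seteqP; split => [_ [[s1 s2] [/= d1 d2] <-]|w [[s1 d1 e1] [s2 d2 e2]]].
    by split; rewrite /= ?row_mxKl ?row_mxKr; [exists s1|exists s2].
  by exists (s1, s2) => //=; rewrite e1 e2 hsubmxK.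
by apply: openI; apply: open_comp => // x _; exact: linear_mx_continuous.
Qed.

Lemma prod_chartsP (c : chart R (T1 * T2)) :
  prod_charts (charts A1) (charts A2) c -> is_chart c.
Proof.
move=> [c1 [c2 [Ac1 Ac2 ->]]].
have [c1K o1] := chartsP Ac1; have [c2K o2] := chartsP Ac2; split.
  by move=> [t1 t2] [/= d1 d2]; rewrite row_mxKl row_mxKr c1K ?c2K.
exact: prod_chart_open.
Qed.

Lemma prod_charts_compatible (c c' : chart R (T1 * T2)) :
  prod_charts (charts A1) (charts A2) c ->
  prod_charts (charts A1) (charts A2) c' -> compatible c c'.
Proof.
move=> [c1 [c2 [Ac1 Ac2 ->]]] [c1' [c2' [Ac1' Ac2' ->]]].
have [oW1 s1] := charts_compatible Ac1 Ac1'; have [oW2 s2] := charts_compatible Ac2 Ac2'.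
have e : cdom (prod_chart c1 c2) `&` cdom (prod_chart c1' c2') =
   (cdom c1 `&` cdom c1') `*` (cdom c2 `&` cdom c2').
  by apply/seteqP; split => [[a b] [[/= ? ?] [/= ? ?]]|[a b] [[/= ? ?] [/= ? ?]]].
rewrite /compatible e; have oW := prod_chart_open oW1 oW2; split => //.
apply: smooth_row_mx => //.
  apply: (@smooth_comp _ _ _ _ _ (cmap c1 @` (cdom c1 `&` cdom c1')) (@lsubmx R 1 _ _)
     (cmap c1' \o cinv c1)) => //; last exact: smooth_linear_mx.
  by move=> _ [[a b] [/= da db] <-]; rewrite row_mxKl; exists a.
apply: (@smooth_comp _ _ _ _ _ (cmap c2 @` (cdom c2 `&` cdom c2')) (@rsubmx R 1 _ _)
   (cmap c2' \o cinv c2)) => //; last exact: smooth_linear_mx.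
by move=> _ [[a b] [/= da db] <-]; rewrite row_mxKr; exists b.
Qed.

Lemma prod_charts_cover t :
  exists2 c, prod_charts (charts A1) (charts A2) c & cdom c t.
Proof.
case: t => t1 t2.
have [c1 Ac1 d1] := charts_cover A1 t1; have [c2 Ac2 d2] := charts_cover A2 t2.
by exists (prod_chart c1 c2) => //; exists c1, c2.
Qed.

Definition prod_atlas : atlas R (T1 * T2) :=
  Atlas prod_charts_cover prod_chartsP prod_charts_compatible.

Lemma smooth_at_fst t : smooth_at prod_atlas A1 fst t.
Proof.
case: t => t1 t2.
have [c1 Ac1 d1] := charts_cover A1 t1; have [c2 Ac2 d2] := charts_cover A2 t2.
have Ac : charts prod_atlas (prod_chart c1 c2) by exists c1, c2.
have [cK oc] := chartsP Ac; have [c1K _] := chartsP Ac1.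
exists (prod_chart c1 c2), c1; split => //; split => //; eexists; split; first exact: oc.
- by exists (t1, t2).
- by move=> _ [[s1 s2] [/= e1 e2] <-]; exists (s1, s2).
apply: (@smooth_eq _ _ _ _ (@lsubmx R 1 _ _)) => //; last exact: smooth_linear_mx.
by move=> _ [[s1 s2] [/= e1 e2] <-]; rewrite /= row_mxKl c1K.
Qed.

Lemma smooth_at_snd t : smooth_at prod_atlas A2 snd t.
Proof.
case: t => t1 t2.
have [c1 Ac1 d1] := charts_cover A1 t1; have [c2 Ac2 d2] := charts_cover A2 t2.
have Ac : charts prod_atlas (prod_chart c1 c2) by exists c1, c2.
have [cK oc] := chartsP Ac; have [c2K _] := chartsP Ac2.
exists (prod_chart c1 c2), c2; split => //; split => //; eexists; split; first exact: oc.
- by exists (t1, t2).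
- by move=> _ [[s1 s2] [/= e1 e2] <-]; exists (s1, s2).
apply: (@smooth_eq _ _ _ _ (@rsubmx R 1 _ _)) => //; last exact: smooth_linear_mx.
by move=> _ [[s1 s2] [/= e1 e2] <-]; rewrite /= row_mxKr c2K.
Qed.

Lemma smooth_at_pair (T : Type) (A : atlas R T) (f : T -> T1) (g : T -> T2) t :
  smooth_at A A1 f t -> smooth_at A A2 g t ->
  smooth_at A prod_atlas (fun s => (f s, g s)) t.
Proof.
move=> [c [c1 [Ac Ac1 [dt dt1 [P [oP Pt Pim Ps]]]]]] gs.
have [c2 Ac2 dt2] := charts_cover A2 (g t).
have [_ _ [Q [oQ Qt Qim Qs]]] := smooth_at_charts gs Ac Ac2 dt dt2.
have Ac12 : charts prod_atlas (prod_chart c1 c2) by exists c1, c2.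
exists c, (prod_chart c1 c2); split => //; split => //.
have oPQ : open (P `&` Q) by exact: openI.
exists (P `&` Q); split => //.
  move=> w [Pw Qw]; have [s [ds fs] es] := Pim w Pw; have [r [dr gr] er] := Qim w Qw.
  rewrite -es in er; have e := chart_inj Ac dr ds er; rewrite e in gr.
  by exists s.
apply: smooth_row_mx => //; first by apply: smooth_sub Ps => w [].
by apply: smooth_sub Qs => w [].
Qed.

End ProductAtlas.

(** * Real coordinates on real and complex vector spaces *)
Section RealCoordinates.
Variables (R : realType) (s : scalar_kind).
Notation k := (scalars R s).
Implicit Types V W Z : vectType k.

Definition real_scalar : R -> scalars R s :=
  match s with RealScalars => id | ComplexScalars => fun r => (r%:C)%C end.

Lemma to_realD d (z w : 'rV[k]_d) : to_real (z + w) = to_real z + to_real w.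
Proof.
rewrite /to_real; case: s z w => // z w; rewrite add_row_mx.
by congr row_mx; apply/rowP => j; rewrite !mxE; case: (z 0 j) (w 0 j) => [? ?] [? ?].
Qed.

Lemma to_realZ d r (z : 'rV[k]_d) : to_real (real_scalar r *: z) = r *: to_real z.
Proof.
rewrite /to_real /real_scalar; case: s z => // z; rewrite scale_row_mx.
congr row_mx; apply/rowP => j; rewrite !mxE; case: (z 0 j) => [x y] /=.
  by rewrite mul0r subr0.
by rewrite mul0r addr0.
Qed.

Definition vdim V : nat := cdim (vect_chart (s := s) V).
Definition vcrd V : V -> 'rV[R]_(vdim V) := cmap (vect_chart (s := s) V).
Definition vinv V : 'rV[R]_(vdim V) -> V := cinv (vect_chart (s := s) V).
Arguments vcrd : simpl never.
Arguments vinv : simpl never.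
Arguments vdim : simpl never.

Lemma vcrdK V : cancel (@vcrd V) (@vinv V).
Proof. exact: vect_chartK. Qed.

Lemma vinvK V : cancel (@vinv V) (@vcrd V).
Proof. exact: vect_chartVK. Qed.

Lemma vcrdP V r (v w : V) :
  @vcrd V (real_scalar r *: v + w) = r *: @vcrd V v + @vcrd V w.
Proof.
rewrite /vcrd /= -to_realZ -to_realD; congr to_real; apply/rowP => i.
by rewrite !mxE linearP.
Qed.

Lemma real_scalar1 : real_scalar 1 = 1.
Proof. by rewrite /real_scalar; case: s. Qed.

Lemma vcrdD V (v w : V) : vcrd (v + w) = vcrd v + vcrd w.
Proof. by rewrite -[v in LHS]scale1r -real_scalar1 vcrdP scale1r. Qed.

Lemma vcrd0 V : @vcrd V 0 = 0.
Proof. by have := vcrdD (0 : V) 0; rewrite addr0 -[X in X = _]addr0 => /addrI/esym. Qed.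

Lemma vinvP V r (x y : 'rV[R]_(vdim V)) :
  @vinv V (r *: x + y) = real_scalar r *: @vinv V x + @vinv V y.
Proof.
apply: (can_inj (@vcrdK V)).
by rewrite vcrdP !vinvK.
Qed.

(** Calculus takes place over R in both cases, so all that it uses of a linear map
    is that it is real linear. *)
Definition rlinear V W (f : V -> W) : Prop :=
  forall r v w, f (real_scalar r *: v + w) = real_scalar r *: f v + f w.

Lemma linear_rlinear V W (f : V -> W) : linear f -> rlinear f.
Proof. by move=> fl r v w; exact: fl. Qed.

Lemma hom_rlinear V W (f : 'Hom(V, W)) : rlinear f.
Proof. by move=> r v w; rewrite linearP. Qed.

Lemma rlinear_crd V W (f : V -> W) : rlinear f ->
  linear (@vcrd W \o f \o @vinv V : 'rV[R]_(vdim V) -> 'rV[R]_(vdim W)).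
Proof. by move=> fl r x y; rewrite /comp vinvP fl vcrdP. Qed.

Definition rlinear_crd_pack V W (f : V -> W) (fl : rlinear f) :
    {linear 'rV[R]_(vdim V) -> 'rV[R]_(vdim W)} :=
  HB.pack (@vcrd W \o f \o @vinv V : 'rV[R]_(vdim V) -> 'rV[R]_(vdim W))
    (GRing.isLinear.Build R 'rV[R]_(vdim V) 'rV[R]_(vdim W) *:%R _ (rlinear_crd fl)).

Definition rmx V W (f : V -> W) : 'M[R]_(vdim V, vdim W) :=
  lin1_mx (@vcrd W \o f \o @vinv V).

Lemma rmxE V W (f : V -> W) v : rlinear f -> @vcrd W (f v) = @vcrd V v *m rmx f.
Proof.
move=> fl; rewrite /rmx -[_ \o f \o _]/(rlinear_crd_pack fl : _ -> _) mul_rV_lin1.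
by rewrite -[RHS]/(@vcrd W (f (@vinv V (@vcrd V v)))) vcrdK.
Qed.

Lemma rV_mx_eq m n (A B : 'M[R]_(m, n)) : (forall u : 'rV_m, u *m A = u *m B) -> A = B.
Proof. by move=> AB; apply/row_matrixP => i; rewrite !rowE AB. Qed.

Lemma rmx_comp V W Z (f : V -> W) (g : W -> Z) : rlinear f -> rlinear g ->
  rmx (g \o f) = rmx f *m rmx g.
Proof.
move=> fl gl; apply: rV_mx_eq => u; rewrite -(@vinvK V u) mulmxA.
rewrite -rmxE; last by move=> r v w; rewrite /= fl gl.
by rewrite /= (rmxE _ gl) (rmxE _ fl).
Qed.

Lemma rmxP V W r (f g : 'Hom(V, W)) :
  rmx (real_scalar r *: f + g) = r *: rmx f + rmx g.
Proof.
apply: rV_mx_eq => u; rewrite -(@vinvK V u) -(rmxE _ (hom_rlinear _)).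
rewrite add_lfunE scale_lfunE vcrdP !(rmxE _ (hom_rlinear _)).
by rewrite mulmxDr scalemxAr.
Qed.

Lemma rmxD V W (f g : 'Hom(V, W)) : rmx (f + g) = rmx f + rmx g.
Proof.
by rewrite -[f in LHS]scale1r -real_scalar1 rmxP scale1r.
Qed.

Lemma rmx1 V : rmx (\1%VF : 'End(V)) = 1%:M.
Proof.
apply: rV_mx_eq => u; rewrite -(@vinvK V u).
by rewrite -(rmxE _ (hom_rlinear _)) id_lfunE mulmx1.
Qed.

Lemma rmx0 V W : rmx (0 : 'Hom(V, W)) = 0.
Proof. by have := @rmxD V W 0 0; rewrite addr0 -[X in X = _]addr0 => /addrI/esym. Qed.

Lemma rmx_comp_lfun V W Z (f : 'Hom(V, W)) (g : 'Hom(W, Z)) :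
  rmx (g \o f)%VF = rmx f *m rmx g.
Proof.
rewrite -rmx_comp; try exact: hom_rlinear.
by congr rmx; apply/funext => v; rewrite /= comp_lfunE.
Qed.

Lemma rank1_subproof V W (i : 'I_(\dim {:V})) (w : W) :
  linear (fun v : V => coord (vbasis {:V}) i v *: w).
Proof. by move=> a v v'; rewrite linearP scalerDl scalerA. Qed.

Definition rank1 V W (i : 'I_(\dim {:V})) (w : W) : 'Hom(V, W) :=
  mklfun (rank1_subproof i w).

Lemma rank1E V W (i : 'I_(\dim {:V})) (w : W) v :
  rank1 i w v = coord (vbasis {:V}) i v *: w.
Proof. exact: mklfunE. Qed.

Lemma rank1_linear V W (i : 'I_(\dim {:V})) : linear (@rank1 V W i).
Proof.
move=> a w w'; apply/lfunP => v; rewrite add_lfunE scale_lfunE !rank1E.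
by rewrite scalerDr !scalerA mulrC.
Qed.

Lemma hom_rank1 V W (f : 'Hom(V, W)) :
  f = \sum_i rank1 i (f (vbasis {:V})`_i).
Proof.
apply/lfunP => v; rewrite {1}(coord_vbasis (memvf v)) linear_sum sum_lfunE.
by apply: eq_bigr => i _; rewrite linearZ rank1E.
Qed.

(** The linear map with the values of Y on a basis; it has matrix Y as soon as Y
    commutes with the scalars, and is real linear in all Y. *)
Definition mxhom V W (Y : 'M[R]_(vdim V, vdim W)) : 'Hom(V, W) :=
  \sum_i rank1 i (@vinv W (@vcrd V (vbasis {:V})`_i *m Y)).

Lemma mxhomP V W r (X Y : 'M[R]_(vdim V, vdim W)) :
  mxhom (r *: X + Y) = real_scalar r *: mxhom X + mxhom Y.
Proof.
rewrite /mxhom scaler_sumr -big_split /=; apply: eq_bigr => i _.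
by rewrite -rank1_linear -vinvP mulmxDr scalemxAr.
Qed.

Lemma rmxK V W (f : 'Hom(V, W)) : mxhom (rmx f) = f.
Proof.
rewrite [RHS]hom_rank1; apply: eq_bigr => i _; congr rank1.
by rewrite -(rmxE _ (hom_rlinear _)) vcrdK.
Qed.

Definition scalar_mx_of V (c : k) : 'M[R]_(vdim V) := rmx (fun v : V => c *: v).

Lemma scale_rlinear V (c : k) : rlinear (fun v : V => c *: v).
Proof. by move=> r v w; rewrite scalerDr !scalerA mulrC. Qed.

Lemma vcrd_sum V (I : Type) (r : seq I) (F : I -> V) :
  @vcrd V (\sum_(i <- r) F i) = \sum_(i <- r) @vcrd V (F i).
Proof.
by elim: r => [|i r IH]; rewrite ?big_nil ?vcrd0 // !big_cons vcrdD IH.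
Qed.

Lemma mxhomK V W (Y : 'M[R]_(vdim V, vdim W)) :
  (forall c, scalar_mx_of V c *m Y = Y *m scalar_mx_of W c) -> rmx (mxhom Y) = Y.
Proof.
move=> Yc; apply: rV_mx_eq => u; rewrite -(@vinvK V u).
move: (@vinv V u) => v; rewrite -(rmxE _ (hom_rlinear _)).
rewrite sum_lfunE {2}(coord_vbasis (memvf v)) !vcrd_sum mulmx_suml.
apply: eq_bigr => i _; rewrite rank1E.
rewrite [LHS](rmxE _ (scale_rlinear _)) [in RHS](rmxE _ (scale_rlinear _)).
by rewrite vinvK -!mulmxA Yc.
Qed.

Lemma rmx_scalar V W (f : 'Hom(V, W)) c :
  scalar_mx_of V c *m rmx f = rmx f *m scalar_mx_of W c.
Proof.
rewrite -!rmx_comp; try exact: hom_rlinear; try exact: scale_rlinear.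
by congr rmx; apply/funext => v; rewrite /= linearZ.
Qed.

(** * Exponential and logarithm of endomorphisms *)

(** The real matrix of a linear map commutes with those of the scalars, and so do
    its exponential and logarithm: they are matrices of linear maps over k. *)
Definition Exp V (X : 'End(V)) : 'End(V) := mxhom (mexp (rmx X)).

Definition Log V (g : 'End(V)) : 'End(V) := mxhom (mlog (rmx g)).

Definition Small V : set 'End(V) := [set X | rownorm (rmx X) < logradius R].

Definition Logdom V : set 'End(V) := [set g | logdom (rmx g)].

Lemma rmx_Exp V (X : 'End(V)) : rmx (Exp X) = mexp (rmx X).
Proof.
by apply: mxhomK => c; apply/esym/mexp_intertwine; rewrite rmx_scalar.
Qed.

Lemma rmx_Log V (g : 'End(V)) : Logdom g -> rmx (Log g) = mlog (rmx g).
Proof.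
move=> gU; apply: mxhomK => c; apply/esym/mlog_intertwine => //.
by rewrite rmx_scalar.
Qed.

Lemma rmx_inj V W : injective (fun f : 'Hom(V, W) => rmx f).
Proof. exact: can_inj (@rmxK V W). Qed.

Lemma Exp_Log V (g : 'End(V)) : Logdom g -> Exp (Log g) = g.
Proof.
by move=> gU; apply: rmx_inj; rewrite rmx_Exp rmx_Log //; case: (mlogP gU).
Qed.

Lemma Small_Log V (g : 'End(V)) : Logdom g -> Small (Log g).
Proof. by move=> gU; rewrite /Small /= rmx_Log //; case: (mlogP gU). Qed.

Lemma Log_Exp V (X : 'End(V)) : Small X -> Log (Exp X) = X.
Proof. by move=> Xs; rewrite /Log rmx_Exp mexpK // rmxK. Qed.

Lemma Logdom1 V : Logdom (\1%VF : 'End(V)).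
Proof. by rewrite /Logdom /= rmx1; exact: logdom1. Qed.

Lemma Exp0 V : Exp (0 : 'End(V)) = \1%VF.
Proof. by apply: rmx_inj; rewrite rmx_Exp rmx0 mexp0 rmx1. Qed.

Lemma Log1 V : Log (\1%VF : 'End(V)) = 0.
Proof.
rewrite -Exp0 Log_Exp // /Small /= rmx0 rownorm0; exact: logradius_gt0.
Qed.

Lemma Exp_intertwine V W (f : 'Hom(V, W)) X Y :
  (f \o X)%VF = (Y \o f)%VF -> (f \o Exp X)%VF = (Exp Y \o f)%VF.
Proof.
move=> fX; apply: rmx_inj; rewrite !rmx_comp_lfun !rmx_Exp.
by apply: mexp_intertwine; rewrite -!rmx_comp_lfun fX.
Qed.

Lemma Small_intertwine V W (f : 'Hom(V, W)) X Y : Small X -> Small Y ->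
  (f \o Exp X)%VF = (Exp Y \o f)%VF -> (f \o X)%VF = (Y \o f)%VF.
Proof.
move=> Xs Ys fX; apply: rmx_inj; rewrite !rmx_comp_lfun.
apply: mexp_intertwine_small; [exact: ltW|exact: ltW|].
by rewrite -!rmx_Exp -!rmx_comp_lfun fX.
Qed.

Lemma Exp_comm V (X Y : 'End(V)) : (X \o Y)%VF = (Y \o X)%VF ->
  Exp (X + Y) = (Exp X \o Exp Y)%VF.
Proof.
move=> XY; have e : rmx Y *m rmx X = rmx X *m rmx Y by rewrite -!rmx_comp_lfun XY.
rewrite [X + Y]addrC; apply: rmx_inj.
rewrite [RHS]rmx_comp_lfun [X in _ = X *m _]rmx_Exp [X in _ = _ *m X]rmx_Exp.
by rewrite [LHS]rmx_Exp (rmxD Y X) (mexpD e).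
Qed.

Lemma ExpNr V (X : 'End(V)) : (Exp X \o Exp (- X))%VF = \1%VF.
Proof.
rewrite -Exp_comm ?subrr ?Exp0 //.
by apply/lfunP => v; rewrite !comp_lfunE !opp_lfunE linearN.
Qed.

Lemma ExpNl V (X : 'End(V)) : (Exp (- X) \o Exp X)%VF = \1%VF.
Proof. by have := ExpNr (- X); rewrite opprK. Qed.

(** * Vector spaces as manifolds *)

Lemma vect_charts_cover V (v : V) :
  exists2 c, [set vect_chart (s := s) V] c & cdom c v.
Proof. by exists (vect_chart V). Qed.

Lemma vect_chart_imT V : @vcrd V @` setT = setT.
Proof.
apply/seteqP; split => // w _; exists (@vinv V w) => //.
exact: vinvK.
Qed.

Lemma vect_chartsP V c : [set vect_chart (s := s) V] c -> is_chart c.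
Proof.
move=> ->; split; first by move=> v _; exact: vcrdK.
by rewrite vect_chart_imT; exact: openT.
Qed.

Lemma vect_charts_compatible V c c' : [set vect_chart (s := s) V] c ->
  [set vect_chart (s := s) V] c' -> compatible c c'.
Proof.
move=> -> ->; rewrite /compatible setIT vect_chart_imT; split; first exact: openT.
apply: (@smooth_eq _ _ _ _ idfun); first exact: openT.
  by move=> x _; exact: (esym (@vinvK V x)).
exact: smooth_linear_mx.
Qed.

Definition vect_atlas V : atlas R V :=
  Atlas (@vect_charts_cover V) (@vect_chartsP V) (@vect_charts_compatible V).

Lemma vect_smooth_at V W (f : V -> W) v (P : set 'rV[R]_(vdim V)) :
  open P -> P (@vcrd V v) -> smooth P (@vcrd W \o f \o @vinv V) ->
  smooth_at (vect_atlas V) (vect_atlas W) f v.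
Proof.
move=> oP Pv Ps; exists (vect_chart V), (vect_chart W); split => //; split => //.
exists P; split => // w _; exists (@vinv V w) => //; exact: vinvK.
Qed.

Lemma smooth_at_rlinear V W (f : V -> W) v : rlinear f ->
  smooth_at (vect_atlas V) (vect_atlas W) f v.
Proof.
move=> fl; apply: (@vect_smooth_at _ _ _ _ setT) => //; first exact: openT.
exact: (@smooth_linear_mx R 1 (vdim V) 'rV[R]_(vdim W) setT (rlinear_crd_pack fl)).
Qed.

(** In coordinates, a sum of products of a coordinate of p.1 with a linear
    function of p.2. *)
Lemma smooth_at_bilinear V W Z (f : V -> W -> Z) p :
  (forall w, rlinear (f^~ w)) -> (forall v, rlinear (f v)) ->
  smooth_at (prod_atlas (vect_atlas V) (vect_atlas W)) (vect_atlas Z)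
    (fun p => f p.1 p.2) p.
Proof.
move=> fl fr; exists (prod_chart (vect_chart V) (vect_chart W)), (vect_chart Z).
split => //; first by exists (vect_chart V), (vect_chart W).
have imT : [set: 'rV[R]_(vdim V + vdim W)] `<=`
    cmap (prod_chart (vect_chart V) (vect_chart W)) @`
    (cdom (prod_chart (vect_chart (s := s) V) (vect_chart W)) `&`
     (fun p => f p.1 p.2) @^-1` cdom (vect_chart Z)).
  move=> w _; exists (@vinv V (lsubmx w), @vinv W (rsubmx w)) => //.
  rewrite -[LHS]/(row_mx (vcrd (@vinv V (lsubmx w))) (vcrd (@vinv W (rsubmx w)))).
  by rewrite !vinvK hsubmxK.
split => //; exists setT; split => //; first exact: openT.
move=> m; apply/(Ck_mxP _ _ openT) => i j.
pose G p (r : 'rV[R]_(vdim W)) : 'rV[R]_(vdim Z) :=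
  (@vcrd Z \o f (@vinv V (delta_mx 0 p)) \o @vinv W) r.
apply: (@Ck_eq _ _ _ _ _ (\sum_(p < vdim V)
  ((fun w : 'rV[R]_(vdim V + vdim W) => w 0 (lshift _ p)) *
   (fun w => G p (rsubmx w) i j)))) => //; first exact: openT.
  move=> w _; rewrite fct_sumE; apply: esym.
  transitivity (rlinear_crd_pack (fl (@vinv W (rsubmx w))) (lsubmx w) i j) => //.
  rewrite {1}[lsubmx w]row_sum_delta linear_sum summxE; apply: eq_bigr => l _.
  rewrite linearZ mxE [lsubmx w 0 l]mxE; congr (_ * _).
apply: Ck_sum => [|l]; first exact: openT.
apply: CkM; first exact: openT.
  have idC : Ck m setT (idfun : 'rV[R]_(vdim V + vdim W) -> 'rV[R]_(vdim V + vdim W)).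
    exact: smooth_linear_mx.
  exact: ((Ck_mxP _ _ openT).1 idC 0 (lshift _ l)).
pose H := rlinear_crd_pack (fr (@vinv V (delta_mx 0 l))) \o @rsubmx R 1 (vdim V) (vdim W).
have GC : Ck m setT H.
  exact: (@smooth_linear_mx R 1 _ 'rV[R]_(vdim Z) setT H).
exact: ((Ck_mxP _ _ openT).1 GC i j).
Qed.

Lemma rmx_crd_linear V W :
  linear (fun x : 'rV[R]_(vdim 'Hom(V, W)) => rmx (@vinv 'Hom(V, W) x)).
Proof. by move=> r x y; rewrite vinvP rmxP. Qed.

Definition rmx_crd V W : {linear 'rV[R]_(vdim 'Hom(V, W)) -> 'M[R]_(vdim V, vdim W)} :=
  HB.pack (fun x : 'rV[R]_(vdim 'Hom(V, W)) => rmx (@vinv 'Hom(V, W) x))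
   (GRing.isLinear.Build R 'rV[R]_(vdim 'Hom(V, W)) 'M[R]_(vdim V, vdim W) *:%R _
     (@rmx_crd_linear V W)).

Lemma mxhom_crd_linear V W :
  linear (fun Y : 'M[R]_(vdim V, vdim W) => @vcrd 'Hom(V, W) (mxhom Y)).
Proof. by move=> r x y; rewrite mxhomP vcrdP. Qed.

Definition mxhom_crd V W : {linear 'M[R]_(vdim V, vdim W) -> 'rV[R]_(vdim 'Hom(V, W))} :=
  HB.pack (fun Y : 'M[R]_(vdim V, vdim W) => @vcrd 'Hom(V, W) (mxhom Y))
   (GRing.isLinear.Build R 'M[R]_(vdim V, vdim W) 'rV[R]_(vdim 'Hom(V, W)) *:%R _
     (@mxhom_crd_linear V W)).

Lemma rmx_preimage_open V W (U : set 'M[R]_(vdim V, vdim W)) : open U ->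
  chart_open (charts (vect_atlas 'Hom(V, W))) [set f : 'Hom(V, W) | U (rmx f)].
Proof.
move=> oU c ->.
have -> : @vcrd 'Hom(V, W) @` (setT `&` [set f : 'Hom(V, W) | U (rmx f)]) =
    @rmx_crd V W @^-1` U.
  apply/seteqP; split => [_ [f [_ Uf] <-]|x Ux].
    by rewrite /preimage /= vcrdK.
  exists (@vinv 'Hom(V, W) x) => //; exact: (vinvK x).
by apply: open_comp => // x _; exact: linear_mx_continuous.
Qed.

Lemma smooth_at_mx V (F : 'M[R]_(vdim V) -> 'M[R]_(vdim V)) U (f : 'End(V)) :
  open U -> smooth U F -> U (rmx f) ->
  smooth_at (vect_atlas 'End(V)) (vect_atlas 'End(V)) (fun f => mxhom (F (rmx f))) f.
Proof.
move=> oU Fs Uf; apply: (@vect_smooth_at _ _ _ _ (@rmx_crd V V @^-1` U)).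
- by apply: open_comp => // x _; exact: linear_mx_continuous.
- by rewrite /preimage /= vcrdK.
move=> m; apply: (@Ck_post _ _ _ _ m _ (F \o @rmx_crd V V) (@mxhom_crd V V)).
- by apply: open_comp => // x _; exact: linear_mx_continuous.
- exact: linear_mx_continuous.
apply: (@Ck_pre _ _ _ _ m U F (@rmx_crd V V) (@rmx_crd V V)) => //.
- exact: linear_mx_continuous.
- by move=> h x v; rewrite linearP.
Qed.

Lemma Exp_smooth V (X : 'End(V)) :
  smooth_at (vect_atlas 'End(V)) (vect_atlas 'End(V)) (@Exp V) X.
Proof. by apply: (smooth_at_mx openT) => //; exact: mexp_smooth. Qed.

Lemma Log_smooth V (g : 'End(V)) : Logdom g ->
  smooth_at (vect_atlas 'End(V)) (vect_atlas 'End(V)) (@Log V) g.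
Proof. by move=> gU; apply: (smooth_at_mx (@open_logdom _ _)) => //; exact: mlog_smooth. Qed.

Lemma Logdom_open V : chart_open (charts (vect_atlas 'End(V))) (@Logdom V).
Proof. exact: rmx_preimage_open (@open_logdom _ _). Qed.

Lemma Small_open V : chart_open (charts (vect_atlas 'End(V))) (@Small V).
Proof.
apply: (@rmx_preimage_open V V [set X | rownorm X < logradius R]).
rewrite openE => X Xr; rewrite /interior.
have := @near_rownorm R _ _ X ((logradius R - rownorm X) / 2).
rewrite divr_gt0 ?subr_gt0 // => /(_ isT); apply: filterS => Y XY.
have := rownormD (Y - X) X; rewrite subrK rownormB.
by rewrite /= in Xr *; lra.
Qed.

Lemma Small0 V : Small (0 : 'End(V)).
Proof. by rewrite /Small /= rmx0 rownorm0; exact: logradius_gt0. Qed.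

End RealCoordinates.

(** * Linear maps on tensor products *)
Section TensorMaps.
Variable k : fieldType.
Implicit Types V W Z : vectType k.

Lemma tens_linear_r V W (v : V) : linear (fun w : W => tens v w).
Proof.
move=> a w w'; apply/lfunP => phi; rewrite add_lfunE scale_lfunE !tensE.
by rewrite scalerDr !scalerA mulrC.
Qed.

Lemma tens_linear_l V W (w : W) : linear (fun v : V => tens v w).
Proof.
move=> a v v'; apply/lfunP => phi; rewrite add_lfunE scale_lfunE !tensE.
by rewrite linearP scalerDl scalerA.
Qed.

Lemma tens_ext V W Z (f g : 'Hom(tensor V W, Z)) :
  (forall v w, f (tens v w) = g (tens v w)) -> f = g.
Proof.
move=> fg; apply/lfunP => t; rewrite (tensor_sum t) !linear_sum.
by apply: eq_bigr => i _; exact: fg.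
Qed.

Definition leib V W (X : 'End(V)) (Y : 'End(W)) : 'End(tensor V W) :=
  tmap X \1%VF + tmap \1%VF Y.

Lemma leib_tens V W (X : 'End(V)) (Y : 'End(W)) v w :
  leib X Y (tens v w) = tens (X v) w + tens v (Y w).
Proof. by rewrite add_lfunE !tmap_tens !id_lfunE. Qed.

Lemma tlin_subproof V W Z (b : 'Hom(V, 'Hom(W, Z))) :
  linear (fun t : tensor V W => \sum_(i < \dim {:V}) b (vbasis {:V})`_i (t (vcoord i))).
Proof.
move=> a t t'; rewrite scaler_sumr -big_split; apply: eq_bigr => i _ /=.
by rewrite add_lfunE scale_lfunE linearP.
Qed.

(** Through the induced map on the tensor product, compatibility with a bilinear
    map becomes an intertwining condition, to which [Exp_intertwine] and
    [Small_intertwine] apply. *)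
Definition tlin V W Z (b : 'Hom(V, 'Hom(W, Z))) : 'Hom(tensor V W, Z) :=
  mklfun (tlin_subproof b).

Lemma tlin_tens V W Z (b : 'Hom(V, 'Hom(W, Z))) v w : tlin b (tens v w) = b v w.
Proof.
rewrite mklfunE {2}(coord_vbasis (memvf v)) linear_sum sum_lfunE.
apply: eq_bigr => i _; rewrite tensE lfunE /= linearZ linearZ scale_lfunE.
by [].
Qed.

Definition leibniz V W Z (b : 'Hom(V, 'Hom(W, Z))) (X : 'End(V)) (Y : 'End(W))
  (D : 'End(Z)) : Prop := forall v w, D (b v w) = b (X v) w + b v (Y w).

Definition equivariant V W Z (b : 'Hom(V, 'Hom(W, Z))) (f : 'End(V))
  (g : 'End(W)) (h : 'End(Z)) : Prop := forall v w, h (b v w) = b (f v) (g w).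

Lemma leibniz_tlin V W Z (b : 'Hom(V, 'Hom(W, Z))) X Y D :
  leibniz b X Y D <-> (tlin b \o leib X Y = D \o tlin b)%VF.
Proof.
split=> [bD|e v w].
  apply: tens_ext => v w.
  by rewrite !comp_lfunE leib_tens linearD /= !tlin_tens bD.
have := congr1 (fun f : 'Hom(tensor V W, Z) => f (tens v w)) e.
by rewrite /= !comp_lfunE leib_tens linearD /= !tlin_tens => <-.
Qed.

Lemma equivariant_tlin V W Z (b : 'Hom(V, 'Hom(W, Z))) f g h :
  equivariant b f g h <-> (tlin b \o tmap f g = h \o tlin b)%VF.
Proof.
split=> [bD|e v w].
  by apply: tens_ext => v w; rewrite !comp_lfunE tmap_tens !tlin_tens bD.
have := congr1 (fun f : 'Hom(tensor V W, Z) => f (tens v w)) e.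
by rewrite /= !comp_lfunE tmap_tens !tlin_tens => <-.
Qed.

(** Take a subspace of largest dimension contained in D. *)
Lemma vspace_of_prop (E : vectType k) (D : E -> Prop) : D 0 ->
  (forall a u v, D u -> D v -> D (a *: u + v)) ->
  exists U : {vspace E}, forall v, v \in U <-> D v.
Proof.
move=> D0 Dlin.
pose P n := `[< exists2 U : {vspace E}, \dim U = n & forall v, v \in U -> D v >].
have P0 : exists n, P n.
  exists 0%N; apply/asboolP; exists 0%VS; first exact: dimv0.
  by move=> v; rewrite memv0 => /eqP ->.
have Pub n : P n -> (n <= \dim {:E})%N.
  by move=> /asboolP[U <- _]; apply: dimvS; exact: subvf.
case: (ex_maxnP P0 Pub) => n /asboolP[U dU UD] nmax.
exists U => v; split; first exact: UD.
move=> Dv; apply/negPn/negP => vU.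
have : P (\dim (U + <[v]>)%VS).
  apply/asboolP; exists (U + <[v]>)%VS => // w /memv_addP[u Uu [_ /vlineP[a ->] ->]].
  by rewrite addrC; apply: Dlin => //; exact: UD.
move=> /nmax; rewrite -dU; apply/negP; rewrite -ltnNge.
rewrite ltn_neqAle dimvS ?addvSl // andbT.
apply: contra vU; rewrite (dimv_leqif_eq (addvSl U <[v]>)) => /eqP e.
by rewrite e; apply: (subvP (addvSr _ _)); exact: memv_line.
Qed.

(** The domain of P is a subspace; choose values on one of its bases and extend
    them linearly. *)
Lemma linear_choice (E F : vectType k) (P : E -> F -> Prop) : P 0 0 ->
  (forall a e e' f f', P e f -> P e' f' -> P (a *: e + e') (a *: f + f')) ->
  exists S : 'Hom(E, F), forall e, (exists f, P e f) -> P e (S e).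
Proof.
move=> P0 Plin.
have [||U UP] := @vspace_of_prop E (fun e => exists f, P e f).
- by exists 0.
- by move=> a e e' [f Pf] [f' Pf']; exists (a *: f + f'); exact: Plin.
have ch i : {f : F | P (vbasis U)`_i f \/ ~ (i < \dim U)%N}.
  apply: cid; have [iU|iU] := boolP (i < \dim U)%N; last by exists 0; right.
  have /UP[f Pf] : (vbasis U)`_i \in U by apply: vbasis_mem; rewrite mem_nth ?size_tuple.
  by exists f; left.
have Slin : linear (fun e : E => \sum_(i < \dim U) coord (vbasis U) i e *: sval (ch i)).
  move=> a e e'; rewrite scaler_sumr -big_split; apply: eq_bigr => i _ /=.
  by rewrite linearP scalerDl scalerA.
exists (mklfun Slin) => e /UP eU; rewrite mklfunE {1}(coord_vbasis eU).
elim/big_ind2: _ => // [e1 f1 e2 f2 P1 P2|i _].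
  by have := Plin 1 _ _ _ _ P1 P2; rewrite !scale1r.
have Pi : P (vbasis U)`_i (sval (ch i)).
  by case: (svalP (ch i)) => // /(_ (ltn_ord i)).
by have := Plin (coord (vbasis U) i e) _ _ _ _ Pi P0; rewrite !addr0.
Qed.

(** Like compatibility with products, parity is an intertwining condition. *)
Lemma even_mapP (V W : super_space k) (f : 'Hom(V, W)) :
  even_map f <-> forall i, (f \o gproj V i = gproj W i \o f)%VF.
Proof.
split=> [fe i|fe i v Vv].
  by rewrite (gproj_shift i (j := false)) ?addbF // => e v Vv; rewrite addbF; exact: fe.
rewrite -(gproj_id Vv) -[f _](comp_lfunE f) fe comp_lfunE; exact: gproj_mem.
Qed.

End TensorMaps.

(** * Exponentials of derivations *)
Section ExpTensor.
Variables (R : realType) (s : scalar_kind).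
Notation k := (scalars R s).
Implicit Types V W Z : vectType k.

(** Tensoring with a fixed vector intertwines X and its extension to the tensor
    product. *)
Lemma Exp_tmapl V W (X : 'End(V)) :
  Exp (tmap X \1%VF : 'End(tensor V W)) = tmap (Exp X) \1%VF.
Proof.
apply: tens_ext => v w.
pose iota : 'Hom(V, tensor V W) := mklfun (@tens_linear_l _ V W w).
have iE u : iota u = tens u w by rewrite mklfunE.
have e : (iota \o X = tmap X \1%VF \o iota)%VF.
  by apply/lfunP => u; rewrite !comp_lfunE !iE tmap_tens id_lfunE.
have := congr1 (fun f : 'Hom(V, tensor V W) => f v) (Exp_intertwine e).
by rewrite /= !comp_lfunE !iE tmap_tens id_lfunE => ->.
Qed.

Lemma Exp_tmapr V W (Y : 'End(W)) :
  Exp (tmap \1%VF Y : 'End(tensor V W)) = tmap \1%VF (Exp Y).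
Proof.
apply: tens_ext => v w.
pose iota : 'Hom(W, tensor V W) := mklfun (@tens_linear_r _ V W v).
have iE u : iota u = tens v u by rewrite mklfunE.
have e : (iota \o Y = tmap \1%VF Y \o iota)%VF.
  by apply/lfunP => u; rewrite !comp_lfunE !iE tmap_tens id_lfunE.
have := congr1 (fun f : 'Hom(W, tensor V W) => f w) (Exp_intertwine e).
by rewrite /= !comp_lfunE !iE tmap_tens id_lfunE => ->.
Qed.

Lemma Exp_leib V W (X : 'End(V)) (Y : 'End(W)) :
  Exp (leib X Y) = tmap (Exp X) (Exp Y).
Proof.
rewrite /leib Exp_comm; last first.
  by apply: tens_ext => v w; rewrite !comp_lfunE !tmap_tens !id_lfunE.
rewrite Exp_tmapl Exp_tmapr.
by apply: tens_ext => v w; rewrite comp_lfunE !tmap_tens !id_lfunE.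
Qed.

(** A derivation exponentiates to an automorphism; the converse for logarithms
    holds near the identity, where the exponential is injective. *)
Lemma leibniz_Exp V W Z (b : 'Hom(V, 'Hom(W, Z))) X Y D :
  leibniz b X Y D -> equivariant b (Exp X) (Exp Y) (Exp D).
Proof.
by move=> /leibniz_tlin/Exp_intertwine; rewrite Exp_leib => /equivariant_tlin.
Qed.

Lemma equivariant_Log V W Z (b : 'Hom(V, 'Hom(W, Z))) f g h :
  Logdom f -> Logdom g -> Logdom h -> Small (leib (Log f) (Log g)) ->
  equivariant b f g h -> leibniz b (Log f) (Log g) (Log h).
Proof.
move=> fU gU hU fgs /equivariant_tlin e; apply/leibniz_tlin.
apply: Small_intertwine => //; first exact: Small_Log.
by rewrite Exp_leib !Exp_Log.
Qed.

Lemma even_Exp (V : super_space k) (X : 'End(V)) : even_map X -> even_map (Exp X).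
Proof. by move=> /even_mapP Xe; apply/even_mapP => i; rewrite (Exp_intertwine (esym (Xe i))). Qed.

Lemma even_Log (V : super_space k) (g : 'End(V)) : Logdom g ->
  even_map g -> even_map (Log g).
Proof.
move=> gU /even_mapP ge; apply/even_mapP => i; apply/esym.
by apply: Small_intertwine; rewrite ?Exp_Log //; exact: Small_Log.
Qed.

Lemma bij_lfun_inv V W (f : 'Hom(V, W)) (g : 'Hom(W, V)) :
  (g \o f = \1)%VF -> (f \o g = \1)%VF -> bijective f.
Proof.
move=> gf fg; exists g => v; first by rewrite -comp_lfunE gf id_lfunE.
by rewrite -comp_lfunE fg id_lfunE.
Qed.

Lemma Exp_bij V (X : 'End(V)) : bijective (Exp X).
Proof. exact: bij_lfun_inv (ExpNl X) (ExpNr X). Qed.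

Lemma smooth_at_sum_rlinear V W Z (a : V -> Z) (b : W -> Z) p :
  rlinear a -> rlinear b ->
  smooth_at (prod_atlas (vect_atlas V) (vect_atlas W)) (vect_atlas Z)
    (fun p => a p.1 + b p.2) p.
Proof.
move=> al bl; exists (prod_chart (vect_chart V) (vect_chart W)), (vect_chart Z).
split => //; first by exists (vect_chart V), (vect_chart W).
split => //; exists setT; split => //; first exact: openT.
  move=> w _; exists (vinv (lsubmx w), vinv (rsubmx w)) => //.
  rewrite -[LHS]/(row_mx (vcrd (@vinv R s V (lsubmx w))) (vcrd (@vinv R s W (rsubmx w)))).
  by rewrite !vinvK hsubmxK.
pose F (w : 'rV[R]_(vdim V + vdim W)) : 'rV[R]_(vdim Z) :=
  rlinear_crd_pack al (lsubmx w) + rlinear_crd_pack bl (rsubmx w).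
have Fl : linear F.
  by move=> r x y; rewrite /F !linearP scalerDr addrACA.
pose L : {linear 'rV[R]_(vdim V + vdim W) -> 'rV[R]_(vdim Z)} :=
  HB.pack F (GRing.isLinear.Build R 'rV[R]_(vdim V + vdim W) 'rV[R]_(vdim Z) *:%R F Fl).
apply: (@smooth_eq _ _ _ _ L); first exact: openT.
  move=> w _; rewrite /= /F.
  transitivity (vcrd (a (vinv (lsubmx w)) + b (vinv (rsubmx w)))) => //.
  exact: (esym (vcrdD _ _)).
exact: smooth_linear_mx.
Qed.

Lemma smooth_at_add T (A : atlas R T) V (f g : T -> V) t :
  smooth_at A (vect_atlas V) f t -> smooth_at A (vect_atlas V) g t ->
  smooth_at A (vect_atlas V) (fun x => f x + g x) t.
Proof.
move=> fs gs; apply: (smooth_at_comp (g := fun p : V * V => p.1 + p.2)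
  (smooth_at_pair fs gs)).
exact: (@smooth_at_sum_rlinear V V V id id).
Qed.

Lemma smooth_at_lfun T (A : atlas R T) V W (L : 'Hom(V, W)) (f : T -> V) t :
  smooth_at A (vect_atlas V) f t -> smooth_at A (vect_atlas W) (fun x => L (f x)) t.
Proof.
move=> fs; apply: (smooth_at_comp (g := L) fs).
exact/smooth_at_rlinear/hom_rlinear.
Qed.

Lemma smooth_at_linear T (A : atlas R T) V W (L : V -> W) (f : T -> V) t :
  linear L ->
  smooth_at A (vect_atlas V) f t -> smooth_at A (vect_atlas W) (fun x => L (f x)) t.
Proof.
move=> Ll fs; apply: (smooth_at_comp (g := L) fs).
exact/smooth_at_rlinear/linear_rlinear.
Qed.

Lemma smooth_at_leib T (A : atlas R T) V W (f : T -> 'End(V)) (g : T -> 'End(W)) t :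
  smooth_at A (vect_atlas 'End(V)) f t -> smooth_at A (vect_atlas 'End(W)) g t ->
  smooth_at A (vect_atlas 'End(tensor V W)) (fun x => leib (f x) (g x)) t.
Proof.
move=> fs gs; apply: smooth_at_add.
  apply: (@smooth_at_linear _ _ _ _ (fun X => tmap X \1%VF)) => // a X Y.
  by apply/lfunP => u; rewrite tmapDl add_lfunE scale_lfunE.
apply: (@smooth_at_linear _ _ _ _ (fun X => tmap \1%VF X)) => // a X Y.
by apply/lfunP => u; rewrite tmapDr add_lfunE scale_lfunE.
Qed.

End ExpTensor.

(** * The group of implementers *)
Section ImplementingGroup.
Variables (R : realType) (s : scalar_kind).
Notation k := (scalars R s).

Lemma bij_lfunKV (V W : vectType k) (f : 'Hom(V, W)) : bijective f ->
  (f \o f^-1)%VF = \1%VF.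
Proof.
move=> [g fK gK]; apply/lfunP => w; rewrite comp_lfunE id_lfunE limg_lfunVK //.
by rewrite -(gK w) memv_img ?memvf.
Qed.

Lemma bij_lfunK (V W : vectType k) (f : 'Hom(V, W)) : bijective f ->
  (f^-1 \o f)%VF = \1%VF.
Proof.
move=> fb; have [g fK gK] := fb; apply/lfunP => v; rewrite comp_lfunE id_lfunE.
apply: (bij_inj fb); rewrite -(comp_lfunE f) (bij_lfunKV fb).
by rewrite id_lfunE.
Qed.

Lemma bij_lfunV (V W : vectType k) (f : 'Hom(V, W)) : bijective f ->
  bijective (f^-1)%VF.
Proof. by move=> fb; exact: bij_lfun_inv (bij_lfunKV fb) (bij_lfunK fb). Qed.

Lemma bij_comp_lfun (V W Z : vectType k) (f : 'Hom(V, W)) (g : 'Hom(W, Z)) :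
  bijective f -> bijective g -> bijective (g \o f)%VF.
Proof.
move=> fb gb; apply: (eq_bij (bij_comp gb fb)) => v.
by rewrite comp_lfunE.
Qed.

Lemma bij_lfun1 (V : vectType k) : bijective (\1%VF : 'End(V)).
Proof. by exists (\1%VF : 'End(V)) => v; rewrite !id_lfunE. Qed.

Lemma even_map_comp (V W Z : super_space k) (f : 'Hom(V, W)) (g : 'Hom(W, Z)) :
  even_map f -> even_map g -> even_map (g \o f)%VF.
Proof. by move=> fe ge i v Vv; rewrite comp_lfunE; apply: ge; exact: fe. Qed.

Lemma even_mapV (V W : super_space k) (f : 'Hom(V, W)) : bijective f ->
  even_map f -> even_map (f^-1)%VF.
Proof.
move=> fb /even_mapP fe; apply/even_mapP => i; apply/lfunP => w.
have fV w' : f ((f^-1)%VF w') = w' by rewrite -comp_lfunE bij_lfunKV // id_lfunE.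
apply: (bij_inj fb); rewrite !comp_lfunE fV -[RHS](comp_lfunE f) fe.
by rewrite comp_lfunE fV.
Qed.

Lemma even_map1 (V : super_space k) : even_map (\1%VF : 'End(V)).
Proof. by move=> i v; rewrite id_lfunE. Qed.

(** As f is onto, the image of the unit is an identity element, and those are
    unique. *)
Lemma bij_alg_hom (A B : super_algebra k) (f : 'Hom(A, B)) : bijective f ->
  even_map f -> (forall a b, f (smul A a b) = smul B (f a) (f b)) -> alg_hom f.
Proof.
move=> [g fK gK] fe fM; split => //.
by rewrite -[LHS]smul1r -(gK (sone B)) -fM smul1l.
Qed.

Lemma alg_hom_comp (A B C : super_algebra k) (f : 'Hom(A, B)) (g : 'Hom(B, C)) :
  alg_hom f -> alg_hom g -> alg_hom (g \o f)%VF.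
Proof.
move=> [fe f1 fM] [ge g1 gM]; split; first exact: even_map_comp.
  by rewrite comp_lfunE f1.
by move=> a b; rewrite !comp_lfunE fM gM.
Qed.

Lemma alg_homV (A B : super_algebra k) (f : 'Hom(A, B)) : bijective f ->
  alg_hom f -> alg_hom (f^-1)%VF.
Proof.
move=> fb [fe f1 fM]; apply: bij_alg_hom; first exact: bij_lfunV.
  exact: even_mapV.
move=> a b; apply: (bij_inj fb); rewrite fM -!(comp_lfunE f) (bij_lfunKV fb).
by rewrite !id_lfunE.
Qed.

Lemma alg_hom1 (A : super_algebra k) : alg_hom (\1%VF : 'End(A)).
Proof. by split => [|//|a b]; rewrite ?id_lfunE //; exact: even_map1. Qed.

Lemma super_aut_comp (A : super_algebra k) (f g : 'End(A)) :
  super_aut f -> super_aut g -> super_aut (f \o g)%VF.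
Proof.
by move=> [fb fh] [gb gh]; split; [exact: bij_comp_lfun|exact: alg_hom_comp].
Qed.

Lemma super_autV (A : super_algebra k) (f : 'End(A)) :
  super_aut f -> super_aut (f^-1)%VF.
Proof. by move=> [fb fh]; split; [exact: bij_lfunV|exact: alg_homV]. Qed.

Lemma super_aut1 (A : super_algebra k) : super_aut (\1%VF : 'End(A)).
Proof. by split; [exact: bij_lfun1|exact: alg_hom1]. Qed.

Section Intertwiners.
Variables (A B A' B' A'' B'' : super_algebra k) (M : bimodule A B)
  (M' : bimodule A' B') (M'' : bimodule A'' B'').

Lemma intertwines_lact (f : 'Hom(A, A')) (u : 'Hom(M, M')) (g : 'Hom(B, B')) :
  bimod_intertwines f u g -> g (sone B) = sone B' ->
  forall a m, u (lact M a m) = lact M' (f a) (u m).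
Proof. by move=> fug g1 a m; have := fug a m (sone B); rewrite g1 !ract1. Qed.

Lemma intertwines_ract (f : 'Hom(A, A')) (u : 'Hom(M, M')) (g : 'Hom(B, B')) :
  bimod_intertwines f u g -> f (sone A) = sone A' ->
  forall m b, u (ract M b m) = ract M' (g b) (u m).
Proof. by move=> fug f1 m b; have := fug (sone A) m b; rewrite f1 !lact1. Qed.

Lemma intertwinesI (f : 'Hom(A, A')) (u : 'Hom(M, M')) (g : 'Hom(B, B')) :
  (forall a m, u (lact M a m) = lact M' (f a) (u m)) ->
  (forall m b, u (ract M b m) = ract M' (g b) (u m)) ->
  bimod_intertwines f u g.
Proof. by move=> ul ur a m b; rewrite ur ul. Qed.

Lemma intertwines_comp (f : 'Hom(A, A')) (u : 'Hom(M, M')) (g : 'Hom(B, B'))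
    (f' : 'Hom(A', A'')) (u' : 'Hom(M', M'')) (g' : 'Hom(B', B'')) :
  bimod_intertwines f u g -> bimod_intertwines f' u' g' ->
  bimod_intertwines (f' \o f)%VF (u' \o u)%VF (g' \o g)%VF.
Proof. by move=> e e' a m b; rewrite !comp_lfunE e e'. Qed.

Lemma intertwinesV (f : 'Hom(A, A')) (u : 'Hom(M, M')) (g : 'Hom(B, B')) :
  bijective f -> bijective u -> bijective g -> bimod_intertwines f u g ->
  bimod_intertwines (f^-1)%VF (u^-1)%VF (g^-1)%VF.
Proof.
move=> fb ub gb e a m b; apply: (bij_inj ub).
by rewrite e -!(comp_lfunE f) -!(comp_lfunE u) -!(comp_lfunE g) !bij_lfunKV // !id_lfunE.
Qed.

End Intertwiners.

Section OneBimodule.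
Variables (A B : super_algebra k) (M : bimodule A B).
Notation T3 := ('End(A) * 'End(M) * 'End(B))%type.

Lemma implementers_comp (t t' : T3) : implementers (M := M) t -> implementers (M := M) t' ->
  implementers (M := M) ((t.1.1 \o t'.1.1)%VF, (t.1.2 \o t'.1.2)%VF, (t.2 \o t'.2)%VF).
Proof.
move=> [fa ga ub ue i] [fa' ga' ub' ue' i']; split => /=.
- exact: super_aut_comp.
- exact: super_aut_comp.
- exact: bij_comp_lfun.
- exact: even_map_comp.
- exact: intertwines_comp i' i.
Qed.

(** An implementer is a tuple of maps compatible with four bilinear maps and with
    parity, so that its logarithm can be treated one condition at a time. *)
Lemma implementersP (f : 'End(A)) (u : 'End(M)) (g : 'End(B)) :
  implementers (M := M) (f, u, g) <->
  [/\ bijective f, bijective u & bijective g] /\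
  [/\ even_map f, even_map u & even_map g] /\
  [/\ equivariant (smul A) f f f, equivariant (lact M) f u u,
      equivariant (ract M) g u u & equivariant (smul B) g g g].
Proof.
split=> [[/= [fb [fe f1 fM]] [gb [ge g1 gM]] ub ue i]|[[fb ub gb] [[fe ue ge] [fM l r gM]]]].
  do 2![split => //]; split => //; last first.
    by move=> b m; apply: (intertwines_ract i).
  by move=> a m; apply: (intertwines_lact i).
split => //=.
- by split => //; exact: bij_alg_hom.
- by split => //; exact: bij_alg_hom.
by apply: intertwinesI.
Qed.

(** The Lie algebra of the group of implementers. *)
Definition lie_triple (X : 'End(A)) (Y : 'End(M)) (Z : 'End(B)) : Prop :=
  [/\ even_map X, even_map Y & even_map Z] /\
  [/\ leibniz (smul A) X X X, leibniz (lact M) X Y Y,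
      leibniz (ract M) Z Y Y & leibniz (smul B) Z Z Z].

Lemma lie_Exp X Y Z : lie_triple X Y Z ->
  implementers (M := M) (Exp X, Exp Y, Exp Z).
Proof.
move=> [[Xe Ye Ze] [XM l r ZM]]; apply/implementersP; do 2![split].
- exact: Exp_bij.
- exact: Exp_bij.
- exact: Exp_bij.
- by split; exact: even_Exp.
- by split; exact: leibniz_Exp.
Qed.

Lemma leibnizP (V W Z : vectType k) (b : 'Hom(V, 'Hom(W, Z))) a X Y D X' Y' D' :
  leibniz b X Y D -> leibniz b X' Y' D' ->
  leibniz b (a *: X + X') (a *: Y + Y') (a *: D + D').
Proof.
move=> e e' v w; rewrite !add_lfunE !scale_lfunE e e' !linearP add_lfunE scale_lfunE.
by rewrite scalerDr addrACA.
Qed.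

Lemma leibniz0 (V W Z : vectType k) (b : 'Hom(V, 'Hom(W, Z))) : leibniz b 0 0 0.
Proof. by move=> v w; rewrite !zero_lfunE !linear0 zero_lfunE addr0. Qed.

Lemma even_linear (V : super_space k) a (X X' : 'End(V)) :
  even_map X -> even_map X' -> even_map (a *: X + X').
Proof.
by move=> e e' i v Vv; rewrite add_lfunE scale_lfunE rpredD ?rpredZ //; [exact: e|exact: e'].
Qed.

Lemma lie_linear a X Y Z X' Y' Z' : lie_triple X Y Z -> lie_triple X' Y' Z' ->
  lie_triple (a *: X + X') (a *: Y + Y') (a *: Z + Z').
Proof.
move=> [[Xe Ye Ze] [XM l r ZM]] [[Xe' Ye' Ze'] [XM' l' r' ZM']].
by split; split; (exact: even_linear || exact: leibnizP).
Qed.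

Lemma lie0 : lie_triple 0 0 0.
Proof.
have e0 (V : super_space k) : even_map (0 : 'End(V)).
  by move=> i v _; rewrite zero_lfunE mem0v.
by split; split; (exact: e0 || exact: leibniz0).
Qed.

Lemma lie_Log (f : 'End(A)) (u : 'End(M)) (g : 'End(B)) :
  Logdom f -> Logdom u -> Logdom g ->
  [/\ Small (leib (Log f) (Log f)), Small (leib (Log f) (Log u)),
      Small (leib (Log g) (Log u)) & Small (leib (Log g) (Log g))] ->
  implementers (M := M) (f, u, g) -> lie_triple (Log f) (Log u) (Log g).
Proof.
move=> fU uU gU [s1 s2 s3 s4] /implementersP[_ [[fe ue ge] [fM l r gM]]].
by split; split; (exact: even_Log || exact: equivariant_Log).
Qed.

End OneBimodule.

(** * Openness of the projections *)

Lemma open_map_at (V V' : vectType k) (S : set V) (S' : set V') (f : V -> V') :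
  open_map (s := s) S S' f -> forall v (W : set V), S v -> vect_open (s := s) W -> W v ->
  exists2 W' : set V', vect_open (s := s) W' & W' (f v) /\
    forall y, S' y -> W' y -> exists u, [/\ S u, W u & f u = y].
Proof.
move=> fo v W Sv oW Wv; have [|W' oW' e] := fo (S `&` W); first by exists W.
exists W' => //; split; first by have [] : (S' `&` W') (f v) by rewrite -e; exists v.
move=> y S'y W'y; have [u [Su Wu] <-] : (f @` (S `&` W)) y by rewrite e.
by exists u.
Qed.

Lemma at_open_map (V V' : vectType k) (S : set V) (S' : set V') (f : V -> V') :
  (forall v, S v -> S' (f v)) ->
  (forall v (W : set V), S v -> vect_open (s := s) W -> W v ->
   exists2 W' : set V', vect_open (s := s) W' & W' (f v) /\
     forall y, S' y -> W' y -> exists u, [/\ S u, W u & f u = y]) ->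
  open_map (s := s) S S' f.
Proof.
move=> fS fat _ [W oW ->].
pose N := [set y | exists2 W' : set V', vect_open (s := s) W' & W' y /\
  forall z, S' z -> W' z -> (f @` (S `&` W)) z].
exists N.
  apply: (@chart_openP _ _ (vect_atlas V')) => y [W' oW' [W'y W'P]].
  exists W' => //; split => // z W'z; by exists W'.
apply/seteqP; split => [_ [v [Sv Wv] <-]|y [S'y [W' oW' [W'y W'P]]]]; last exact: W'P.
split; first exact: fS.
have [W' oW' [W'fv W'P]] := fat v W Sv oW Wv.
exists W' => //; split => // z S'z W'z.
by have [u [Su Wu <-]] := W'P z S'z W'z; exists u.
Qed.

Lemma vect_open_preimage (V W : vectType k) (f : V -> W) (O : set W) : linear f ->
  vect_open (s := s) O -> vect_open (s := s) (f @^-1` O).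
Proof.
move=> fl oO; rewrite -[f @^-1` O]setTI.
apply: (@chart_open_smooth_preimage _ _ _ (vect_atlas V) (vect_atlas W)) => //.
  exact: chart_openT.
by move=> v _; exact/smooth_at_rlinear/linear_rlinear.
Qed.

Section ImplementingAtIdentity.
Variables (A B : super_algebra k) (M : bimodule A B).
Notation T3 := ('End(A) * 'End(M) * 'End(B))%type.

Lemma implementers1 : implementers (M := M) (\1%VF, \1%VF, \1%VF).
Proof.
split => /=; [exact: super_aut1|exact: super_aut1|exact: bij_lfun1|exact: even_map1|].
by move=> a m b; rewrite !id_lfunE.
Qed.

Let mult (t t' : T3) : T3 :=
  ((t.1.1 \o t'.1.1)%VF, (t.1.2 \o t'.1.2)%VF, (t.2 \o t'.2)%VF).

Let mult_linear t : linear (mult t).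
Proof. by move=> a x y; rewrite /mult /= !comp_lfunDr -!comp_lfunZr. Qed.

(** By translation, openness of a projection needs to be checked only at the
    identity. *)
Lemma left_implementingP : left_implementing M <->
  forall W : set T3, vect_open (s := s) W -> W (\1%VF, \1%VF, \1%VF) ->
  exists2 N : set 'End(A), vect_open (s := s) N & N \1%VF /\ forall f, super_aut f -> N f ->
    exists u g, implementers (M := M) (f, u, g) /\ W (f, u, g).
Proof.
split=> [lo W oW W1|lo].
  have [N oN [N1 NP]] := open_map_at lo implementers1 oW W1.
  exists N => //; split => // f fa Nf; have [[[f' u] g] [ti Wt /= e]] := NP f fa Nf.
  by rewrite -{}e; exists u, g.
apply: at_open_map; first by move=> t [].
move=> t W It oW Wt; have [fa _ _ _ _] := It.
have [|N oN [N1 NP]] := lo (mult t @^-1` W) (vect_open_preimage (mult_linear t) oW).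
  by rewrite /preimage /mult /= !comp_lfun1r; case: t Wt {It fa} => [[? ?] ?].
exists ((fun f : 'End(A) => (t.1.1^-1 \o f)%VF) @^-1` N).
  apply: vect_open_preimage oN => a x y; by rewrite comp_lfunDr -comp_lfunZr.
split; first by rewrite /preimage /= bij_lfunK //; case: fa.
move=> f f_aut Nf.
have [u [g [ti Wm]]] := NP _ (super_aut_comp (super_autV fa) f_aut) Nf.
exists (mult t ((t.1.1^-1 \o f)%VF, u, g)); split => //.
  exact: implementers_comp.
by rewrite /mult /= comp_lfunA bij_lfunKV ?comp_lfun1l //; case: fa.
Qed.

Lemma right_implementingP : right_implementing M <->
  forall W : set T3, vect_open (s := s) W -> W (\1%VF, \1%VF, \1%VF) ->
  exists2 N : set 'End(B), vect_open (s := s) N & N \1%VF /\ forall g, super_aut g -> N g ->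
    exists f u, implementers (M := M) (f, u, g) /\ W (f, u, g).
Proof.
split=> [lo W oW W1|lo].
  have [N oN [N1 NP]] := open_map_at lo implementers1 oW W1.
  exists N => //; split => // g ga Ng; have [[[f u] g'] [ti Wt /= e]] := NP g ga Ng.
  by rewrite -{}e; exists f, u.
apply: at_open_map; first by move=> t [].
move=> t W It oW Wt; have [_ ga _ _ _] := It.
have [|N oN [N1 NP]] := lo (mult t @^-1` W) (vect_open_preimage (mult_linear t) oW).
  by rewrite /preimage /mult /= !comp_lfun1r; case: t Wt {It ga} => [[? ?] ?].
exists ((fun f : 'End(B) => (t.2^-1 \o f)%VF) @^-1` N).
  apply: vect_open_preimage oN => a x y; by rewrite comp_lfunDr -comp_lfunZr.
split; first by rewrite /preimage /= bij_lfunK //; case: ga.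
move=> g g_aut Ng.
have [f [u [ti Wm]]] := NP _ (super_aut_comp (super_autV ga) g_aut) Ng.
exists (mult t (f, u, (t.2^-1 \o g)%VF)); split => //.
  exact: implementers_comp.
by rewrite /mult /= comp_lfunA bij_lfunKV ?comp_lfun1l //; case: ga.
Qed.

End ImplementingAtIdentity.
End ImplementingGroup.

(** * Smooth lifts of automorphisms to implementers *)
Section LocalLift.
Variables (R : realType) (s : scalar_kind).
Notation k := (scalars R s).

Lemma real_scalar_neq0 (r : R) : r != 0 -> real_scalar s r != 0.
Proof.
move=> r0; rewrite /real_scalar; case: s => //=.
by apply: contra r0 => /eqP[->].
Qed.

Lemma vect_open_small_multiple (V : vectType k) (O : set V) (v : V) :
  vect_open (s := s) O -> O 0 -> exists2 c : k, c != 0 & O (c *: v).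
Proof.
move=> oO O0; have := oO (vect_chart V) erefl; rewrite setTI => oP.
have : \forall r \near (0 : R), (@vcrd R s V @` O) (r *: vcrd v).
  have c0 : {for 0, continuous (fun r : R => r *: @vcrd R s V v)}.
    exact: scalel_continuous.
  by apply: c0; apply: open_nbhs_nbhs; split => //; rewrite scale0r; exists 0; rewrite ?vcrd0.
move=> /nbhs_dnbhs h.
have [r [r0 [w Ow e]]] : exists r : R, r != 0 /\ (@vcrd R s V @` O) (r *: vcrd v).
  apply: (@filter_ex _ (0 : R)^'); near=> r; split; last by near: r.
  by near: r; exact: nbhs_dnbhs_neq.
exists (real_scalar s r); first exact: real_scalar_neq0.
suff -> : real_scalar s r *: v = w by [].
apply: (can_inj (@vcrdK R s V)); rewrite e -[_ *: v]addr0 vcrdP.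
by rewrite vcrd0 addr0.
Unshelve. all: by end_near. Qed.

Lemma leib_Log1 (V W : vectType k) :
  Small (leib (Log (\1%VF : 'End(V))) (Log (\1%VF : 'End(W)))).
Proof.
rewrite !Log1; have -> : leib (0 : 'End(V)) (0 : 'End(W)) = 0.
  apply: tens_ext => v w; rewrite leib_tens !zero_lfunE.
  by apply/lfunP => phi; rewrite add_lfunE !tensE zero_lfunE linear0 scale0r scaler0 addr0.
exact: Small0.
Qed.

Section Bimodule.
Variables (A B : super_algebra k) (M : bimodule A B).
Notation T3 := ('End(A) * 'End(M) * 'End(B))%type.

(** The triples near the identity on which [lie_Log] applies. *)
Definition log_good : set T3 := [set t : T3 |
  [/\ Logdom t.1.1, Logdom t.1.2 & Logdom t.2] /\
  [/\ Small (leib (Log t.1.1) (Log t.1.1)), Small (leib (Log t.1.1) (Log t.1.2)),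
      Small (leib (Log t.2) (Log t.1.2)) & Small (leib (Log t.2) (Log t.2))]].

Lemma log_good_nbhs : exists2 N : set T3, vect_open (s := s) N &
  N (\1%VF, \1%VF, \1%VF) /\ N `<=` log_good.
Proof.
pose t0 : T3 := (\1%VF, \1%VF, \1%VF).
have l1 : linear (fun t : T3 => t.1.1) by [].
have l2 : linear (fun t : T3 => t.1.2) by [].
have l3 : linear (fun t : T3 => t.2) by [].
have p1 := @smooth_at_rlinear R s _ _ _ t0 (linear_rlinear l1).
have p2 := @smooth_at_rlinear R s _ _ _ t0 (linear_rlinear l2).
have p3 := @smooth_at_rlinear R s _ _ _ t0 (linear_rlinear l3).
have q1 := smooth_at_comp p1 (Log_smooth (Logdom1 A)).
have q2 := smooth_at_comp p2 (Log_smooth (Logdom1 M)).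
have q3 := smooth_at_comp p3 (Log_smooth (Logdom1 B)).
have near1 (V : vectType k) (f : T3 -> 'End(V)) :
    smooth_at (vect_atlas T3) (vect_atlas 'End(V)) f t0 -> Small (f t0) ->
    exists2 N : set T3, vect_open (s := s) N & N t0 /\ forall t, N t -> Small (f t).
  by move=> fs ft; apply: (smooth_at_continuous fs) => //; exact: Small_open.
have [N1 o1 [i1 P1]] := near1 _ _ (smooth_at_leib q1 q1) (leib_Log1 A A).
have [N2 o2 [i2 P2]] := near1 _ _ (smooth_at_leib q1 q2) (leib_Log1 A M).
have [N3 o3 [i3 P3]] := near1 _ _ (smooth_at_leib q3 q2) (leib_Log1 B M).
have [N4 o4 [i4 P4]] := near1 _ _ (smooth_at_leib q3 q3) (leib_Log1 B B).
have d1 := vect_open_preimage l1 (@Logdom_open R s A).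
have d2 := vect_open_preimage l2 (@Logdom_open R s M).
have d3 := vect_open_preimage l3 (@Logdom_open R s B).
exists ((N1 `&` N2 `&` (N3 `&` N4)) `&` ((fun t : T3 => t.1.1) @^-1` (@Logdom R s A) `&`
    ((fun t : T3 => t.1.2) @^-1` (@Logdom R s M) `&` (fun t : T3 => t.2) @^-1` (@Logdom R s B)))).
  by do ![apply: (@chart_openI _ _ (vect_atlas T3)) => //].
split; first by do ![split => //]; exact: Logdom1.
move=> t [[[n1 n2] [n3 n4]] [e1 [e2 e3]]]; split; split => //.
- exact: P1.
- exact: P2.
- exact: P3.
- exact: P4.
Qed.

(** Openness forces the projection to be onto on Lie algebras: a small multiple of
    Z has its exponential in the open image of the implementers near 1, and the
    logarithm of a preimage lies over that multiple. *)
Lemma lie_onto : right_implementing M -> forall Z : 'End(B),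
  even_map Z -> leibniz (smul B) Z Z Z -> exists X Y, lie_triple (M := M) X Y Z.
Proof.
move=> /right_implementingP ri Z Ze ZM.
have [W oW [W1 WP]] := log_good_nbhs.
have [N oN [N1 NP]] := ri W oW W1.
have [Q1 oQ1 [Q10 Q1N]] : exists2 Q1 : set 'End(B), vect_open (s := s) Q1 &
    Q1 0 /\ forall X, Q1 X -> N (Exp X).
  by apply: (smooth_at_continuous (Exp_smooth 0)) => //; rewrite Exp0.
have [||c c0 [cZ Zs]] := @vect_open_small_multiple _ (Q1 `&` @Small R s B) Z.
- by apply: (@chart_openI _ _ (vect_atlas 'End(B))) => //; exact: Small_open.
- by split => //; exact: Small0.
have lin a (X : 'End(B)) : even_map X -> leibniz (smul B) X X X ->
    even_map (a *: X) /\ leibniz (smul B) (a *: X) (a *: X) (a *: X).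
  move=> Xe XM; rewrite -[a *: X]addr0; split.
    by apply: even_linear => // i v _; rewrite zero_lfunE mem0v.
  exact: (leibnizP a XM (@leibniz0 _ _ _ _ _ _)).
have [cZe cZM] := lin c Z Ze ZM.
have aut : super_aut (Exp (c *: Z)).
  split; first exact: Exp_bij.
  apply: bij_alg_hom; [exact: Exp_bij|exact: even_Exp|exact: leibniz_Exp].
have [f [u [ti /WP[/= [fU uU gU] sm]]]] := NP _ aut (Q1N _ cZ).
have := lie_Log fU uU gU sm ti; rewrite Log_Exp // => li.
exists (c^-1 *: Log f), (c^-1 *: Log u).
have := lie_linear c^-1 li (lie0 M); rewrite !addr0.
by rewrite scalerA mulVf // scale1r.
Qed.

(** The section is g |-> Exp (S (Log g)), with S a linear section on Lie algebras,
    which exists by [lie_onto]. *)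
Lemma right_lift : right_implementing M ->
  exists (N : set 'End(B)) (f : 'End(B) -> 'End(A)) (u : 'End(B) -> 'End(M)),
  [/\ vect_open (s := s) N, N \1%VF,
    forall g, N g -> smooth_at (vect_atlas 'End(B)) (vect_atlas 'End(A)) f g,
    forall g, N g -> smooth_at (vect_atlas 'End(B)) (vect_atlas 'End(M)) u g &
    forall g, super_aut g -> N g -> implementers (M := M) (f g, u g, g)].
Proof.
move=> ri.
have [S SP] := @linear_choice k 'End(B) ('End(A) * 'End(M))%type
  (fun Z XY => lie_triple (M := M) XY.1 XY.2 Z) (lie0 M)
  (fun a e e' f f' => @lie_linear _ _ _ _ M a f.1 f.2 e f'.1 f'.2 e').
have [W oW [W1 WP]] := log_good_nbhs.
have inl : linear (fun g : 'End(B) => (0, 0, g) : T3).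
  by move=> a x y; congr (_, _, _); rewrite /= scaler0 addr0.
pose N := [set g : 'End(B) | W (\1%VF, \1%VF, g)].
have oN : vect_open (s := s) N.
  rewrite -[N]setTI.
  apply: (@chart_open_smooth_preimage _ _ _ (vect_atlas 'End(B)) (vect_atlas T3)
     setT (fun g => (\1%VF, \1%VF, g) : T3)) => //; first exact: chart_openT.
  move=> g _; pose c0 : T3 := (\1%VF, \1%VF, 0).
  have -> : (fun g => (\1%VF, \1%VF, g) : T3) = (fun g => (0, 0, g) + c0).
    by apply/funext => h; rewrite /c0 /GRing.add /= /add_pair /= !add0r addr0.
  apply: smooth_at_add; last exact: smooth_at_cst.
  exact/smooth_at_rlinear/linear_rlinear.
have l1 : linear (fun p : 'End(A) * 'End(M) => p.1) by [].
have l2 : linear (fun p : 'End(A) * 'End(M) => p.2) by [].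
have Ss g : N g -> smooth_at (vect_atlas 'End(B)) (vect_atlas ('End(A) * 'End(M))%type)
    (fun g => S (Log g)) g.
  by move=> /WP[[_ _ gU] _]; exact: smooth_at_lfun (Log_smooth gU).
exists N, (fun g => Exp (S (Log g)).1), (fun g => Exp (S (Log g)).2); split => //.
- move=> g /Ss s0; exact: (smooth_at_comp (smooth_at_linear l1 s0) (Exp_smooth _)).
- move=> g /Ss s0; exact: (smooth_at_comp (smooth_at_linear l2 s0) (Exp_smooth _)).
move=> g [gb [ge g1 gM]] /WP[/= [_ _ gU] [_ _ _ s4]].
have Le := even_Log gU ge.
have LM := equivariant_Log gU gU gU s4 gM.
have [|X [Y li]] := lie_onto ri Le; first exact: LM.
have li' : lie_triple (M := M) (S (Log g)).1 (S (Log g)).2 (Log g).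
  by apply: SP; exists (X, Y).
by have := lie_Exp li'; rewrite Exp_Log.
Qed.

End Bimodule.
End LocalLift.

(** * Smooth families of linear isomorphisms *)
Section SmoothInverse.
Variables (R : realType) (s : scalar_kind).
Notation k := (scalars R s).
Implicit Types V W : vectType k.

Lemma lfun_inv_unique V W (f : 'Hom(V, W)) (g : 'Hom(W, V)) :
  (g \o f = \1)%VF -> (f \o g = \1)%VF -> (f^-1)%VF = g.
Proof.
move=> gf fg; have fb := bij_lfun_inv gf fg.
by rewrite -[RHS]comp_lfun1l -(bij_lfunK fb) -comp_lfunA fg comp_lfun1r.
Qed.

Lemma lfun_inv_compV V W (Z : vectType k) (f : 'Hom(V, W)) (g : 'Hom(V, Z)) :
  bijective f -> bijective g -> ((f \o g^-1)^-1)%VF = (g \o f^-1)%VF.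
Proof.
move=> fb gb; apply: lfun_inv_unique; rewrite comp_lfunA -[X in (X \o _)%VF]comp_lfunA;
  by rewrite bij_lfunK // comp_lfun1r bij_lfunKV.
Qed.

Lemma End_inv_smooth V (g : 'End(V)) : bijective g ->
  smooth_at (vect_atlas 'End(V)) (vect_atlas 'End(V)) (fun f => f^-1%VF) g.
Proof.
move=> gb; pose N := [set f : 'End(V) | rmx f \in unitmx].
have oU : open [set Y : 'M[R]_(vdim V) | Y \in unitmx].
  exact: (@open_unitmx R).
have oN : chart_open (charts (vect_atlas 'End(V))) N.
  exact: rmx_preimage_open oU.
have gN : rmx g \in unitmx.
  have e : rmx g *m rmx (g^-1)%VF = 1%:M by rewrite -rmx_comp_lfun bij_lfunK ?rmx1.
  by case: (mulmx1_unit e).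
have := smooth_at_mx oU (@invmx_smooth R _) gN.
apply: (smooth_at_eq oN gN) => f fN; apply/esym.
have e : rmx (mxhom (invmx (rmx f)) : 'End(V)) = invmx (rmx f).
  apply: mxhomK => c; have fc := rmx_scalar f c.
  by rewrite -[LHS](mulKmx fN) !mulmxA -[_ *m rmx f *m _]mulmxA -fc -!mulmxA mulmxV ?mulmx1.
by apply: lfun_inv_unique; apply: rmx_inj; rewrite rmx_comp_lfun e rmx1 ?mulmxV ?mulVmx.
Qed.

(** Composition with the inverse at t reduces the claim to endomorphisms. *)
Lemma smooth_at_inv T (A : atlas R T) V W (f : T -> 'Hom(V, W)) t N :
  chart_open (charts A) N -> N t -> (forall x, N x -> bijective (f x)) ->
  smooth_at A (vect_atlas 'Hom(V, W)) f t ->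
  smooth_at A (vect_atlas 'Hom(W, V)) (fun x => (f x)^-1%VF) t.
Proof.
move=> oN Nt fb fs; pose L := (f t)^-1%VF.
have Lb : bijective L by apply: bij_lfunV; exact: fb.
have Ll : linear (fun h : 'Hom(V, W) => (L \o h)%VF).
  by move=> a h h'; rewrite comp_lfunDr -comp_lfunZr.
have Lr : linear (fun h : 'End(V) => (h \o L)%VF).
  by move=> a h h'; rewrite comp_lfunDl -comp_lfunZl.
have s1 := smooth_at_linear Ll fs.
have s2 := smooth_at_linear Lr (smooth_at_comp s1 (End_inv_smooth (bij_comp_lfun (fb t Nt) Lb))).
apply: (smooth_at_eq oN Nt) s2 => x /fb fxb; apply/esym/lfun_inv_unique.
  rewrite -comp_lfunA; apply: bij_lfunK; exact: bij_comp_lfun.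
apply/lfunP => w; apply: (bij_inj Lb); rewrite -(comp_lfunE L) !comp_lfunA.
by rewrite bij_lfunKV ?comp_lfun1l ?id_lfunE //; exact: bij_comp_lfun.
Qed.

End SmoothInverse.

(** * Local trivializations *)
Section LocalTrivializations.
Variables (R : realType) (s : scalar_kind) (X : manifold R).
Notation k := (scalars R s).
Notation AX := (structure_atlas (manifold_structure X)).
Implicit Types (U : set X) (V W : vectType k).

Lemma existT_inj (F : X -> vectType k) y (v w : F y) :
  existT (fun x => F x : Type) y v = existT (fun x => F x : Type) y w -> v = w.
Proof.
by move=> e; have := projT2_eq e; rewrite (Prop_irrelevance (projT1_eq e) erefl).
Qed.

Section OneBundle.
Variables (F : X -> vectType k) (AE : atlas R (total_space F)).

(** The same condition as [is_trivialization], on the atlas alone, so that it makes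
    sense before the total space is known to be Hausdorff and second countable. *)
Definition local_triv U V (t : forall x, 'Hom(F x, V)) :=
  chart_open (charts AX) U /\
  diffeo_on (charts AE) (charts (prod_atlas AX (vect_atlas V)))
    [set e | U (tag e)] [set p | U p.1]
    (fun e : total_space F => (tag e, t (tag e) (tagged e))).

Definition triv_inv V (t : forall x, 'Hom(F x, V)) (p : X * V) : total_space F :=
  existT (fun x => F x : Type) p.1 ((t p.1)^-1%VF p.2).

Lemma local_triv_open U V (t : forall x, 'Hom(F x, V)) :
  local_triv U t -> chart_open (charts AX) U.
Proof. by case. Qed.

Lemma local_triv_bij U V (t : forall x, 'Hom(F x, V)) y :
  local_triv U t -> U y -> bijective (t y).
Proof.
move=> [_ [g [fK gK _ _]]] Uy.
have ti : injective (t y).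
  move=> v v' e; have [_ e1] := fK (existT _ y v) Uy.
  have [_ e2] := fK (existT _ y v') Uy.
  by apply: existT_inj; rewrite -e1 -e2 /= e.
have ts w : exists v, t y v = w.
  have [_] := gK (y, w) Uy; case: (g (y, w)) => z v /= [ez].
  by subst z => <-; exists v.
pose h w := sval (cid (ts w)).
exists h => [v|w]; last exact: svalP (cid (ts w)).
by apply: ti; exact: svalP (cid (ts _)).
Qed.

Lemma local_triv_smooth U V (t : forall x, 'Hom(F x, V)) e :
  local_triv U t -> U (tag e) ->
  smooth_at AE (prod_atlas AX (vect_atlas V))
    (fun e : total_space F => (tag e, t (tag e) (tagged e))) e.
Proof. by move=> [_ [g [_ _ ts _]]] Ue; exact: smooth_on_at ts Ue. Qed.

Lemma local_triv_inv_smooth U V (t : forall x, 'Hom(F x, V)) p :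
  local_triv U t -> U p.1 ->
  smooth_at (prod_atlas AX (vect_atlas V)) AE (triv_inv t) p.
Proof.
move=> tt Up; have [oU [g [_ gK _ gs]]] := tt.
apply: (@smooth_at_eq _ _ _ _ _ g _ _ [set p | U p.1]) (smooth_on_at gs Up) => //.
  exact: smooth_on_open gs.
move=> [y v] /= Uy; have tb := local_triv_bij tt Uy.
have [_] := gK (y, v) Uy; case: (g (y, v)) => z w /= [ez].
subst z => e; congr existT; apply: (bij_inj tb).
by rewrite e -(comp_lfunE (t y)) bij_lfunKV // id_lfunE.
Qed.

Lemma triv_inv_in_fibre V (t : forall x, 'Hom(F x, V)) y v :
  bijective (t y) -> triv_inv t (y, t y v) = existT _ y v.
Proof.
move=> tb; congr existT; by rewrite /= -comp_lfunE bij_lfunK // id_lfunE.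
Qed.

Lemma local_triv_tag_smooth U V (t : forall x, 'Hom(F x, V)) e :
  local_triv U t -> U (tag e) -> smooth_at AE AX (fun e => tag e) e.
Proof.
move=> tt Ue; apply: (smooth_at_comp (g := fst) (local_triv_smooth tt Ue)).
exact: smooth_at_fst.
Qed.

Lemma local_trivP U V (t : forall x, 'Hom(F x, V)) :
  chart_open (charts AX) U -> (forall y, U y -> bijective (t y)) ->
  (forall e, U (tag e) -> smooth_at AE (prod_atlas AX (vect_atlas V))
    (fun e : total_space F => (tag e, t (tag e) (tagged e))) e) ->
  (forall p, U p.1 -> smooth_at (prod_atlas AX (vect_atlas V)) AE (triv_inv t) p) ->
  local_triv U t.
Proof.
move=> oU tb ts ts'; split => //; exists (triv_inv t); split.
- move=> [y v] /= Uy; split => //; exact: triv_inv_in_fibre (tb y Uy).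
- move=> [y v] /= Uy; split => //.
  by rewrite -comp_lfunE bij_lfunKV ?id_lfunE //; exact: tb.
- apply: smooth_at_on => //; apply: chart_openP => e Ue.
  have ps : smooth_at AE AX (fun e => tag e) e.
    by apply: (smooth_at_comp (g := fst) (ts e Ue)); exact: smooth_at_fst.
  by have [N oN [Ne NU]] := smooth_at_continuous ps oU Ue; exists N.
apply: smooth_at_on => //; apply: chart_openP => p Up.
have [N oN [Ne NU]] := smooth_at_continuous (@smooth_at_fst _ _ _ AX (vect_atlas V) p) oU Up.
by exists N.
Qed.

Lemma smooth_at_hom_pair (T : Type) (A : atlas R T) V W (f : T -> 'Hom(V, W)) (g : T -> V) t :
  smooth_at A (vect_atlas 'Hom(V, W)) f t -> smooth_at A (vect_atlas V) g t ->
  smooth_at A (vect_atlas W) (fun x => f x (g x)) t.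
Proof.
move=> fs gs.
apply: (smooth_at_comp (g := fun p : 'Hom(V, W) * V => p.1 p.2) (smooth_at_pair fs gs)).
apply: (@smooth_at_bilinear R s _ _ _ (fun (f : 'Hom(V, W)) v => f v)).
  by move=> w; apply: linear_rlinear => a h h'; rewrite add_lfunE scale_lfunE.
by move=> h; exact: hom_rlinear.
Qed.

Lemma smooth_at_hom (T : Type) (A : atlas R T) V W (f : T -> 'Hom(V, W)) t :
  (forall v, smooth_at A (vect_atlas W) (fun x => f x v) t) ->
  smooth_at A (vect_atlas 'Hom(V, W)) f t.
Proof.
move=> fs.
have -> : f = (fun x => \sum_i rank1 i (f x (vbasis {:V})`_i)).
  by apply/funext => x; exact: hom_rank1.
elim: (index_enum _) => [|i r IH].
  by under eq_fun do rewrite big_nil; exact: smooth_at_cst.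
under eq_fun do rewrite big_cons; apply: smooth_at_add => //.
by apply: (smooth_at_linear (@rank1_linear R s V W i)).
Qed.

Lemma transition_smooth U U' V V' (t : forall x, 'Hom(F x, V))
    (t' : forall x, 'Hom(F x, V')) y :
  local_triv U t -> local_triv U' t' -> U y -> U' y ->
  smooth_at AX (vect_atlas 'Hom(V, V')) (fun z => (t' z \o (t z)^-1)%VF) y.
Proof.
move=> tt tt' Uy U'y; apply: smooth_at_hom => v.
have cs : smooth_at AX (prod_atlas AX (vect_atlas V)) (fun z => (z, v)) y.
  by apply: smooth_at_pair; [exact: smooth_at_id|exact: smooth_at_cst].
have s1 := smooth_at_comp cs (local_triv_inv_smooth (p := (y, v)) tt Uy).
have s2 := smooth_at_comp s1 (local_triv_smooth (e := triv_inv t (y, v)) tt' U'y).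
have := smooth_at_comp s2 (@smooth_at_snd _ _ _ _ _ _).
congr smooth_at; apply/funext => z; by rewrite /= comp_lfunE.
Qed.

(** In given trivializations, t is the map (z, v) |-> (z, t z (t0 z)^-1 v), and
    smoothness of the inverse follows from [smooth_at_inv]. *)
Lemma local_triv_transition U V (t : forall x, 'Hom(F x, V)) :
  chart_open (charts AX) U -> (forall y, U y -> bijective (t y)) ->
  (forall y, U y -> exists (U0 : set X) (V0 : vectType k) (t0 : forall x, 'Hom(F x, V0)),
     [/\ local_triv U0 t0, U0 y &
       smooth_at AX (vect_atlas 'Hom(V0, V)) (fun z => (t z \o (t0 z)^-1)%VF) y]) ->
  local_triv U t.
Proof.
move=> oU tb loc; apply: local_trivP => //.
  move=> e Ue; have [U0 [V0 [t0 [tt0 U0e ts]]]] := loc _ Ue.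
  have t0s := local_triv_smooth tt0 U0e.
  have ps := local_triv_tag_smooth tt0 U0e.
  have t0s2 := smooth_at_comp t0s (@smooth_at_snd _ _ _ _ _ _).
  apply: smooth_at_pair => //.
  have := smooth_at_hom_pair (smooth_at_comp ps ts) t0s2.
  have [N oN [Ne NU]] := smooth_at_continuous ps (local_triv_open tt0) U0e.
  apply: (smooth_at_eq oN Ne) => -[z v] /NU /= U0z.
  rewrite comp_lfunE; congr (t z _).
  by rewrite -comp_lfunE bij_lfunK ?id_lfunE //; exact: local_triv_bij U0z.
move=> [y v] /= Uy; have [U0 [V0 [t0 [tt0 U0y ts0]]]] := loc _ Uy.
have oN : chart_open (charts AX) (U `&` U0).
  by apply: chart_openI => //; exact: local_triv_open tt0.
have ts : smooth_at AX (vect_atlas 'Hom(V, V0)) (fun z => (t0 z \o (t z)^-1)%VF) y.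
  have Nb z : (U `&` U0) z -> bijective (t z) /\ bijective (t0 z).
    by move=> [/tb tz U0z]; split => //; exact: local_triv_bij U0z.
  have inv := @smooth_at_inv _ _ _ _ _ _ _ y _ oN (conj Uy U0y) _ ts0.
  apply: (smooth_at_eq oN (conj Uy U0y)) (inv _) => z /Nb[tz t0z].
    exact: lfun_inv_compV.
  by apply: bij_comp_lfun => //; exact: bij_lfunV.
have q1 := @smooth_at_fst _ _ _ AX (vect_atlas V) (y, v).
have q2 := @smooth_at_snd _ _ _ AX (vect_atlas V) (y, v).
have q3 := smooth_at_pair q1 (smooth_at_hom_pair (smooth_at_comp q1 ts) q2).
have := smooth_at_comp q3 (local_triv_inv_smooth (p := (y, _)) tt0 U0y).
have [|N oN' [Ne NU]] := smooth_at_continuous q1 oN; first by split.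
apply: (smooth_at_eq oN' Ne) => -[z w] /NU /= [Uz U0z].
rewrite /triv_inv /=; congr existT.
rewrite comp_lfunE -(comp_lfunE (t0 z)^-1%VF) bij_lfunK ?id_lfunE //.
exact: local_triv_bij U0z.
Qed.

Lemma local_triv_twist U V V' (t : forall x, 'Hom(F x, V)) (h : X -> 'Hom(V, V')) U' :
  local_triv U t -> chart_open (charts AX) U' -> U' `<=` U ->
  (forall y, U' y -> bijective (h y)) ->
  (forall y, U' y -> smooth_at AX (vect_atlas 'Hom(V, V')) h y) ->
  local_triv U' (fun x => h x \o t x)%VF.
Proof.
move=> tt oU' UU' hb hs; apply: local_triv_transition => //.
  by move=> y U'y; apply: bij_comp_lfun; [exact: local_triv_bij tt (UU' _ U'y)|exact: hb].
move=> y U'y; exists U, V, t; split; [by []|exact: UU'|].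
apply: (@smooth_at_eq _ _ _ _ _ h _ _ U') => //; last exact: hs.
move=> z /UU' Uz; rewrite -comp_lfunA bij_lfunKV ?comp_lfun1r //.
exact: local_triv_bij Uz.
Qed.

Lemma local_triv_comp U V V' (t : forall x, 'Hom(F x, V)) (L : 'Hom(V, V')) :
  local_triv U t -> bijective L -> local_triv U (fun x => L \o t x)%VF.
Proof.
move=> tt Lb; apply: (local_triv_twist (h := cst L) tt) => //.
  exact: local_triv_open tt.
by move=> y _; exact: smooth_at_cst.
Qed.

Lemma local_triv_sub U V (t : forall x, 'Hom(F x, V)) U' :
  local_triv U t -> chart_open (charts AX) U' -> U' `<=` U -> local_triv U' t.
Proof.
move=> tt oU' UU'; have -> : t = (fun x => \1%VF \o t x)%VF.
  by apply: functional_extensionality_dep => x; rewrite comp_lfun1l.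
apply: (local_triv_twist (h := cst \1%VF) tt) => // y _; first exact: bij_lfun1.
exact: smooth_at_cst.
Qed.

End OneBundle.
End LocalTrivializations.

(** * Bundles from transition maps *)
Section BundleAtlas.
Variables (R : realType) (s : scalar_kind) (X : manifold R).
Notation k := (scalars R s).
Notation AX := (structure_atlas (manifold_structure X)).
Variables (F : X -> vectType k) (I : Type) (U : I -> set X) (V : I -> vectType k)
  (t : forall i x, 'Hom(F x, V i)).
Hypothesis U_open : forall i, chart_open (charts AX) (U i).
Hypothesis U_cover : forall x, exists i, U i x.
Hypothesis t_bij : forall i x, U i x -> bijective (t i x).
Hypothesis t_trans : forall i j x, U i x -> U j x ->
  smooth_at AX (vect_atlas 'Hom(V i, V j)) (fun z => (t j z \o (t i z)^-1)%VF) x.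

Definition bundle_charts : set (chart R (total_space F)) :=
  [set c | exists b i, charts AX b /\ c = trivialization_chart b (U i) (t i)].

Lemma bundle_charts_cover e : exists2 c, bundle_charts c & cdom c e.
Proof.
have [b Ab db] := charts_cover AX (tag e); have [i Ui] := U_cover (tag e).
by exists (trivialization_chart b (U i) (t i)) => //; exists b, i.
Qed.

Lemma bundle_chart_invE b i w :
  cinv (trivialization_chart b (U i) (t i)) w =
  triv_inv (t i) (cinv b (lsubmx w), vinv (rsubmx w)).
Proof. by []. Qed.

Lemma bundle_chart_mapE b i e :
  cmap (trivialization_chart b (U i) (t i)) e =
  row_mx (cmap b (tag e)) (vcrd (t i (tag e) (tagged e))).
Proof. by []. Qed.

Lemma bundle_chart_inv b i z (v : V i) : charts AX b -> U i z -> cdom b z ->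
  cinv (trivialization_chart b (U i) (t i)) (row_mx (cmap b z) (vcrd v)) =
  triv_inv (t i) (z, v).
Proof.
move=> Ab Uz dz; have [bK _] := chartsP Ab.
by rewrite bundle_chart_invE row_mxKl row_mxKr bK // vcrdK.
Qed.

Lemma bundle_chart_im b i (S : set X) : charts AX b -> S `<=` U i `&` cdom b ->
  cmap (trivialization_chart b (U i) (t i)) @` [set e | S (tag e)] =
  lsubmx @^-1` (cmap b @` S).
Proof.
move=> Ab SU; apply/seteqP; split => [_ [e Se <-]|w [z Sz ez]].
  by rewrite /preimage /= row_mxKl; exists (tag e).
have [Uz dz] := SU z Sz.
exists (triv_inv (t i) (z, vinv (rsubmx w))) => //.
rewrite bundle_chart_mapE -[tagged _]/((t i z)^-1%VF _) -[tag _]/z ez.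
rewrite -comp_lfunE bij_lfunKV ?id_lfunE; last exact: t_bij.
by rewrite vinvK hsubmxK.
Qed.

Lemma bundle_chartsP c : bundle_charts c -> is_chart c.
Proof.
move=> [b [i [Ab ->]]]; have [bK ob] := chartsP Ab; split.
  move=> [z v] [Uz dz]; rewrite bundle_chart_mapE bundle_chart_inv //.
  exact: (triv_inv_in_fibre v (t_bij Uz)).
have -> : cdom (trivialization_chart b (U i) (t i)) =
    [set e | (U i `&` cdom b) (tag e)] by [].
rewrite (bundle_chart_im Ab); last by [].
apply: open_comp; first by move=> x _; exact: linear_mx_continuous.
by rewrite setIC; exact: U_open.
Qed.

(** In two of the charts, the identity of the total space is the map G below. *)
Lemma bundle_charts_compatible c c' :
  bundle_charts c -> bundle_charts c' -> compatible c c'.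
Proof.
move=> [b [i [Ab ->]]] [b' [j [Ab' ->]]]; rewrite /compatible.
set ci := trivialization_chart b _ _; set cj := trivialization_chart b' _ _.
pose S := (U i `&` cdom b) `&` (U j `&` cdom b').
have -> : cdom ci `&` cdom cj = [set e | S (tag e)] by [].
have oS : open (cmap b @` S).
  have -> : S = cdom b `&` (U i `&` (U j `&` cdom b')).
    by rewrite /S [U i `&` _]setIC -setIA.
  apply: chart_openI => //; apply: chart_openI => //; exact: chart_open_dom.
rewrite /ci (bundle_chart_im Ab) => [|z [] //].
have oW : open (lsubmx @^-1` (cmap b @` S) : set 'rV[R]_(cdim b + vdim (V i))).
  by apply: open_comp => // x _; exact: linear_mx_continuous.
split => //; apply: smooth_local => w [z Sz ez].
have [[Uz dz] [Ujz djz]] := Sz.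
pose v : V i := vinv (rsubmx w).
pose G (p : X * V i) : X * V j := (p.1, (t j p.1 \o (t i p.1)^-1)%VF p.2).
have Gs : smooth_at (prod_atlas AX (vect_atlas (V i))) (prod_atlas AX (vect_atlas (V j))) G (z, v).
  have q1 := @smooth_at_fst _ _ _ AX (vect_atlas (V i)) (z, v).
  have q2 := @smooth_at_snd _ _ _ AX (vect_atlas (V i)) (z, v).
  apply: smooth_at_pair => //.
  apply: smooth_at_hom_pair q2.
  by have := smooth_at_comp q1 (t_trans Uz Ujz).
have Aci : charts (prod_atlas AX (vect_atlas (V i))) (prod_chart b (vect_chart (V i))).
  by exists b, (vect_chart (V i)).
have Acj : charts (prod_atlas AX (vect_atlas (V j))) (prod_chart b' (vect_chart (V j))).
  by exists b', (vect_chart (V j)).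
have [_ _ [P [oP Pw Pim Ps]]] := smooth_at_charts Gs Aci Acj (conj dz Logic.I) (conj djz Logic.I).
have we : row_mx (cmap b z) (vcrd v) = w by rewrite ez vinvK hsubmxK.
exists (P `&` lsubmx @^-1` (cmap b @` S)).
  by split; [rewrite -we|exists z].
apply: (smooth_eq _ _ (smooth_sub (@subIsetl _ _ _) Ps)); first exact: openI.
move=> y [Py [x Sx ex]]; have [[Ux dx] [Ujx djx]] := Sx.
have [bK _] := chartsP Ab.
have ye : y = row_mx (cmap b x) (vcrd (vinv (rsubmx y) : V i)).
  by rewrite ex vinvK hsubmxK.
rewrite [in RHS]ye /comp bundle_chart_inv // /G /= -ex bK //.
by rewrite comp_lfunE.
Qed.

Definition bundle_atlas : atlas R (total_space F) :=
  Atlas bundle_charts_cover bundle_chartsP bundle_charts_compatible.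

Lemma bundle_atlas_triv i : local_triv bundle_atlas (U i) (t i).
Proof.
apply: local_trivP => //; first by move=> y; exact: t_bij.
  move=> [y v] /= Uy; have [b Ab db] := charts_cover AX y; have [bK _] := chartsP Ab.
  have Ac : charts bundle_atlas (trivialization_chart b (U i) (t i)) by exists b, i.
  have [cK oc] := chartsP Ac.
  exists (trivialization_chart b (U i) (t i)), (prod_chart b (vect_chart (V i))).
  split => //; first by exists b, (vect_chart (V i)).
  split => //; eexists; split; first exact: oc.
  - by exists (existT _ y v).
  - by move=> _ [[z w] [/= Uz dz] <-]; exists (existT _ z w).
  apply: (@smooth_eq _ _ _ _ idfun) => //; last exact: smooth_linear_mx.
  by move=> _ [e de <-]; rewrite /comp cK.
move=> [y v] /= Uy; have [b Ab db] := charts_cover AX y; have [bK _] := chartsP Ab.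
have Ac : charts bundle_atlas (trivialization_chart b (U i) (t i)) by exists b, i.
exists (prod_chart b (vect_chart (V i))), (trivialization_chart b (U i) (t i)).
split => //; first by exists b, (vect_chart (V i)).
have oUb : open (cmap b @` (U i `&` cdom b)) by rewrite setIC; exact: U_open.
split => //; exists (lsubmx @^-1` (cmap b @` (U i `&` cdom b))); split.
- by apply: open_comp => // x _; exact: linear_mx_continuous.
- by rewrite /preimage /= row_mxKl; exists y.
- move=> w [z [Uz dz] ez]; exists (z, vinv (rsubmx w)) => //.
  rewrite -[LHS]/(row_mx (cmap b z) (vcrd (vinv (rsubmx w) : V i))).
  by rewrite vinvK ez hsubmxK.
apply: (@smooth_eq _ _ _ _ idfun) => //; last exact: smooth_linear_mx.
  by apply: open_comp => // x _; exact: linear_mx_continuous.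
move=> w [z [Uz dz] ez].
have -> : w = row_mx (cmap b z) (vcrd (vinv (rsubmx w) : V i)).
  by rewrite vinvK ez hsubmxK.
move: (vinv _) => v'.
have -> : (cmap (trivialization_chart b (U i) (t i)) \o triv_inv (t i) \o
    cinv (prod_chart b (vect_chart (V i)))) (row_mx (cmap b z) (vcrd v')) =
    cmap (trivialization_chart b (U i) (t i)) (triv_inv (t i)
     (cinv b (lsubmx (row_mx (cmap b z) (vcrd v'))),
      vinv (rsubmx (row_mx (cmap b z) (vcrd v'))))) by [].
rewrite row_mxKl row_mxKr bK // vcrdK bundle_chart_mapE.
rewrite -[tagged _]/((t i z)^-1%VF v') -[tag _]/z.
by rewrite -comp_lfunE bij_lfunKV ?id_lfunE //; exact: t_bij.
Qed.

End BundleAtlas.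

(** * The topology of a bundle *)
Section Boxes.
Variables (R : realType).

Definition rational_ball n (p : 'rV[rat]_n * nat) : set 'rV[R]_n :=
  ball (map_mx (@ratr R) p.1) (p.2.+1%:R^-1).

Lemma rational_ball_basis n (P : set 'rV[R]_n) x : open P -> P x ->
  exists p, rational_ball p x /\ rational_ball p `<=` P.
Proof.
move=> oP Px; have /nbhs_ballP[e e0 eP] := open_nbhs_nbhs (conj oP Px).
have e20 : 0 < e / 2 by rewrite divr_gt0.
have [m me] : exists m, m.+1%:R^-1 < e / 2.
  by have [m] := ltr_add_invr e20; rewrite add0r; exists m.
pose d : R := m.+1%:R^-1; have d0 : 0 < d by rewrite invr_gt0.
have q j : {q : rat | `|ratr q - x 0 j| < d}.
  apply: cid; have [|q] := @rat_in_itvoo R (x 0 j - d) (x 0 j + d).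
    by rewrite ltrD2l gtrN.
  rewrite in_itv /= => /andP[q1 q2]; exists q; rewrite ltr_norml.
  by rewrite ltrBlDl q2 ltrBrDl q1.
have qx : ball (map_mx (@ratr R) (\row_j sval (q j))) d x.
  split => // i j; rewrite !mxE ord1; exact: (svalP (q j)).
exists (\row_j sval (q j), m); split => // y qy.
apply: eP; apply: (@le_ball _ _ _ (d + d)); first by rewrite [e]splitr lerD ?ltW.
exact: ball_triangle (ball_sym qx) qy.
Qed.

Lemma vcrd_preimage_open (s : scalar_kind) (V : vectType (scalars R s))
    (P : set 'rV[R]_(vdim V)) : open P ->
  chart_open (charts (vect_atlas V)) [set v | P (vcrd v)].
Proof.
move=> oP c ->; have := chart_open_preimage (A := vect_atlas V) erefl oP erefl.
by congr (open (_ @` (_ `&` _))); apply/seteqP; split => // v [].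
Qed.

Lemma prod_open_box (s : scalar_kind) (T : Type) (A : atlas R T)
    (V : vectType (scalars R s)) (N : set (T * V)) y v :
  chart_open (charts (prod_atlas A (vect_atlas V))) N -> N (y, v) ->
  exists (S : set T) (Q : set 'rV[R]_(vdim V)),
  [/\ chart_open (charts A) S, open Q, S y /\ Q (vcrd v) &
     forall z w, S z -> Q (vcrd w) -> N (z, w)].
Proof.
move=> oN Nyv; have [c Ac dy] := charts_cover A y.
have Ap : charts (prod_atlas A (vect_atlas V)) (prod_chart c (vect_chart V)).
  by exists c, (vect_chart V).
have := oN _ Ap; set P := _ @` _ => oP.
have Pyv : P (row_mx (cmap c y) (vcrd v)) by exists (y, v).
have /nbhs_ballP[e e0 eP] := open_nbhs_nbhs (conj oP Pyv).
exists [set z | cdom c z /\ ball (cmap c y) e (cmap c z)], (ball (vcrd v) e); split.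
- apply: chart_open_preimage => //; exact: ball_open.
- exact: ball_open.
- by split; [split => //|]; exact: ballxx.
move=> z w [dz bz] bw.
have : ball (row_mx (cmap c y) (vcrd v)) e (row_mx (cmap c z) (vcrd w)).
  split => // i j; case: (split_ordP j) => l ->; rewrite ?row_mxEl ?row_mxEr.
    by case: bz => _ /(_ i l).
  by case: bw => _ /(_ i l).
move=> /eP[[z' w'] [[/= dz' _] Nzw'] /eq_row_mx[ez ew]].
have zz := chart_inj Ac dz' dz ez.
have ww := can_inj (@vcrdK R s V) ew.
by rewrite -zz -ww.
Qed.

End Boxes.

Section BundleTopology.
Variables (R : realType) (s : scalar_kind) (X : manifold R).
Notation k := (scalars R s).
Notation AX := (structure_atlas (manifold_structure X)).
Variables (F : X -> vectType k) (AE : atlas R (total_space F)).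
Hypothesis AE_triv : forall x, exists (U : set X) (V : vectType k)
  (t : forall y, 'Hom(F y, V)), U x /\ local_triv AE U t.

Lemma tag_smooth e : smooth_at AE AX (fun e : total_space F => tag e) e.
Proof.
by have [U [V [t [Ue tt]]]] := AE_triv (tag e); exact: local_triv_tag_smooth tt Ue.
Qed.

Lemma tag_preimage_open (W : set X) : chart_open (charts AX) W ->
  chart_open (charts AE) [set e : total_space F | W (tag e)].
Proof.
move=> oW; have := chart_open_smooth_preimage (@chart_openT _ _ AE) (fun e _ => tag_smooth e) oW.
by rewrite setTI.
Qed.

Lemma fibre_coordinate_open U (V : vectType k) (t : forall y, 'Hom(F y, V))
    (P : set 'rV[R]_(vdim V)) : local_triv AE U t -> open P ->
  chart_open (charts AE) [set e : total_space F | U (tag e) /\ P (vcrd (t (tag e) (tagged e)))].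
Proof.
move=> tt oP; have oU := tag_preimage_open (local_triv_open tt).
have fs (e : total_space F) : [set e : total_space F | U (tag e)] e -> smooth_at AE (vect_atlas V)
    (fun e : total_space F => t (tag e) (tagged e)) e.
  move=> Ue; apply: (smooth_at_comp (g := snd) (local_triv_smooth tt Ue)).
  exact: smooth_at_snd.
exact: (chart_open_smooth_preimage oU fs (vcrd_preimage_open oP)).
Qed.

(** Points of different fibres are separated in X, points of one fibre by their
    fibre coordinates. *)
Lemma bundle_hausdorff : hausdorff_space (atlas_space AE).
Proof.
rewrite open_hausdorff => e e' ee'.
have [yy'|yy'] := pselect (tag e = tag e'); last first.
  have hX := structure_hausdorff (s := manifold_structure X).
  have := hX; rewrite open_hausdorff => /(_ (tag e) (tag e')).
  case; first by apply/eqP.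
  move=> [P Q] /= [/set_mem Pe /set_mem Qe'] [oP oQ PQ].
  exists ([set e : total_space F | P (tag e)], [set e : total_space F | Q (tag e)]) => /=.
    by split; apply/mem_set.
  split; [exact: tag_preimage_open|exact: tag_preimage_open|].
  apply/eqP/seteqP; split => // z [Pz Qz].
  by move/eqP/seteqP: PQ => [/(_ (tag z)) + _]; apply.
have [U [V [t [Ue tt]]]] := AE_triv (tag e).
have Ue' : U (tag e') by rewrite -yy'.
have ne : vcrd (t (tag e) (tagged e)) != vcrd (t (tag e') (tagged e')).
  apply: contra ee' => /eqP/(can_inj (@vcrdK R s V)) h; apply/eqP.
  case: e e' yy' Ue {Ue'} h => [y v] [y' v'] /= e; subst y' => Uy.
  by move=> /(bij_inj (local_triv_bij tt Uy)) ->.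
have := @norm_hausdorff _ 'rV[R]_(vdim V); rewrite open_hausdorff => /(_ _ _ ne).
move=> [[P Q] /= [/set_mem Pe /set_mem Qe'] [oP oQ PQ]].
exists ([set e : total_space F | U (tag e) /\ P (vcrd (t (tag e) (tagged e)))],
        [set e : total_space F | U (tag e) /\ Q (vcrd (t (tag e) (tagged e)))]) => /=.
  by split; apply/mem_set.
split; [exact: (fibre_coordinate_open tt oP)|exact: (fibre_coordinate_open tt oQ)|].
apply/eqP/seteqP; split => // z [[_ Pz] [_ Qz]].
have : (P `&` Q) (vcrd (t (tag z) (tagged z))) by split.
by move/eqP: PQ => ->.
Qed.

(** Choose a trivialization for each member b of a countable base of X over which
    there is one. The products of base sets inside b with rational balls in its
    fibre coordinates are a countable base of the total space. *)
Lemma bundle_second_countable : @second_countable (atlas_space AE).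
Proof.
have [BX cBX [BXo BXb]] := @structure_second_countable R X (manifold_structure X).
have base (y : X) (S : set X) : chart_open (charts AX) S -> S y ->
    exists b, [/\ BX b, b y & b `<=` S].
  move=> oS Sy.
  have [|b [Bb by_] bS] := BXb (y : atlas_space AX) S; last by exists b.
  exact: (open_nbhs_nbhs (T := atlas_space AX) (conj oS Sy)).
pose good (b : set X) := exists (U : set X) (V : vectType k)
  (t : forall y, 'Hom(F y, V)), local_triv AE U t /\ b `<=` U.
have ch (b : set X) : {w : {V : vectType k & forall y, 'Hom(F y, V)} |
    good b -> exists U : set X, local_triv AE U (projT2 w) /\ b `<=` U}.
  apply: cid; have [[U [V [t [tt bU]]]]|ng] := pselect (good b).
    by exists (existT _ V t) => _; exists U.
  (* A default value, for those b that lie in no trivialization. *)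
  by exists (existT (fun V : vectType k => forall y, 'Hom(F y, V)) (k^o : vectType k) (fun=> 0)).
pose V b := projT1 (sval (ch b)); pose t b := projT2 (sval (ch b)).
pose N (b b' : set X) (p : 'rV[rat]_(vdim (V b)) * nat) : set (total_space F) :=
  [set e : total_space F | [/\ b (tag e), b' (tag e) &
     rational_ball p (vcrd (t b (tag e) (tagged e)))]].
exists (\bigcup_(b in BX `&` good) \bigcup_(b' in BX) range (N b b')).
  apply: bigcup_countable => [|b _].
    by apply: sub_countable cBX; apply: subset_card_le => b [].
  apply: bigcup_countable => // b' _.
  exact: sub_countable (card_image_le _ _) (countableP _).
have tP b : good b -> exists U : set X, local_triv AE U (t b) /\ b `<=` U.
  by move=> gb; exact: (svalP (ch b)).
split.
  move=> _ [b [Bb /tP[U [tt bU]]] [b' Bb' [p _ <-]]].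
  have ob : chart_open (charts AX) b by exact: BXo.
  have ob' : chart_open (charts AX) b' by exact: BXo.
  have oQ : open (@rational_ball R _ p) by apply: ball_open; rewrite invr_gt0.
  have := chart_openI (tag_preimage_open (chart_openI ob ob'))
    (fibre_coordinate_open tt oQ).
  rewrite atlas_openE; congr chart_open; apply/seteqP.
  by split => [e [[? ?] [? ?]]|e [? ? ?]] //; do !split => //; exact: bU.
move=> e W; rewrite nbhsE => -[W' [oW' W'e] W'W].
have [U0 [V0 [t0 [U0e tt0]]]] := AE_triv (tag e).
have [b [Bb be bU0]] := base _ _ (local_triv_open tt0) U0e.
have gb : good b by exists U0, V0, t0.
have [U [tt bU]] := tP b gb.
have Ue := bU _ be.
have oN : chart_open (charts (prod_atlas AX (vect_atlas (V b))))
    ([set p | U p.1] `&` triv_inv (t b) @^-1` W').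
  apply: (chart_open_smooth_preimage _ _ oW').
    have := chart_open_smooth_preimage (@chart_openT _ _ (prod_atlas AX (vect_atlas (V b))))
      (fun p _ => @smooth_at_fst _ _ _ AX (vect_atlas (V b)) p) (local_triv_open tt).
    by rewrite setTI.
  by move=> p; exact: local_triv_inv_smooth tt.
have eE : triv_inv (t b) (tag e, t b (tag e) (tagged e)) = e.
  rewrite triv_inv_in_fibre; first by case: (e).
  exact: local_triv_bij tt Ue.
have [|S [Q [oS oQ [Sy Qv] SQ]]] := prod_open_box (v := t b (tag e) (tagged e)) (y := tag e) oN.
  by split => //=; rewrite /preimage /= eE.
have [b' [Bb' b'y b'S]] := base _ _ oS Sy.
have [p [pv pQ]] := rational_ball_basis oQ Qv.
exists (N b b' p); first by split => //; exists b => //; exists b' => //; exists p.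
move=> e' [be' b'e' pe']; apply: W'W.
have [_] := SQ (tag e') (t b (tag e') (tagged e')) (b'S _ b'e') (pQ _ pe').
rewrite /preimage /= triv_inv_in_fibre; first by case: (e').
exact: local_triv_bij tt (bU _ be').
Qed.

Definition bundle_structure : smooth_structure R (total_space F) :=
  SmoothStructure bundle_hausdorff bundle_second_countable.

End BundleTopology.

(** * Maps between relative tensor products *)
Section RelativeTensorMaps.
Variables (R : realType) (s : scalar_kind).
Notation k := (scalars R s).

Section Functoriality.
Variables (A B C A' B' C' : super_algebra k).
Variables (M : bimodule A B) (N : bimodule B C).
Variables (M' : bimodule A' B') (N' : bimodule B' C').

(** The linear lift from the quotient makes this bilinear in (u, v), and so smooth;
    [rel_mapE] gives its values for compatible u and v. *)
Definition rel_map (u : 'Hom(M, M')) (v : 'Hom(N, N')) :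
    'Hom(rel_tensor M N, rel_tensor M' N') :=
  (rel_proj M' N' \o tmap u v \o quot_lift (balanced M N))%VF.

Lemma rel_map_lift u v q :
  rel_map u v q = rel_proj M' N' (tmap u v (quot_lift (balanced M N) q)).
Proof.
by rewrite /rel_map (comp_lfunE (_ \o _)%VF) (comp_lfunE (rel_proj M' N')).
Qed.

(** For these pairs the tensor product of u and v preserves balanced tensors, and
    [rel_map] is a functor. *)
Definition balanced_pair (u : 'Hom(M, M')) (g : 'Hom(B, B')) (v : 'Hom(N, N')) :=
  (forall m b, u (ract M b m) = ract M' (g b) (u m)) /\
  (forall b n, v (lact N b n) = lact N' (g b) (v n)).

Lemma tmap_balancing u g v b t : balanced_pair u g v ->
  tmap u v (balancing M N b t) = balancing M' N' (g b) (tmap u v t).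
Proof.
move=> [ug gv]; rewrite !balancingE linearB /= !tmap_comp !comp_lfun1l !comp_lfun1r.
have -> : (u \o ract M b = ract M' (g b) \o u)%VF.
  by apply/lfunP => m; rewrite !comp_lfunE ug.
have -> // : (v \o lact N b = lact N' (g b) \o v)%VF.
by apply/lfunP => n; rewrite !comp_lfunE gv.
Qed.

Lemma tmap_balanced u g v t : balanced_pair u g v ->
  t \in balanced M N -> tmap u v t \in balanced M' N'.
Proof.
move=> ugv /memv_sumP[ts tsP ->]; rewrite linear_sum.
apply: rpred_sum => i _; have /memv_imgP[w _ ->] := tsP i isT.
rewrite /= -[X in X \in _]/(tmap u v (balancing M N (vbasis fullv)`_i w)).
rewrite (tmap_balancing _ _ ugv); exact: mem_balancing.
Qed.

Lemma rel_mapE u g v t : balanced_pair u g v ->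
  rel_map u v (rel_proj M N t) = rel_proj M' N' (tmap u v t).
Proof.
move=> ugv; rewrite rel_map_lift; apply/eqP; rewrite -subr_eq0 -!linearB quot_proj_eq0.
by apply: (tmap_balanced ugv); rewrite -opprB rpredN quot_projK.
Qed.

Lemma rel_projP (q : rel_tensor M N) : exists t, q = rel_proj M N t.
Proof. by exists (quot_lift _ q); rewrite /rel_proj quot_liftK. Qed.

Lemma rel_map_linear_l v : linear (fun u => rel_map u v).
Proof.
move=> a u u'; apply/lfunP => q; rewrite add_lfunE scale_lfunE.
by rewrite !rel_map_lift tmapDl linearP.
Qed.

Lemma rel_map_linear_r u : linear (rel_map u).
Proof.
move=> a v v'; apply/lfunP => q; rewrite add_lfunE scale_lfunE.
by rewrite !rel_map_lift tmapDr linearP.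
Qed.

Lemma tmap_tproj u v e t : even_map u -> even_map v ->
  tmap u v (tproj M N e t) = tproj M' N' e (tmap u v t).
Proof.
move=> /even_mapP ue /even_mapP ve.
by rewrite /tproj !add_lfunE linearD /= !tmap_comp !ue !ve.
Qed.

Lemma rel_map_even u g v : balanced_pair u g v -> even_map u -> even_map v ->
  even_map (rel_map u v).
Proof.
move=> ugv ue ve i q /super_of_projP <-; have [t ->] := rel_projP q.
rewrite rel_gprojE (rel_mapE _ ugv) tmap_tproj //; apply/super_of_projP.
by rewrite rel_gprojE tproj_proj eqxx.
Qed.

Lemma rel_map_intertwines (f : 'Hom(A, A')) u g v (h : 'Hom(C, C')) :
  balanced_pair u g v ->
  (forall a m, u (lact M a m) = lact M' (f a) (u m)) ->
  (forall n c, v (ract N c n) = ract N' (h c) (v n)) ->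
  bimod_intertwines (M := rel_tensor M N) (M' := rel_tensor M' N') f (rel_map u v) h.
Proof.
move=> ugv fu vh; apply: intertwinesI => [a q|q c]; have [t ->] := rel_projP q.
  rewrite [lact _ a _]rel_lactE !(rel_mapE _ ugv) [RHS]rel_lactE.
  congr (rel_proj M' N' _); rewrite !tmap_comp comp_lfun1l comp_lfun1r.
  have -> // : (u \o lact M a = lact M' (f a) \o u)%VF.
  by apply/lfunP => m; rewrite !comp_lfunE fu.
rewrite [ract _ c _]rel_ractE !(rel_mapE _ ugv) [RHS]rel_ractE.
congr (rel_proj M' N' _); rewrite !tmap_comp comp_lfun1l comp_lfun1r.
have -> // : (v \o ract N c = ract N' (h c) \o v)%VF.
by apply/lfunP => n; rewrite !comp_lfunE vh.
Qed.

Lemma intertwines_balanced (f : 'Hom(A, A')) u g v (h : 'Hom(C, C')) :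
  alg_hom f -> alg_hom h ->
  bimod_intertwines f u g -> bimod_intertwines g v h -> balanced_pair u g v.
Proof.
move=> [_ f1 _] [_ h1 _] fug gvh; split; first by apply: (intertwines_ract fug).
by apply: (intertwines_lact gvh).
Qed.

End Functoriality.

Section Composition.
Variables (A B C A' B' C' A'' B'' C'' : super_algebra k).
Variables (M : bimodule A B) (N : bimodule B C).
Variables (M' : bimodule A' B') (N' : bimodule B' C').
Variables (M'' : bimodule A'' B'') (N'' : bimodule B'' C'').

Lemma rel_map_comp (u : 'Hom(M, M')) g (v : 'Hom(N, N')) (u' : 'Hom(M', M'')) g'
    (v' : 'Hom(N', N'')) : balanced_pair u g v -> balanced_pair u' g' v' ->
  (rel_map u' v' \o rel_map u v)%VF = rel_map (u' \o u)%VF (v' \o v)%VF.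
Proof.
move=> ugv ugv'; have ugv'' : balanced_pair (u' \o u)%VF (g' \o g)%VF (v' \o v)%VF.
  split=> [m b|b n]; rewrite !comp_lfunE.
    by rewrite ugv.1 ugv'.1.
  by rewrite ugv.2 ugv'.2.
apply/lfunP => q; have [t ->] := rel_projP q.
by rewrite comp_lfunE (rel_mapE _ ugv) (rel_mapE _ ugv') (rel_mapE _ ugv'') tmap_comp.
Qed.

Lemma rel_map1 : rel_map (\1%VF : 'End(M)) (\1%VF : 'End(N)) = \1%VF.
Proof.
have b1 : balanced_pair (\1%VF : 'End(M)) \1%VF (\1%VF : 'End(N)).
  by split=> *; rewrite !id_lfunE.
apply/lfunP => q; have [t ->] := rel_projP q.
by rewrite (rel_mapE _ b1) id_lfunE tmap1.
Qed.

End Composition.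
End RelativeTensorMaps.

Section RelativeTensorInverse.
Variables (R : realType) (s : scalar_kind).
Notation k := (scalars R s).
Variables (A B C A' B' C' : super_algebra k).
Variables (M : bimodule A B) (N : bimodule B C).
Variables (M' : bimodule A' B') (N' : bimodule B' C').

Lemma balanced_pairV (u : 'Hom(M, M')) (g : 'Hom(B, B')) (v : 'Hom(N, N')) :
  bijective u -> bijective g -> bijective v -> balanced_pair u g v ->
  balanced_pair (u^-1)%VF (g^-1)%VF (v^-1)%VF.
Proof.
move=> ub gb vb [ug gv]; split=> [m b|b n].
  apply: (bij_inj ub); rewrite ug -!(comp_lfunE u) -(comp_lfunE g).
  by rewrite !bij_lfunKV // !id_lfunE.
apply: (bij_inj vb); rewrite gv -!(comp_lfunE v) -(comp_lfunE g).
by rewrite !bij_lfunKV // !id_lfunE.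
Qed.

Lemma rel_mapK (u : 'Hom(M, M')) (g : 'Hom(B, B')) (v : 'Hom(N, N')) :
  bijective u -> bijective g -> bijective v -> balanced_pair u g v ->
  (rel_map u^-1 v^-1 \o rel_map u v = \1)%VF.
Proof.
move=> ub gb vb ugv; rewrite (rel_map_comp ugv (balanced_pairV ub gb vb ugv)).
by rewrite !bij_lfunK // rel_map1.
Qed.

Lemma rel_mapKV (u : 'Hom(M, M')) (g : 'Hom(B, B')) (v : 'Hom(N, N')) :
  bijective u -> bijective g -> bijective v -> balanced_pair u g v ->
  (rel_map u v \o rel_map u^-1 v^-1 = \1)%VF.
Proof.
move=> ub gb vb ugv; rewrite (rel_map_comp (balanced_pairV ub gb vb ugv) ugv).
by rewrite !bij_lfunKV // rel_map1.
Qed.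

Lemma rel_map_bij (u : 'Hom(M, M')) (g : 'Hom(B, B')) (v : 'Hom(N, N')) :
  bijective u -> bijective g -> bijective v -> balanced_pair u g v ->
  bijective (rel_map u v).
Proof.
move=> ub gb vb ugv; exact: bij_lfun_inv (rel_mapK ub gb vb ugv) (rel_mapKV ub gb vb ugv).
Qed.

Lemma smooth_at_rel_map T (D : atlas R T) (u : T -> 'Hom(M, M')) (v : T -> 'Hom(N, N')) t :
  smooth_at D (vect_atlas 'Hom(M, M')) u t ->
  smooth_at D (vect_atlas 'Hom(N, N')) v t ->
  smooth_at D (vect_atlas 'Hom(rel_tensor M N, rel_tensor M' N'))
    (fun x => rel_map (u x) (v x)) t.
Proof.
move=> us vs; apply: (smooth_at_comp
  (g := fun p : 'Hom(M, M') * 'Hom(N, N') => rel_map p.1 p.2) (smooth_at_pair us vs)).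
apply: (@smooth_at_bilinear R s _ _ _ (fun u v => rel_map u v)).
  by move=> w; apply: linear_rlinear; exact: rel_map_linear_l.
by move=> w; apply: linear_rlinear; exact: rel_map_linear_r.
Qed.

Lemma tmap_comp_lfun (V V' V'' W W' W'' : vectType k) (f : 'Hom(V, V'))
    (f' : 'Hom(V', V'')) (g : 'Hom(W, W')) (g' : 'Hom(W', W'')) :
  (tmap f' g' \o tmap f g)%VF = tmap (f' \o f)%VF (g' \o g)%VF.
Proof. by apply/lfunP => t; rewrite comp_lfunE tmap_comp. Qed.

Lemma tmap_lfun1 (V W : vectType k) :
  tmap (\1%VF : 'End(V)) (\1%VF : 'End(W)) = \1%VF.
Proof. by apply/lfunP => t; rewrite tmap1 id_lfunE. Qed.

Lemma tmap_bij (V V' W W' : vectType k) (f : 'Hom(V, V')) (g : 'Hom(W, W')) :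
  bijective f -> bijective g -> bijective (tmap f g).
Proof.
move=> fb gb; apply: (bij_lfun_inv (g := tmap f^-1 g^-1));
  by rewrite tmap_comp_lfun ?bij_lfunK ?bij_lfunKV ?tmap_lfun1.
Qed.

Lemma tmap_inv (V V' W W' : vectType k) (f : 'Hom(V, V')) (g : 'Hom(W, W')) :
  bijective f -> bijective g -> ((tmap f g)^-1)%VF = tmap f^-1 g^-1.
Proof.
by move=> fb gb; apply: lfun_inv_unique;
  rewrite tmap_comp_lfun ?bij_lfunK ?bij_lfunKV ?tmap_lfun1.
Qed.

Lemma smooth_at_tmap (V V' W W' : vectType k) T (D : atlas R T)
    (u : T -> 'Hom(V, V')) (v : T -> 'Hom(W, W')) t :
  smooth_at D (vect_atlas 'Hom(V, V')) u t ->
  smooth_at D (vect_atlas 'Hom(W, W')) v t ->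
  smooth_at D (vect_atlas 'Hom(tensor V W, tensor V' W')) (fun x => tmap (u x) (v x)) t.
Proof.
move=> us vs; apply: (smooth_at_comp
  (g := fun p : 'Hom(V, V') * 'Hom(W, W') => tmap p.1 p.2) (smooth_at_pair us vs)).
apply: (@smooth_at_bilinear R s _ _ _ (fun u v => tmap u v)).
  by move=> w; apply: linear_rlinear => a f g; apply/lfunP => x;
    rewrite tmapDl add_lfunE scale_lfunE.
by move=> w; apply: linear_rlinear => a f g; apply/lfunP => x;
  rewrite tmapDr add_lfunE scale_lfunE.
Qed.

End RelativeTensorInverse.

(** * Implementers of the relative tensor product *)
Section ImplementingTensor.
Variables (R : realType) (s : scalar_kind).
Notation k := (scalars R s).
Variables (A B C : super_algebra k) (M : bimodule A B) (N : bimodule B C).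
Notation TM := ('End(A) * 'End(M) * 'End(B))%type.
Notation TN := ('End(B) * 'End(N) * 'End(C))%type.
Notation Q := (rel_tensor M N).
Notation TQ := ('End(A) * 'End(Q) * 'End(C))%type.

Lemma implementers_rel (f : 'End(A)) (u : 'End(M)) (g : 'End(B)) (v : 'End(N)) (h : 'End(C)) :
  implementers (M := M) (f, u, g) -> implementers (M := N) (g, v, h) ->
  implementers (M := Q) (f, rel_map u v, h).
Proof.
move=> [/= fa ga ub ue ui] [/= _ ha vb ve vi].
have ugv := intertwines_balanced fa.2 ha.2 ui vi.
split => //=.
- by apply: rel_map_bij ugv => //; case: ga.
- exact: rel_map_even ugv ue ve.
apply: (rel_map_intertwines ugv).
  by case: ga => _ [_ g1 _]; apply: intertwines_lact ui g1.
move=> n c; case: ga => _ [_ g1 _]; exact: (intertwines_ract vi g1).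
Qed.

(** An implementer of M and one of N over the same automorphism g combine to an
    implementer of the tensor product. This is the continuity at the identity of
    the combination; g is forgotten, since only u and v enter [rel_map]. *)
Lemma rel_nbhs (W : set TQ) : vect_open (s := s) W -> W (\1%VF, \1%VF, \1%VF) ->
  exists (S : set TM) (P : set TN),
  [/\ vect_open (s := s) S, vect_open (s := s) P,
     S (\1%VF, \1%VF, \1%VF) /\ P (\1%VF, \1%VF, \1%VF) &
     forall t t', S t -> P t' -> W (t.1.1, rel_map t.1.2 t'.1.2, t'.2)].
Proof.
move=> oW W1.
pose G (p : TM * TN) : TQ := (p.1.1.1, rel_map p.1.1.2 p.2.1.2, p.2.2).
pose D := prod_atlas (vect_atlas TM) (vect_atlas TN).
have Gs p : smooth_at D (vect_atlas TQ) G p.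
  have q1 := @smooth_at_fst _ _ _ (vect_atlas TM) (vect_atlas TN) p.
  have q2 := @smooth_at_snd _ _ _ (vect_atlas TM) (vect_atlas TN) p.
  have fs : smooth_at D (vect_atlas 'End(A)) (fun p => p.1.1.1) p.
    by apply: (@smooth_at_linear _ _ _ _ _ _ (fun t : TM => t.1.1)) q1.
  have us : smooth_at D (vect_atlas 'End(M)) (fun p => p.1.1.2) p.
    by apply: (@smooth_at_linear _ _ _ _ _ _ (fun t : TM => t.1.2)) q1.
  have vs : smooth_at D (vect_atlas 'End(N)) (fun p => p.2.1.2) p.
    by apply: (@smooth_at_linear _ _ _ _ _ _ (fun t : TN => t.1.2)) q2.
  have hs : smooth_at D (vect_atlas 'End(C)) (fun p => p.2.2) p.
    by apply: (@smooth_at_linear _ _ _ _ _ _ (fun t : TN => t.2)) q2.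
  have ws := smooth_at_rel_map us vs.
  have l1 : linear (fun f : 'End(A) => (f, 0, 0) : TQ).
    by move=> a x y; congr (_, _, _); rewrite /= scaler0 addr0.
  have l2 : linear (fun f : 'End(Q) => (0, f, 0) : TQ).
    by move=> a x y; congr (_, _, _); rewrite /= scaler0 addr0.
  have l3 : linear (fun f : 'End(C) => (0, 0, f) : TQ).
    by move=> a x y; congr (_, _, _); rewrite /= scaler0 addr0.
  have -> : G = (fun p => (p.1.1.1, 0, 0) + (0, rel_map p.1.1.2 p.2.1.2, 0) + (0, 0, p.2.2)).
    by apply/funext => p'; congr (_, _, _); rewrite /= ?addr0 ?add0r.
  apply: smooth_at_add; last exact: smooth_at_linear l3 hs.
  by apply: smooth_at_add; [exact: smooth_at_linear l1 fs|exact: smooth_at_linear l2 ws].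
have oN : chart_open (charts D) (G @^-1` W).
  have := chart_open_smooth_preimage (@chart_openT _ _ D) (fun p _ => Gs p) oW.
  by rewrite setTI.
have [|S [P [oS oP [S1 P1] SP]]] := prod_open_box (y := (\1%VF, \1%VF, \1%VF) : TM)
  (v := (\1%VF, \1%VF, \1%VF) : TN) oN.
  by rewrite /preimage /G /= rel_map1.
exists S, [set t | P (vcrd t)]; split; [by []|exact: vcrd_preimage_open|by []|].
by move=> t t' St Pt'; exact: SP.
Qed.

(** Lift an automorphism f of A near the identity to an implementer (f, u, g) of M
    such that g is near the identity, and then g to an implementer (g, v, h) of
    N; both can be chosen near the identity. The other side is symmetric. *)
Lemma implementing_rel_tensor :
  implementing M -> implementing N -> implementing Q.
Proof.
move=> [/left_implementingP Ml /right_implementingP Mr].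
move=> [/left_implementingP Nl /right_implementingP Nr]; split.
  apply/left_implementingP => W oW W1.
  have [S [P [oS oP [S1 P1] SP]]] := rel_nbhs oW W1.
  have [NB oNB [NB1 NBP]] := Nl P oP P1.
  have l3 : linear (fun t : TM => t.2) by [].
  have oS' : vect_open (s := s) (S `&` (fun t : TM => t.2) @^-1` NB).
    by apply: (@chart_openI _ _ (vect_atlas TM)) => //; exact: vect_open_preimage l3 oNB.
  have [NA oNA [NA1 NAP]] := Ml _ oS' (conj S1 NB1).
  exists NA => //; split => // f fa NAf.
  have [u [g [fug [Sfug NBg]]]] := NAP f fa NAf.
  have [v [h [gvh Pgvh]]] := NBP g (let: And5 _ ga _ _ _ := fug in ga) NBg.
  exists (rel_map u v), h; split; first exact: implementers_rel fug gvh.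
  exact: SP Sfug Pgvh.
apply/right_implementingP => W oW W1.
have [S [P [oS oP [S1 P1] SP]]] := rel_nbhs oW W1.
have [NB oNB [NB1 NBP]] := Mr S oS S1.
have l1 : linear (fun t : TN => t.1.1) by [].
have oP' : vect_open (s := s) (P `&` (fun t : TN => t.1.1) @^-1` NB).
  by apply: (@chart_openI _ _ (vect_atlas TN)) => //; exact: vect_open_preimage l1 oNB.
have [NC oNC [NC1 NCP]] := Nr _ oP' (conj P1 NB1).
exists NC => //; split => // h ha NCh.
have [g [v [gvh [Pgvh NBg]]]] := NCP h ha NCh.
have [f [u [fug Sfug]]] := NBP g (let: And5 ga _ _ _ _ := gvh in ga) NBg.
exists f, (rel_map u v); split; first exact: implementers_rel fug gvh.
exact: SP Sfug Pgvh.
Qed.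

End ImplementingTensor.

(** * Trivializations of bimodule bundles *)
Section RelativeTensorBundle.
Variables (R : realType) (s : scalar_kind) (X : manifold R).
Notation k := (scalars R s).
Notation AX := (structure_atlas (manifold_structure X)).

Section OneBundle.
Variables (A B : algebra_bundle s X) (M : bimodule_bundle A B).

Definition bimod_triv (A0 B0 : super_algebra k) (M0 : bimodule A0 B0) (U : set X)
    (phi : forall y, 'Hom(A y, A0)) (u : forall y, 'Hom(M y, M0))
    (psi : forall y, 'Hom(B y, B0)) : Prop :=
  [/\ local_triv (structure_atlas (algebra_structure A)) U phi,
      local_triv (structure_atlas (bimodule_structure M)) U u &
      local_triv (structure_atlas (algebra_structure B)) U psi] /\
  forall y, U y -> [/\ alg_hom (phi y), even_map (u y), alg_hom (psi y) &
    bimod_intertwines (phi y) (u y) (psi y)].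

Lemma bimod_triv_sub (A0 B0 : super_algebra k) (M0 : bimodule A0 B0) (U U' : set X)
    (phi : forall y, 'Hom(A y, A0)) (u : forall y, 'Hom(M y, M0))
    (psi : forall y, 'Hom(B y, B0)) : bimod_triv U phi u psi ->
  chart_open (charts AX) U' -> U' `<=` U -> bimod_triv U' phi u psi.
Proof.
move=> [[tphi tu tpsi] h] oU' UU'; split; last by move=> y /UU'; exact: h.
by split; [exact: local_triv_sub tphi _ _|exact: local_triv_sub tu _ _|
  exact: local_triv_sub tpsi _ _].
Qed.

Lemma bimod_triv_at x : exists (U : set X) (phi : forall y, 'Hom(A y, A x))
    (u : forall y, 'Hom(M y, M x)) (psi : forall y, 'Hom(B y, B x)),
  [/\ U x, bimod_triv U phi u psi, phi x = \1%VF & psi x = \1%VF].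
Proof.
have [U [A0 [B0 [M0 [phi [u [psi [Ux [[tphi hphi] [tu eu] [tpsi hpsi] i]]]]]]]]] :=
  bimodule_bundleP M x.
have phib := local_triv_bij tphi Ux; have ub := local_triv_bij tu Ux.
have psib := local_triv_bij tpsi Ux; have oU := local_triv_open tphi.
exists U, (fun y => (phi x)^-1 \o phi y)%VF, (fun y => (u x)^-1 \o u y)%VF,
  (fun y => (psi x)^-1 \o psi y)%VF; split => //;
  try exact: bij_lfunK.
split=> [|y Uy]; first by split; apply: local_triv_comp => //;
  first [exact: tphi|exact: tu|exact: tpsi|exact: bij_lfunV].
split.
- by apply: alg_hom_comp; [exact: hphi|apply: alg_homV => //; exact: hphi].
- by apply: even_map_comp; [exact: eu|apply: even_mapV => //; exact: eu].
- by apply: alg_hom_comp; [exact: hpsi|apply: alg_homV => //; exact: hpsi].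
- by apply: intertwines_comp (i y Uy) _; apply: intertwinesV => //; exact: i.
Qed.

(** The two trivializations of B differ by a smooth family tau of automorphisms of
    B x which is the identity at x. Lift it to implementers of M x and compose the
    trivialization of M with the lift. *)
Lemma bimod_triv_twist x (U1 U2 : set X) (phi : forall y, 'Hom(A y, A x))
    (u : forall y, 'Hom(M y, M x)) (psi psi' : forall y, 'Hom(B y, B x)) :
  right_implementing (M x) -> bimod_triv U1 phi u psi ->
  local_triv (structure_atlas (algebra_structure B)) U2 psi' ->
  (forall y, U2 y -> alg_hom (psi' y)) ->
  U1 x -> U2 x -> psi x = \1%VF -> psi' x = \1%VF ->
  exists (U : set X) (phi' : forall y, 'Hom(A y, A x)) (u' : forall y, 'Hom(M y, M x)),
  [/\ U x, U `<=` U2 & bimod_triv U phi' u' psi'].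
Proof.
move=> Mr [[tphi tu tpsi] h] tpsi' hpsi' U1x U2x psix psix'.
have [N [f [g [oN N1 fs gs fgP]]]] := right_lift Mr.
pose tau z : 'End(B x) := (psi' z \o (psi z)^-1)%VF.
have taus z : U1 z -> U2 z -> smooth_at AX (vect_atlas 'End(B x)) tau z.
  by move=> U1z U2z; exact: transition_smooth tpsi tpsi' U1z U2z.
pose U := (U1 `&` U2) `&` tau @^-1` N.
have oU : chart_open (charts AX) U.
  apply: (@chart_open_smooth_preimage _ _ _ AX (vect_atlas 'End(B x))) => //.
    by apply: chart_openI; [exact: local_triv_open tphi|exact: local_triv_open tpsi'].
  by move=> z [U1z U2z]; exact: taus.
have aut z : U z -> super_aut (tau z).
  move=> [[U1z U2z] _]; have psib := local_triv_bij tpsi U1z.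
  have [_ _ hpsi _] := h z U1z; split.
    by apply: bij_comp_lfun; [exact: bij_lfunV|exact: local_triv_bij tpsi' U2z].
  by apply: alg_hom_comp; [exact: alg_homV|exact: hpsi'].
have imp z : U z -> implementers (M := M x) (f (tau z), g (tau z), tau z).
  by move=> Uz; apply: fgP; [exact: aut|case: Uz].
have tauK z : U z -> (tau z \o psi z)%VF = psi' z.
  move=> [[U1z _] _]; rewrite -comp_lfunA bij_lfunK ?comp_lfun1r //.
  exact: local_triv_bij tpsi U1z.
exists U, (fun z => f (tau z) \o phi z)%VF, (fun z => g (tau z) \o u z)%VF.
have taux : tau x = \1%VF.
  rewrite /tau psix psix' comp_lfun1l; apply: lfun_inv_unique; exact: comp_lfun1l.
split; [by split; rewrite // /preimage /= taux|by move=> z [[]]|].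
split=> [|z Uz].
  split; last by apply: local_triv_sub tpsi' oU _ => z [[]].
    apply: (local_triv_twist tphi oU) => [z [[]]||] //.
      by move=> z /imp [[]].
    move=> z [[U1z U2z] Nz]; apply: smooth_at_comp (taus z U1z U2z) _; exact: fs.
  apply: (local_triv_twist tu oU) => [z [[]]||] //.
    by move=> z /imp [].
  move=> z [[U1z U2z] Nz]; apply: smooth_at_comp (taus z U1z U2z) _; exact: gs.
have [[U1z U2z] _] := Uz; have [hphi eu hpsi i] := h z U1z.
have [/= [_ fh] _ _ ge ig] := imp z Uz; split.
- exact: alg_hom_comp.
- exact: even_map_comp.
- exact: hpsi'.
- by rewrite -(tauK z Uz); exact: intertwines_comp i ig.
Qed.

End OneBundle.

Section TwoBundles.
Variables (A B C : algebra_bundle s X) (M : bimodule_bundle A B)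
  (N : bimodule_bundle B C).
Notation TF := (fun x => tensor (M x) (N x)).
Notation QF := (rel_tensor_fibre M N).

(** * The fibrewise tensor product over k *)

(** The index set of the atlas of the fibrewise tensor product: all pairs of
    trivializations of M and N over the same set. *)
Record pair_triv := PairTriv {
  pt_dom : set X;
  pt_V : vectType k;
  pt_W : vectType k;
  pt_u : forall y, 'Hom(M y, pt_V);
  pt_v : forall y, 'Hom(N y, pt_W);
  pt_uP : local_triv (structure_atlas (bimodule_structure M)) pt_dom pt_u;
  pt_vP : local_triv (structure_atlas (bimodule_structure N)) pt_dom pt_v }.

Definition pt_map (p : pair_triv) y := tmap (pt_u p y) (pt_v p y).

Lemma pt_open p : chart_open (charts AX) (pt_dom p).
Proof. exact: local_triv_open (pt_uP p). Qed.

Lemma pt_cover x : exists p, pt_dom p x.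
Proof.
have [U [phi [u [psi [Ux [[_ tu _] _] _ _]]]]] := bimod_triv_at M x.
have [V [chi [v [xi [Vx [[_ tv _] _] _ _]]]]] := bimod_triv_at N x.
have oUV : chart_open (charts AX) (U `&` V).
  by apply: chart_openI; [exact: local_triv_open tu|exact: local_triv_open tv].
have tu' := local_triv_sub tu oUV (@subIsetl _ _ _).
have tv' := local_triv_sub tv oUV (@subIsetr _ _ _).
by exists (PairTriv tu' tv').
Qed.

Lemma pt_bij p x : pt_dom p x -> bijective (pt_map p x).
Proof.
move=> px; apply: tmap_bij; first exact: local_triv_bij (pt_uP p) px.
exact: local_triv_bij (pt_vP p) px.
Qed.

Lemma pt_trans p q x : pt_dom p x -> pt_dom q x ->
  smooth_at AX (vect_atlas 'Hom(tensor (pt_V p) (pt_W p), tensor (pt_V q) (pt_W q)))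
    (fun z => (pt_map q z \o (pt_map p z)^-1)%VF) x.
Proof.
move=> px qx; have oN := chart_openI (@pt_open p) (@pt_open q).
apply: (smooth_at_eq oN (conj px qx)); last apply: smooth_at_tmap.
- move=> z [pz qz]; rewrite tmap_inv; first by rewrite tmap_comp_lfun.
    exact: local_triv_bij (pt_uP p) pz.
  exact: local_triv_bij (pt_vP p) pz.
- exact: transition_smooth (pt_uP p) (pt_uP q) px qx.
- exact: transition_smooth (pt_vP p) (pt_vP q) px qx.
Qed.

Definition tensor_atlas : atlas R (total_space TF) :=
  bundle_atlas pt_open pt_cover pt_bij pt_trans.

Lemma tensor_atlasE : @tensor_charts R s X A B C M N = charts tensor_atlas.
Proof.
apply/seteqP; split=> [c [b [U [V [W [u [v [bX tu tv ->]]]]]]]|c [b [p [bX ->]]]].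
  by exists b, (PairTriv tu tv).
exists b, (pt_dom p), (pt_V p), (pt_W p), (pt_u p), (pt_v p); split => //.
  exact: pt_uP.
exact: pt_vP.
Qed.

Lemma tensor_triv p : local_triv tensor_atlas (pt_dom p) (pt_map p).
Proof. exact: bundle_atlas_triv. Qed.

(** * Common trivializations *)

(** Trivializations of M and of N that agree on B; only for these does the tensor
    product of the fibre maps descend to the relative tensor product. *)
Record common_triv := CommonTriv {
  ct_A : super_algebra k;
  ct_B : super_algebra k;
  ct_C : super_algebra k;
  ct_M : bimodule ct_A ct_B;
  ct_N : bimodule ct_B ct_C;
  ct_dom : set X;
  ct_phi : forall y, 'Hom(A y, ct_A);
  ct_u : forall y, 'Hom(M y, ct_M);
  ct_psi : forall y, 'Hom(B y, ct_B);
  ct_v : forall y, 'Hom(N y, ct_N);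
  ct_chi : forall y, 'Hom(C y, ct_C);
  ct_left : bimod_triv ct_dom ct_phi ct_u ct_psi;
  ct_right : bimod_triv ct_dom ct_psi ct_v ct_chi }.

Hypothesis M_right : forall x, right_implementing (M x).

Lemma ct_cover x : exists c, ct_dom c x.
Proof.
have [U1 [phi [u [psi [U1x tM _ psix]]]]] := bimod_triv_at M x.
have [U2 [psi' [v [chi [U2x tN psix' _]]]]] := bimod_triv_at N x.
have [[tpsi _ _] hpsi] := tN.
have [|U [phi' [u' [Ux U2U tM']]]] := bimod_triv_twist (@M_right x) tM tpsi _ U1x U2x psix psix'.
  by move=> y /hpsi[].
have oU : chart_open (charts AX) U by case: tM' => -[/local_triv_open].
by exists (CommonTriv tM' (bimod_triv_sub tN oU U2U)).
Qed.

Definition rel_triv (c : common_triv) y : 'Hom(QF y, rel_tensor (ct_M c) (ct_N c)) :=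
  rel_map (ct_u c y) (ct_v c y).

Section OneTrivialization.
Variable c : common_triv.

Lemma ct_phiP : local_triv (structure_atlas (algebra_structure A)) (ct_dom c) (ct_phi c).
Proof. by case: (ct_left c) => -[]. Qed.

Lemma ct_psiP : local_triv (structure_atlas (algebra_structure B)) (ct_dom c) (ct_psi c).
Proof. by case: (ct_left c) => -[]. Qed.

Lemma ct_chiP : local_triv (structure_atlas (algebra_structure C)) (ct_dom c) (ct_chi c).
Proof. by case: (ct_right c) => -[]. Qed.

Lemma ct_uP : local_triv (structure_atlas (bimodule_structure M)) (ct_dom c) (ct_u c).
Proof. by case: (ct_left c) => -[]. Qed.

Lemma ct_vP : local_triv (structure_atlas (bimodule_structure N)) (ct_dom c) (ct_v c).
Proof. by case: (ct_right c) => -[]. Qed.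

Lemma ct_open : chart_open (charts AX) (ct_dom c).
Proof. exact: local_triv_open ct_phiP. Qed.

Lemma ct_balanced y : ct_dom c y -> balanced_pair (ct_u c y) (ct_psi c y) (ct_v c y).
Proof.
move=> cy; have [hphi _ _ i] := (ct_left c).2 y cy.
by have [_ _ hchi j] := (ct_right c).2 y cy; exact: intertwines_balanced hphi hchi i j.
Qed.

Lemma ct_bij y : ct_dom c y ->
  [/\ bijective (ct_u c y), bijective (ct_psi c y) & bijective (ct_v c y)].
Proof.
move=> cy; split; [exact: local_triv_bij ct_uP cy|exact: local_triv_bij ct_psiP cy|].
exact: local_triv_bij ct_vP cy.
Qed.

Lemma rel_triv_bij y : ct_dom c y -> bijective (rel_triv c y).
Proof.
by move=> cy; have [ub gb vb] := ct_bij cy; exact: rel_map_bij ub gb vb (ct_balanced cy).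
Qed.

Lemma rel_triv_inv y : ct_dom c y ->
  ((rel_triv c y)^-1)%VF = rel_map (ct_u c y)^-1%VF (ct_v c y)^-1%VF.
Proof.
move=> cy; have [ub gb vb] := ct_bij cy; have b := ct_balanced cy.
by apply: lfun_inv_unique; [exact: rel_mapK b|exact: rel_mapKV b].
Qed.

Definition ct_pair : pair_triv := PairTriv ct_uP ct_vP.

End OneTrivialization.

Lemma rel_triv_trans c d x : ct_dom c x -> ct_dom d x ->
  smooth_at AX (vect_atlas 'Hom(rel_tensor (ct_M c) (ct_N c), rel_tensor (ct_M d) (ct_N d)))
    (fun z => (rel_triv d z \o (rel_triv c z)^-1)%VF) x.
Proof.
move=> cx dx; have oN := chart_openI (@ct_open c) (@ct_open d).
apply: (smooth_at_eq oN (conj cx dx)); last apply: smooth_at_rel_map.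
- move=> z [cz dz]; have [ub gb vb] := ct_bij cz; rewrite rel_triv_inv //.
  have bV := balanced_pairV ub gb vb (ct_balanced cz).
  by rewrite (rel_map_comp bV (ct_balanced dz)).
- exact: transition_smooth (ct_uP c) (ct_uP d) cx dx.
- exact: transition_smooth (ct_vP c) (ct_vP d) cx dx.
Qed.

Definition rel_atlas : atlas R (total_space QF) :=
  bundle_atlas ct_open ct_cover rel_triv_bij rel_triv_trans.

Lemma rel_atlas_triv c : local_triv rel_atlas (ct_dom c) (rel_triv c).
Proof. exact: bundle_atlas_triv. Qed.

Lemma rel_atlas_bundle x : exists (U : set X) (V : vectType k)
  (t : forall y, 'Hom(QF y, V)), U x /\ local_triv rel_atlas U t.
Proof.
have [c cx] := ct_cover x; exists (ct_dom c), (rel_tensor (ct_M c) (ct_N c)), (rel_triv c).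
by split => //; exact: rel_atlas_triv.
Qed.

Definition rel_structure : smooth_structure R (total_space QF) :=
  bundle_structure rel_atlas_bundle.

Lemma tensor_atlas_bundle x : exists (U : set X) (V : vectType k)
  (t : forall y, 'Hom(TF y, V)), U x /\ local_triv tensor_atlas U t.
Proof.
have [p px] := pt_cover x; exists (pt_dom p), (tensor (pt_V p) (pt_W p)), (pt_map p).
by split => //; exact: tensor_triv.
Qed.

Lemma canonical_map_smooth e :
  smooth_at tensor_atlas rel_atlas (@canonical_map R s X A B C M N) e.
Proof.
have [c ce] := ct_cover (tag e).
have oN := tag_preimage_open tensor_atlas_bundle (@ct_open c).
pose G (q : X * tensor (ct_M c) (ct_N c)) := triv_inv (rel_triv c) (q.1, rel_proj _ _ q.2).
have Gs : smooth_at tensor_atlas rel_atlas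
    (fun e => G (tag e, pt_map (ct_pair c) (tag e) (tagged e))) e; last first.
  apply: (smooth_at_eq oN ce) Gs.
  move=> [z t] /= cz; rewrite /G /canonical_map /= /pt_map /=.
  rewrite -(rel_mapE _ (ct_balanced cz)) -[LHS]/(triv_inv (rel_triv c) (z, rel_triv c z _)).
  by rewrite triv_inv_in_fibre //; exact: rel_triv_bij.
apply: smooth_at_comp (local_triv_smooth (tensor_triv (ct_pair c)) ce) _.
apply: (smooth_at_comp (A' := prod_atlas AX (vect_atlas (rel_tensor (ct_M c) (ct_N c))))
  (f := fun q => (q.1, rel_proj (ct_M c) (ct_N c) q.2)) (g := triv_inv (rel_triv c))); last first.
  exact: (local_triv_inv_smooth (p := (_, _)) (rel_atlas_triv c)).
apply: smooth_at_pair; first exact: smooth_at_fst.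
by apply: smooth_at_lfun; exact: smooth_at_snd.
Qed.

Lemma rel_structureP : is_rel_tensor_structure rel_structure.
Proof.
split; first exact: rel_atlas_bundle.
rewrite tensor_atlasE; apply: smooth_at_on; first exact: chart_openT.
by move=> e _; exact: canonical_map_smooth.
Qed.

(** In a trivialization t0 of E, the inverse of [rel_triv c] at the class of a
    tensor p is the image under the canonical map of the section that is constantly
    p in the coordinates of c. So it is smooth, and one of the two transition maps
    is enough by [smooth_at_inv]. *)
Lemma rel_triv_local E : is_rel_tensor_structure (M := M) (N := N) E ->
  forall c, local_triv (structure_atlas E) (ct_dom c) (rel_triv c).
Proof.
move=> [Eb can] c; apply: local_triv_transition; first exact: (@ct_open c).
  exact: rel_triv_bij.
move=> y cy; have [U0 [V0 [t0 [U0y tt0]]]] := Eb y; exists U0, V0, t0.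
have {}tt0 : local_triv (structure_atlas E) U0 t0 by [].
split => //.
have oN := chart_openI (@ct_open c) (local_triv_open tt0).
have trb z : (ct_dom c `&` U0) z -> bijective (t0 z \o (rel_triv c z)^-1)%VF.
  move=> [cz U0z]; apply: bij_comp_lfun; last exact: local_triv_bij tt0 U0z.
  by apply: bij_lfunV; exact: rel_triv_bij.
apply: (smooth_at_eq oN (conj cy U0y)
  (f := fun z => ((t0 z \o (rel_triv c z)^-1)^-1)%VF)).
  move=> z [cz U0z]; apply: lfun_inv_compV; last exact: rel_triv_bij.
  exact: local_triv_bij tt0 U0z.
apply: (smooth_at_inv oN (conj cy U0y) trb); apply: smooth_at_hom => q.
have [p ->] := rel_projP q.
pose D := prod_atlas AX (vect_atlas (tensor (ct_M c) (ct_N c))).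
pose can_p z : total_space QF := canonical_map (triv_inv (pt_map (ct_pair c)) (z, p)).
have cps : smooth_at AX (structure_atlas E) can_p y.
  apply: (smooth_at_comp (A' := tensor_atlas)
    (f := fun z => triv_inv (pt_map (ct_pair c)) (z, p))).
    apply: (smooth_at_comp (A' := D) (f := fun z => (z, p))).
      by apply: smooth_at_pair; [exact: smooth_at_id|exact: smooth_at_cst].
    exact: (local_triv_inv_smooth (p := (_, _)) (tensor_triv (ct_pair c)) cy).
  by apply: (smooth_on_at (S := setT)); rewrite -?tensor_atlasE.
have := smooth_at_comp (smooth_at_comp cps (local_triv_smooth (e := can_p y) tt0 U0y))
  (@smooth_at_snd _ _ _ _ _ _).
apply: (smooth_at_eq oN (conj cy U0y)) => z [cz U0z] /=.
rewrite comp_lfunE; congr (t0 z _); rewrite /pt_map /=.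
have [ub gb vb] := ct_bij cz; have bV := balanced_pairV ub gb vb (ct_balanced cz).
by rewrite tmap_inv // rel_triv_inv // (rel_mapE _ bV).
Qed.

Lemma rel_tensor_bimodule_bundle E : is_rel_tensor_structure (M := M) (N := N) E ->
  is_bimodule_bundle (F := QF) E.
Proof.
move=> EP x; have [c cx] := ct_cover x.
exists (ct_dom c), (ct_A c), (ct_C c), (rel_tensor (ct_M c) (ct_N c)),
  (ct_phi c), (rel_triv c), (ct_chi c); split => //.
have L y (cy : ct_dom c y) := (ct_left c).2 y cy.
have P y (cy : ct_dom c y) := (ct_right c).2 y cy.
split.
- by split; [exact: ct_phiP|move=> y /L[]].
- split; first exact: rel_triv_local.
  move=> y cy; have [_ ue _ _] := L y cy; have [_ ve _ _] := P y cy.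
  exact: rel_map_even (ct_balanced cy) ue ve.
- by split; [exact: ct_chiP|move=> y /P[]].
- move=> y cy; have [_ _ [_ psi1 _] i] := L y cy; have [[_ _ _] _ _ j] := P y cy.
  apply: (rel_map_intertwines (ct_balanced cy)).
    exact: intertwines_lact i psi1.
  exact: intertwines_ract j psi1.
Qed.

End TwoBundles.
End RelativeTensorBundle.

Theorem theorem4p2p6 (R : realType) (s : scalar_kind) (X : manifold R)
    (A B C : algebra_bundle s X)
    (M : bimodule_bundle A B) (N : bimodule_bundle B C)
    (M_implementing : implementing_family M)
    (N_implementing : implementing_family N) :
  (exists E : smooth_structure R (total_space (rel_tensor_fibre M N)),
     is_rel_tensor_structure E) /\
  forall E : smooth_structure R (total_space (rel_tensor_fibre M N)),
    is_rel_tensor_structure E ->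
    is_bimodule_bundle E /\ implementing_family (rel_tensor_fibre M N).
Proof.
have M_right x : right_implementing (M x) := (M_implementing x).2.
split; first by exists (rel_structure N M_right); exact: rel_structureP.
move=> E EP; split; first exact: rel_tensor_bimodule_bundle M_right E EP.
by move=> x; exact: implementing_rel_tensor.
Qed.
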